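(* Let $\rho_0$ be a smooth probability density on $U$ (with respect to the uniform probability measure $m$ on $U$), bounded below by a positive constant. Let $\rho(\cdot,t)$ and the redistribution maps $X_{[t,0]}:U\to U$, $t\ge 0$, be generated from $\rho_0$ by the heat flow as described in the context. Let $Y$ be a random variable with values in $U$ whose law has density $\rho_0$ with respect to $m$. Let $Z$ be a random variable with uniform distribution on $U$ (that is, with law $m$), and define $Z_t = X_{[t,0]}(Z)$ for each $t\ge 0$. Then $Z_t$ converges to $Y$ in distribution as $t\to\infty$.
   Context: $U$ is a bounded connected domain in $\mathbb{R}^d$ with sufficiently regular boundary (Neumann boundary conditions), or a flat torus (periodic boundary conditions). $m$ is the uniform probability measure on $U$: $m(U)=1$, with constant density with respect to Lebesgue measure. All densities are with respect to $m$, so the uniform density is the constant $1$. Heat flow of the density: $\rho$ solves $\partial_t\rho=\Delta\rho$ on $U\times(0,\infty)$ with $\rho(\cdot,0)=\rho_0$ and, if $U$ has a boundary, $\partial_n\rho=0$ on $\partial U$. Equivalently, $\rho$ solves the continuity equation $\partial_t\rho+\nabla\cdot(\rho u)=0$ with velocity $$u(x,t)=-\nabla\log\rho(x,t).$$ Redistribution map: $X_B(x,t)=X_{[t,0]}(x)$ denotes the backward characteristic map of $u$, i.e. the solution of $\partial_tX_B+(u\cdot\nabla)X_B=0$, $X_B(x,0)=x$. Equivalently, $X_{[t,0]}(\gamma(t))=\gamma(0)$ for every curve $\gamma$ satisfying $\frac{d}{dt}\gamma(t)=u(\gamma(t),t)$. It satisfies $$\rho(x,t)=\rho_0(X_B(x,t))\,\det\nabla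 X_B(x,t).$$ Standing assumption: the velocity $u$ generates diffeomorphic characteristic maps, i.e. $X_{[t,0]}$ is a diffeomorphism of $U$ for every $t\ge0$. *)

(* Defs.v *)
From HB Require Import structures.
From mathcomp Require Import all_boot all_order all_algebra.
From mathcomp Require Import all_classical all_reals all_analysis.

Set Implicit Arguments.
Unset Strict Implicit.
Unset Printing Implicit Defensive.

Import Order.TTheory GRing.Theory Num.Theory.
Import numFieldNormedType.Exports.

Local Open Scope classical_set_scope.
Local Open Scope ring_scope.

(* R^d with its Borel sigma-algebra. *)
Notation borel R d := (g_sigma_algebraType (@open 'rV[R]_d)).

(* Lebesgue measure of a Borel subset of R^d, by iterated integration over the
   coordinates (so no product measure has to be constructed). *)
Fixpoint lebesgue_vol (R : realType) (d : nat) :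
    set 'rV[R]_d -> \bar R :=
  match d with
  | 0%N => fun A => (\1_A 0)%:E
  | d'.+1 => fun A => (\int[@lebesgue_measure R]_s
      lebesgue_vol [set y : 'rV[R]_d' | A (row_mx (s%:M : 'rV[R]_1) y)])%E
  end.

Section calculus.
Context {R : realType} {d : nat}.
Local Notation E := 'rV[R]_d.

(* The library norm on 'rV[R]_d is the sup norm, so the Euclidean structure is
   introduced by hand. *)
Definition dot (u v : E) : R := \sum_i u 0 i * v 0 i.

Definition basis_vec (i : 'I_d) : E := delta_mx 0 i.

Definition partial {W : normedModType R} (i : 'I_d) (f : E -> W) : E -> W :=
  fun x => 'D_(basis_vec i) f x.

Definition grad (f : E -> R) (x : E) : E := \row_i partial i f x.

Definition laplacian (f : E -> R) (x : E) : R :=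
  \sum_i partial i (partial i f) x.

(* Meant for open A. *)
Fixpoint Ck {W : normedModType R} (k : nat) (A : set E) (f : E -> W) : Prop :=
  (forall x, A x -> {for x, continuous f}) /\
  match k with
  | 0%N => True
  | k'.+1 => forall i, (forall x, A x -> derivable f x (basis_vec i)) /\
                       Ck k' A (partial i f)
  end.

Definition smooth_on (A : set E) (f : E -> R) : Prop := forall k, Ck k A f.

Definition diffeo {U : set E} (f : E -> E) : Prop :=
  exists g : E -> E,
    [/\ Ck 1 U f, Ck 1 U g,
        forall x, U x -> U (f x) /\ g (f x) = x &
        forall y, U y -> U (g y) /\ f (g y) = y].

Definition jointly_continuous {W : normedModType R} (A : set E) (I : set R)
    (f : E -> R -> W) : Prop :=
  {within A `*` I, continuous (fun z : E * R => f z.1 z.2)}.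

(* C^1 in space and time, jointly (for open A and I). *)
Definition C1_1 {W : normedModType R} (A : set E) (I : set R)
    (f : E -> R -> W) : Prop :=
  [/\ jointly_continuous A I f,
      forall x t, A x -> I t -> derivable (f x) t 1,
      jointly_continuous A I (fun x t => derive1 (f x) t) &
      forall i, (forall x t, A x -> I t -> derivable (f ^~ t) x (basis_vec i))
             /\ jointly_continuous A I (fun x t => partial i (f ^~ t) x)].

(* C^2 in space and C^1 in time. *)
Definition C2_1 {W : normedModType R} (A : set E) (I : set R)
    (f : E -> R -> W) : Prop :=
  C1_1 A I f /\
  forall i j,
    (forall x t, A x -> I t ->
       derivable (partial i (f ^~ t)) x (basis_vec j)) /\
    jointly_continuous A I (fun x t => partial j (partial i (f ^~ t)) x).

End calculus.

Arguments diffeo {R d} U f.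

Section domains.
Context {R : realType} {d : nat}.
Local Notation E := 'rV[R]_d.

Definition bdry (U : set E) : set E := closure U `\` interior U.

(* Near p, U is the sublevel set {phi < 0} of a C^1 function without critical
   points. *)
Definition local_defining (U : set E) (p : E) (phi : E -> R) : Prop :=
  exists W : set E,
    [/\ open W, W p, Ck 1 W phi, forall x, W x -> grad phi x != 0 &
        U `&` W = [set x | W x /\ phi x < 0]].

Definition C1_boundary (U : set E) : Prop :=
  forall p, bdry U p -> exists phi, local_defining U p phi.

Definition outward_normal (U : set E) (p n : E) : Prop :=
  exists2 phi, local_defining U p phi &
    n = (Num.sqrt (dot (grad phi p) (grad phi p)))^-1 *: grad phi p.

(* The lattice spanned by the rows of B, and its half-open fundamental cell. *)
Definition lattice (B : 'M[R]_d) : set E :=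
  [set v | exists k : 'rV[int]_d, v = map_mx intr k *m B].

Definition cell (B : 'M[R]_d) : set E :=
  [set v | exists2 s : E, (forall i, 0 <= s 0 i < 1) & v = s *m B].

(* [flow_space U L D]: the state space is U modulo translations by L, with
   fundamental domain D.  A flat torus is R^d modulo a lattice; functions on it
   are the L-periodic functions on R^d, its Borel sets are the L-invariant Borel
   sets of R^d, and points and random points are given by representatives in
   R^d.  For a bounded domain L = {0}, so periodicity and invariance are void. *)
Variant flow_space : set E -> set E -> set E -> Prop :=
| Bounded_domain (U : set E) of open U & U !=set0 & connected U &
    bounded_set U & C1_boundary U : flow_space U [set 0] U
| Flat_torus (B : 'M[R]_d) of B \in unitmx :
    flow_space setT (lattice B) (cell B).

Definition periodic {T : Type} (L : set E) (f : E -> T) : Prop :=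
  forall x l, L l -> f (x + l) = f x.

Definition uniform_on (D : set E) (m : probability (borel R d) R) : Prop :=
  exists c : R, forall A : set (borel R d), measurable A ->
    m A = (c%:E * lebesgue_vol (A `&` D))%E.

End domains.

Section flow.
Context {R : realType} {d : nat}.
Local Notation E := 'rV[R]_d.
Variables (U L : set E).

Record smooth_density (m : probability (borel R d) R) (rho0 : E -> R) : Prop :=
  { density_smooth : smooth_on U rho0;
    density_periodic : periodic L rho0;
    density_lower_bound : exists2 c : R, 0 < c & forall x, U x -> c <= rho0 x;
    density_mass : (\int[m]_(x in (U : set (borel R d))) (rho0 x)%:E = 1)%E }.

(* Classical solution.  Regularity up to the boundary means that rho(., t),
   t > 0, is regular on an open neighbourhood of the closure of U; the equation
   itself is only imposed in U.  When U is the whole space the boundary is empty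
   and the boundary condition is void. *)
Record heat_flow (rho0 : E -> R) (rho : E -> R -> R) : Prop :=
  { heat_regular : exists V : set E,
      [/\ open V, closure U `<=` V & C2_1 V [set t | 0 < t] rho];
    heat_continuous : jointly_continuous (closure U) [set t | 0 <= t] rho;
    heat_periodic : forall t, 0 <= t -> periodic L (rho ^~ t);
    heat_initial : forall x, U x -> rho x 0 = rho0 x;
    heat_equation : forall x t, U x -> 0 < t ->
      derive1 (rho x) t = laplacian (rho ^~ t) x;
    heat_neumann : forall p n t, bdry U p -> outward_normal U p n -> 0 < t ->
      'D_n (rho ^~ t) p = 0 }.

Definition velocity (rho : E -> R -> R) (x : E) (t : R) : E :=
  - grad (fun y => ln (rho y t)) x.

(* [X x t] is X_{[t,0]}(x).  The term (u . grad) X is the derivative of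
   X(., t) along u.  Equivariance says that X(., t) descends to the quotient
   of U by L. *)
Record redistribution (rho : E -> R -> R) (X : E -> R -> E) : Prop :=
  { redist_regular : C1_1 U [set t | 0 < t] X;
    redist_continuous : jointly_continuous U [set t | 0 <= t] X;
    redist_initial : forall x, U x -> X x 0 = x;
    redist_transport : forall x t, U x -> 0 < t ->
      derive1 (X x) t + 'D_(velocity rho x t) (X ^~ t) x = 0;
    redist_equivariant : forall x l t, L l -> 0 <= t ->
      X (x + l) t = X x t + l;
    redist_diffeo : forall t, 0 <= t -> diffeo U (X ^~ t) }.

(* The random point Y of U modulo L has law mu. *)
Definition has_law {dO} {Omega : measurableType dO} (P : probability Omega R)
    (Y : {RV P >-> borel R d}) (mu : set (borel R d) -> \bar R) : Prop :=
  (forall w, U (Y w)) /\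
  forall A : set (borel R d), measurable A ->
    periodic L (A : E -> Prop) -> distribution P Y A = mu A.

(* Weak convergence, tested on bounded continuous functions on U modulo L. *)
Definition cvg_in_distribution {dO dO'}
    {Omega : measurableType dO} {Omega' : measurableType dO'}
    (P : probability Omega R) (Z : R -> Omega -> E)
    (P' : probability Omega' R) (Y : Omega' -> E) : Prop :=
  forall f : E -> R,
    {within U, continuous f} -> (exists M, forall x, U x -> `|f x| <= M) ->
    periodic L f ->
    ('E_P[f \o Z t] @[t --> +oo%R] --> 'E_P'[f \o Y])%E.

End flow.

(* Main.v *)
(* Two facts give the theorem.

   Transport: for g = F o X_t one has rho d_t g = grad g . grad rho, because
   the velocity is - grad rho / rho, so the time derivative of
   int F(X_t) rho_t dm is int (g Lap rho + grad g . grad rho) dm, which vanishes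
   by the Neumann condition.  Hence int F(X_t) rho_t dm = int F rho_0 dm, and
   |E F(Z_t) - E F(Y)| = |int F(X_t) (1 - rho_t) dm| <= sup |F| int |1 - rho_t| dm.

   Relaxation: int (rho_t - 1)^2 dm decreases at the rate 2 int |grad rho_t|^2 dm,
   so the gradient is small in L^2 at some late times.  There rho_t is nearly
   constant on small balls (average over translations), hence on U, which is
   connected, and the constant is 1 by conservation of mass.

   The integrations by parts use only that m is locally translation invariant:
   no surface measure is needed.  At the boundary one multiplies by cutoffs
   chi_n; near a boundary point chi_n is a C^1 step in n phi, where phi is a
   defining function, the integral of its gradient stays bounded, and
   grad phi . grad rho is uniformly small in the layer where chi_n varies. *)

Require Import Defs.
From HB Require Import structures.
From mathcomp Require Import all_boot all_order all_algebra.
From mathcomp Require Import all_classical all_reals all_analysis.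
From mathcomp Require Import measurable_realfun lra ring.

Set Implicit Arguments.
Unset Strict Implicit.
Unset Printing Implicit Defensive.

Import Order.TTheory GRing.Theory Num.Theory.
Import numFieldNormedType.Exports.

Local Open Scope classical_set_scope.
Local Open Scope ring_scope.

(** The obstacle is low regularity at the edges of the data. [X] is C^1 on the open set [U] only, so
    the gradient of [g = F o X_t] may blow up at the boundary and [g] is not admissible in Green's
    formula up to the boundary. It is therefore always integrated against a cutoff; the error term
    left over contains [g] but no derivative of [g], and the bound on [F] alone makes it vanish. At
    time 0 there is only continuity, so identities are proved between positive times and passed to
    the limit along [1/(n+1)].

    Conservation of mass, the maximum principle (whence positivity of the density) and the decay
    used for relaxation are one identity for the integral of [h(rho_t)], with [h] affine, a cubed
    positive part, or a square. Small gradients are obtained along a sequence of times only;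
    monotonicity of the second moment carries the conclusion to all later times.

    Transport needs C^1 observables while weak convergence is tested on continuous ones, hence an
    approximation by C^1 functions, periodic on the torus. Laws are prescribed on [L]-invariant sets
    only, so expectations are recovered from superlevel sets of the test function. *)

(** * Borel structure of R^d *)

Lemma ball_rVP (R : realType) d (x y : 'rV[R]_d) (e : R) : 0 < e ->
  ball x e y <-> forall i, `|x 0 i - y 0 i| < e.
Proof.
move=> e0; split=> [[_ h] i|h]; first exact: (h 0 i).
by split=> // i j; rewrite (ord1 i); exact: h.
Qed.

Lemma rat_rV_dense (R : realType) d (x : 'rV[R]_d) (e : R) : 0 < e ->
  exists q : 'rV[rat]_d, ball (map_mx ratr q : 'rV[R]_d) e x.
Proof.
move=> e0.
have h i : exists q : rat, ratr q \in `]x 0 i - e, x 0 i + e[.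
  by apply: rat_in_itvoo; lra.
exists (\row_i projT1 (cid (h i))); apply/ball_rVP => // i; rewrite !mxE.
by case: cid => q /=; rewrite in_itv /= ltr_norml => /andP[? ?]; lra.
Qed.

(** Rational balls form a countable base. Balls of the sup norm are boxes, so this reduces Borel
    measurability of a map into R^d to its coordinates in [measurable_fun_rV]. *)
Lemma open_rV_ratballs (R : realType) d (O : set 'rV[R]_d) : open O ->
  O = \bigcup_(p in [set p : 'rV[rat]_d * nat |
        ball (map_mx ratr p.1 : 'rV[R]_d) p.2.+1%:R^-1 `<=` O])
      ball (map_mx ratr p.1 : 'rV[R]_d) p.2.+1%:R^-1.
Proof.
move=> oO; apply/seteqP; split=> [x Ox|x [p /= pO px]]; last exact: pO.
have /nbhs_ballP[e /= e0 he] := open_nbhs_nbhs (conj oO Ox).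
have [n _ hn] : exists2 n : nat, True & n.+1%:R^-1 < e / 2.
  have [n] := near_infty_natSinv_lt (PosNum (divr_gt0 e0 (ltr0Sn R 1))).
  by move=> _ /(_ n (leqnn n)) ?; exists n.
have n0 : 0 < n.+1%:R^-1 :> R by rewrite invr_gt0.
have [q hq] := rat_rV_dense x n0.
exists (q, n) => //= y qy; apply: he.
have -> : e = e / 2 + e / 2 by lra.
apply: (@ball_triangle _ _ (map_mx ratr q : 'rV[R]_d)).
  by apply/ball_sym/(le_ball (ltW hn)).
exact: (le_ball (ltW hn)).
Qed.

Lemma measurable_fun_rV (R : realType) d dT (T : measurableType dT)
    (D : set T) (h : T -> 'rV[R]_d) : measurable D ->
  (forall i, measurable_fun D (fun x => h x 0 i)) ->
  measurable_fun D (h : T -> borel R d).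
Proof.
move=> mD mh; apply: (@measurability _ _ T (borel R d) D h (@open 'rV[R]_d)) => // _ [B oB <-].
rewrite (open_rV_ratballs oB) preimage_bigcup setI_bigcupr bigcup_mkcond.
apply: countable_bigcupT_measurable => // -[q n]; case: ifP => // _ /=.
have -> : D `&` h @^-1` ball (map_mx ratr q : 'rV[R]_d) n.+1%:R^-1 =
    D `&` \bigcap_(i in [set: 'I_d]) (D `&` (fun x => h x 0 i) @^-1`
      (ball (ratr (q 0 i) : R) n.+1%:R^-1)).
  have n0 : 0 < n.+1%:R^-1 :> R by rewrite invr_gt0.
  apply/seteqP; split => x /=.
    move=> [Dx hx]; split => // i _ /=; split => //.
    by have := (ball_rVP _ _ n0).1 hx i; rewrite mxE.
  move=> [Dx hx]; split => //.
  by apply/ball_rVP => // i; rewrite mxE; exact: (hx i I).2.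
apply: measurableI => //; apply: fin_bigcap_measurable => [|i _].
  exact: finite_finset.
by apply: mh => //; exact: measurable_ball.
Qed.

Lemma open_measurable_rV (R : realType) d (A : set 'rV[R]_d) :
  open A -> measurable (A : set (borel R d)).
Proof. by move=> oA; apply: sub_sigma_algebra. Qed.

Lemma closed_measurable_rV (R : realType) d (A : set 'rV[R]_d) :
  closed A -> measurable (A : set (borel R d)).
Proof.
move=> cA; rewrite -[A]setCK; apply: (@measurableC _ (borel R d)).
by apply: open_measurable_rV; exact: closed_openC.
Qed.

Lemma measurable_fun_rV_continuous (R : realType) d (D : set 'rV[R]_d)
    (f : 'rV[R]_d -> R) : open D ->
  (forall x, D x -> {for x, continuous f}) ->
  measurable_fun (D : set (borel R d)) f.
Proof.
move=> oD cf; apply: (measurability _ (RGenOpens.measurableE R)).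
move=> _ [_ [a [b ->] <-]].
apply: open_measurable_rV; rewrite openE => x [Dx fx].
have h : \forall y \near x, f y \in `]a, b[.
  exact: (cf x Dx [set z | z \in `]a, b[] (near_in_itvoo fx)).
have h' : \forall y \near x, D y by apply: open_nbhs_nbhs.
by rewrite /interior /=; near do split.
Unshelve. all: by end_near. Qed.

Lemma measurable_coord (R : realType) d (i : 'I_d) :
  measurable_fun [set: borel R d] (fun x : 'rV[R]_d => x 0 i).
Proof.
by apply: (@measurable_fun_rV_continuous R d setT) => [|x _];
  [exact: openT|exact: coord_continuous].
Qed.

Lemma measurable_row_mx (R : realType) d1 d2 dT (T : measurableType dT)
    (D : set T) (f : T -> 'rV[R]_d1) (g : T -> 'rV[R]_d2) : measurable D ->
  measurable_fun D (f : T -> borel R d1) -> measurable_fun D (g : T -> borel R d2) ->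
  measurable_fun D (fun x => row_mx (f x) (g x) : borel R (d1 + d2)).
Proof.
move=> mD mf mg; apply: measurable_fun_rV => // i.
case: (split_ordP i) => j ->; under eq_fun do rewrite ?row_mxEl ?row_mxEr.
  exact: (measurableT_comp (measurable_coord j) mf).
exact: (measurableT_comp (measurable_coord j) mg).
Qed.

Lemma measurable_fun_scalar_row (R : realType) :
  measurable_fun setT ((fun s : R => s%:M) : R -> borel R 1).
Proof.
apply: measurable_fun_rV => // i; rewrite (ord1 i).
by under eq_fun do rewrite mxE eqxx mulr1n; exact: measurable_id.
Qed.

Lemma setT_ballE (R : realType) d :
  [set: 'rV[R]_d] = \bigcup_n ball (0 : 'rV[R]_d) n.+1%:R.
Proof.
apply/esym/seteqP; split => // x _; exists (Num.truncn `|x|).+1 => //.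
rewrite mx_norm_ball /ball_ /= sub0r normrN.
by apply: lt_le_trans (truncnS_gt _) _; rewrite ler_nat.
Qed.

Lemma ball_row_mxE (R : realType) d (s s0 : R) (y y0 : 'rV[R]_d) (r : R) :
  ball (row_mx (s0%:M : 'rV[R]_1) y0) r (row_mx (s%:M : 'rV[R]_1) y) <->
  ball s0 r s /\ ball y0 r y.
Proof.
split=> [[r0 h]|[h1 h2]].
  split.
    by have := h 0 (lshift d 0); rewrite !row_mxEl !mxE !mulr1n.
  split => // i j; have := h 0 (rshift 1 j).
  by rewrite !row_mxEr (ord1 i).
split => [|i j]; first by case: h2.
rewrite (ord1 i); case: (split_ordP j) => k ->.
  by rewrite !row_mxEl (ord1 k) !mxE eqxx !mulr1n.
by rewrite !row_mxEr; exact: h2.2.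
Qed.

Lemma row_mx_headE (R : realType) d (x : 'rV[R]_(1 + d)) :
  x = row_mx ((x 0 0)%:M : 'rV[R]_1) (rsubmx x).
Proof.
rewrite -[LHS]hsubmxK; congr (row_mx _ _).
apply/matrixP => i j; rewrite (ord1 i) (ord1 j) !mxE eqxx mulr1n.
by congr (x _ _); apply: val_inj.
Qed.

(** * Lebesgue measure on R^d and its translation invariance *)

Lemma sigma_finite_measure_of (R : realType) dT (T : measurableType dT)
    (nu : {measure set T -> \bar R}) : sigma_finite setT nu ->
  {mu : {sigma_finite_measure set T -> \bar R} | forall A, mu A = nu A}.
Proof.
move=> snu; pose H1 := isSigmaFinite.Build _ _ _ _ snu.
pose H2 := isSFinite.Build _ _ _ _ (sfinite_measure_sigma_finite snu).
pose mu := HB.pack_for (SigmaFiniteMeasure.type T R) (Measure.sort nu) H1 H2.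
by exists mu.
Qed.

(** [lebesgue_vol] is a bare set function; Tonelli and changes of variables need a sigma-finite
    measure. By induction on [d] this is the image of a product measure under [row_mx]. The bounds
    on balls travel with the induction: sup-norm balls are products of balls, and their finite
    measure yields sigma-finiteness in the next dimension. *)
Lemma lebesgue_vol_measure (R : realType) d :
  {mu : {sigma_finite_measure set (borel R d) -> \bar R} |
   (forall A : set (borel R d), measurable A -> mu A = lebesgue_vol A) /\
   (forall (x : 'rV[R]_d) r, 0 < r ->
     (0 < mu (ball x r : set (borel R d)) < +oo)%E)}.
Proof.
elim: d => [|d [mu [muE mub]]].
  exists (\d_(0 : borel R 0) : {sigma_finite_measure set (borel R 0) -> \bar R}).
  split => // x r r0; rewrite /= /dirac indicE mem_set ?lte01 ?ltry//.
  by split => // i [].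
pose g (p : R * borel R d) : borel R (1 + d) := row_mx (p.1%:M : 'rV[R]_1) (p.2 : 'rV[R]_d).
have mg : measurable_fun setT g.
  apply: (@measurable_row_mx R 1 d _ (R * borel R d)%type setT
    (fun p => p.1%:M) (fun p => p.2)) => //.
  exact: (measurableT_comp (@measurable_fun_scalar_row R) measurable_fst).
  exact: measurable_snd.
pose nu0 : {measure set (borel R d.+1) -> \bar R} :=
  pushforward (lebesgue_measure \x mu)%E g.
pose nu : {measure set (borel R d.+1) -> \bar R} := nu0 mg.
have nub (x : 'rV[R]_d.+1) r : 0 < r ->
    (0 < nu (ball x r : set (borel R d.+1)) < +oo)%E.
  move=> r0.
  have xE : x = row_mx ((x 0 0)%:M : 'rV[R]_1) (rsubmx (x : 'rV[R]_(1 + d))).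
    exact: (@row_mx_headE R d x).
  have -> : nu (ball x r : set (borel R d.+1)) =
    (lebesgue_measure \x mu)%E (ball (x 0 0) r `*`
      (ball (rsubmx (x : 'rV[R]_(1 + d))) r)).
    rewrite /nu /= /pushforward; congr (_ _).
    apply/seteqP; split => -[s y] /=.
      by rewrite /g {1}xE => /ball_row_mxE.
    by move=> h; rewrite /g xE; apply/ball_row_mxE.
  rewrite product_measure1E; last 2 first.
  - by exact: measurable_ball.
  - by apply: open_measurable_rV; exact: ball_open.
  set a := (X in (X * _)%E); have -> : a = (r *+ 2)%:E.
    exact: (@lebesgue_measure_ball R (x 0 0) r (ltW r0)).
  have /andP[h1 h2] := mub (rsubmx (x : 'rV[R]_(1 + d))) r r0.
  rewrite mule_gt0 ?lte_fin ?mulrn_wgt0//=.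
  by apply: lte_mul_pinfty => //; rewrite lee_fin mulrn_wge0// ltW.
have snu : sigma_finite setT nu.
  exists (fun n => ball (0 : 'rV[R]_d.+1) n.+1%:R); first exact: setT_ballE.
  move=> n; split; first by apply: open_measurable_rV; exact: ball_open.
  by have /andP[] := nub 0 n.+1%:R (ltr0Sn _ _).
have [snu' snuE] := sigma_finite_measure_of snu.
exists snu'; split => [A mA|x r r0]; rewrite snuE; last exact: nub.
rewrite /nu /= /pushforward /product_measure1 /=.
apply: eq_integral => s _; rewrite -muE; last first.
  rewrite (_ : [set y | _] = (fun y => g (s, y)) @^-1` A)//.
  rewrite -[X in measurable X]setTI.
  have : measurable_fun setT (fun y => g (s, y)) by apply: measurableT_comp.
  exact.
by congr (mu _); apply/seteqP; split => y /=; rewrite /xsection /= inE.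
Qed.

Definition vol (R : realType) d : {sigma_finite_measure set (borel R d) -> \bar R} :=
  sval (lebesgue_vol_measure R d).

Lemma volE (R : realType) d (A : set (borel R d)) : measurable A ->
  vol R d A = lebesgue_vol A.
Proof. exact: (svalP (lebesgue_vol_measure R d)).1. Qed.

Lemma vol_ball_gt0 (R : realType) d (x : 'rV[R]_d) r : 0 < r ->
  (0 < vol R d (ball x r : set (borel R d)))%E.
Proof. by move=> r0; have /andP[] := (svalP (lebesgue_vol_measure R d)).2 x r r0. Qed.

Lemma vol_ball_lty (R : realType) d (x : 'rV[R]_d) r : 0 < r ->
  (vol R d (ball x r : set (borel R d)) < +oo)%E.
Proof. by move=> r0; have /andP[] := (svalP (lebesgue_vol_measure R d)).2 x r r0. Qed.

Lemma measurable_shift (R : realType) d (v : 'rV[R]_d) :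
  measurable_fun setT ((fun x => x + v) : borel R d -> borel R d).
Proof.
apply: measurable_fun_rV => // i; under eq_fun do rewrite mxE.
by apply: measurable_funD => //; exact: measurable_coord.
Qed.

(** The image measure under a translation agrees with Lebesgue measure on half-open intervals, which
    characterises the latter. *)
Lemma lebesgue_measure_shift (R : realType) (a : R) (A : set R) : measurable A ->
  lebesgue_measure ((fun s => s + a) @^-1` A) = lebesgue_measure A.
Proof.
move=> mA.
have ms : measurable_fun setT (fun s : measurableTypeR R => s + a : measurableTypeR R).
  exact: measurable_funD.
pose nu0 : {measure set (measurableTypeR R) -> \bar R} :=
  pushforward lebesgue_measure (fun s : measurableTypeR R => s + a : measurableTypeR R).
pose nu := nu0 ms.
apply/esym/(@lebesgue_measure_unique R nu) => // _ [[b c]] _ <-.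
rewrite /nu /= /pushforward /=.
rewrite (_ : _ @^-1` _ = `]b - a, c - a]%classic); last first.
  by apply/seteqP; split => x /=; rewrite !in_itv /= => /andP[? ?]; apply/andP; split; lra.
rewrite !lebesgue_measure_itv /= !lte_fin ltrD2r; case: ifPn => // _.
by rewrite -!EFinD; congr EFin; lra.
Qed.

Lemma ge0_integral_lebesgue_shift (R : realType) (a : R) (f : R -> \bar R) :
  measurable_fun setT f -> (forall s, 0 <= f s)%E ->
  (\int[lebesgue_measure]_s f (s + a)%R = \int[lebesgue_measure]_s f s)%E.
Proof.
move=> mf f0.
have ms : measurable_fun setT (fun s : measurableTypeR R => s + a : measurableTypeR R).
  exact: measurable_funD.
rewrite -[LHS](ge0_integral_pushforward ms lebesgue_measure (D := setT)) //.
by apply: eq_measure_integral => A mA _; exact: lebesgue_measure_shift.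
Qed.

Lemma row_mx_head_add (R : realType) d (s : R) (y : 'rV[R]_d) (v : 'rV[R]_(1 + d)) :
  row_mx (s%:M : 'rV[R]_1) y + v = row_mx ((s + v 0 0)%:M : 'rV[R]_1) (y + rsubmx v).
Proof. by rewrite {1}(row_mx_headE v) add_row_mx -raddfD. Qed.

(** The head of [v] shifts the outer integration variable, which is the one-dimensional case, and
    its tail shifts the slices, which is the induction hypothesis. *)
Lemma lebesgue_vol_shift (R : realType) d (v : 'rV[R]_d) (A : set (borel R d)) :
  measurable A -> lebesgue_vol ((fun x => x + v) @^-1` A) = lebesgue_vol A.
Proof.
elim: d v A => [|d IH] v A mA /=.
  by have -> : +%R^~ v @^-1` A = A by apply/seteqP; split => y /=; rewrite [v]thinmx0 addr0.
(* Written with the measure [vol] because the measure of a slice is then a measurable function of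
   [s]. *)
pose F s := vol R d [set y : 'rV[R]_d | A (row_mx (s%:M : 'rV[R]_1) y)].
have mg : measurable_fun setT (fun p : R * borel R d =>
    row_mx (p.1%:M : 'rV[R]_1) (p.2 : 'rV[R]_d) : borel R (1 + d)).
  apply: (@measurable_row_mx R 1 d _ (R * borel R d)%type setT
    (fun p => p.1%:M) (fun p => p.2)) => //.
  exact: (measurableT_comp (@measurable_fun_scalar_row R) measurable_fst).
  exact: measurable_snd.
have mA' s : measurable ([set y | A (row_mx (s%:M : 'rV[R]_1) y)] : set (borel R d)).
  rewrite (_ : [set y | _] = xsection ((fun p : R * borel R d =>
    row_mx (p.1%:M : 'rV[R]_1) (p.2 : 'rV[R]_d) : borel R (1 + d)) @^-1` A) s); last first.
    by apply/seteqP; split => y /=; rewrite /xsection /= inE.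
  by apply: measurable_xsection; rewrite -[X in measurable X]setTI; exact: mg.
have mF : measurable_fun setT F.
  rewrite (_ : F = (vol R d) \o xsection ((fun p : R * borel R d =>
    row_mx (p.1%:M : 'rV[R]_1) (p.2 : 'rV[R]_d) : borel R (1 + d)) @^-1` A)).
    by apply: measurable_fun_xsection; rewrite -[X in measurable X]setTI; exact: mg.
  by apply/funext => s; congr (vol R d _); apply/seteqP; split => y /=; rewrite /xsection /= inE.
transitivity (\int[lebesgue_measure]_s F (s + v 0 0)%R)%E.
  apply: eq_integral => s _; rewrite /F volE//.
  rewrite -[RHS](IH (rsubmx (v : 'rV[R]_(1 + d))) _ (mA' _)).
  congr (lebesgue_vol _); apply/funext => y.
  exact: (congr1 (A : 'rV[R]_(1 + d) -> Prop) (row_mx_head_add s y (v : 'rV[R]_(1 + d)))).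
rewrite ge0_integral_lebesgue_shift //.
by apply: eq_integral => s _; rewrite /F volE.
Qed.

Lemma vol_shift (R : realType) d (v : 'rV[R]_d) (A : set (borel R d)) :
  measurable A -> vol R d ((fun x => x + v) @^-1` A) = vol R d A.
Proof.
move=> mA; rewrite !volE ?lebesgue_vol_shift//.
by rewrite -[X in measurable X]setTI; exact: measurable_shift.
Qed.

Lemma ge0_integral_vol_shift (R : realType) d (v : 'rV[R]_d) (f : 'rV[R]_d -> \bar R) :
  measurable_fun (setT : set (borel R d)) f -> (forall x, 0 <= f x)%E ->
  (\int[vol R d]_x f (x + v)%R = \int[vol R d]_x f x)%E.
Proof.
move=> mf f0.
rewrite -[LHS](ge0_integral_pushforward (measurable_shift v) (vol R d) (D := setT)) //.
apply: eq_measure_integral => [|ms A mA _]; [exact: measurable_shift|exact: vol_shift].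
Qed.

(** * Derivatives along lines, and differentiability from continuous partial derivatives *)

Section line_calculus.
Context {R : realType}.

(** Turns a directional derivative into a derivative in one real variable, the form taken by the
    mean value theorem and by differentiation under the integral. *)
Lemma is_derive_line {V W : normedModType R} (f : V -> W) (x v : V) (s : R) :
  derivable f (s *: v + x) v ->
  is_derive s 1 (fun h => f (h *: v + x)) ('D_v f (s *: v + x)).
Proof.
move=> df.
have gE : (fun h : R => h^-1 *: (((fun h => f (h *: v + x)) \o shift s) (h *: 1) -
    f (s *: v + x))) =
    (fun h => h^-1 *: ((f \o shift (s *: v + x)) (h *: v) - f (s *: v + x))).
  by apply/funext => h /=; rewrite [h *: 1]mulr1 scalerDl -addrA.
by apply: DeriveDef; rewrite ?/derivable ?/derive gE.
Qed.

End line_calculus.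

Lemma cvg_sumr {R : realType} {V : normedModType R} {T I : Type}
    (F : set_system T) {FF : Filter F} (r : seq I) (P : pred I)
    (f : I -> T -> V) (a : I -> V) :
  (forall i, P i -> f i x @[x --> F] --> a i) ->
  \sum_(i <- r | P i) f i x @[x --> F] --> \sum_(i <- r | P i) a i.
Proof. by move=> fa; apply: cvg_big => //; exact: add_continuous. Qed.

Lemma MVT0 {R : realType} (g dg : R -> R) (c : R) :
  (forall s : R, `|s| <= `|c| -> is_derive s 1 g (dg s)) ->
  exists2 s, `|s| <= `|c| & g c - g 0 = dg s * c.
Proof.
move=> gE.
have cg s : `|s| <= `|c| -> derivable g s 1 by move=> /gE ?; exact: ex_derive.
have [c0|c0] := leP 0 c.
  have le s : s \in `[0, c] -> `|s| <= `|c|.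
    by rewrite in_itv /= => /andP[s0 sc]; rewrite !ger0_norm.
  have [|s sI ->] := MVT_segment c0 (fun s sI => gE s (le s (subset_itv_oo_cc sI))).
    by apply: derivable_within_continuous => s /le/cg.
  by exists s; [exact: le|rewrite subr0].
have le s : s \in `[c, 0] -> `|s| <= `|c|.
  by rewrite in_itv /= => /andP[s0 sc]; rewrite !ler0_norm ?lerN2// ltW.
have [|s sI E] := MVT_segment (ltW c0) (fun s sI => gE s (le s (subset_itv_oo_cc sI))).
  by apply: derivable_within_continuous => s /le/cg.
by exists s; [exact: le|rewrite -[LHS]opprB E sub0r mulrN opprK].
Qed.

Lemma near_eq_continuous {T S : topologicalType} (f g : T -> S) (x : T) :
  (\forall y \near x, f y = g y) -> {for x, continuous f} -> {for x, continuous g}.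
Proof.
move=> fg cf; have gx : g x = f x by rewrite (nbhs_singleton fg).
rewrite /prop_for /continuous_at gx.
by apply: cvg_trans cf; apply: near_eq_cvg; apply: filterS fg.
Qed.

Lemma continuous_translate {R : realType} {V : normedModType R} (v : V) :
  continuous (fun x => v + x).
Proof.
move=> x; have h : v + z @[z --> x] --> v + x by apply: cvgD; [exact: cvg_cst|exact: cvg_id].
exact: h.
Qed.

Section continuity_at_a_point.
Context {R : realType} {T : topologicalType} (x : T).
Implicit Types f g : T -> R.

Lemma continuous_atD f g : {for x, continuous f} -> {for x, continuous g} ->
  {for x, continuous (fun y => f y + g y)}.
Proof.
move=> cf cg; exact: (@cvgD _ _ _ (nbhs x) _ f g _ _ (cf : f y @[y --> x] --> f x) cg).
Qed.

Lemma continuous_atM f g : {for x, continuous f} -> {for x, continuous g} ->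
  {for x, continuous (fun y => f y * g y)}.
Proof.
move=> cf cg; exact: (@cvgM _ _ (nbhs x) _ f g _ _ (cf : f y @[y --> x] --> f x) cg).
Qed.

Lemma continuous_atN f : {for x, continuous f} -> {for x, continuous (fun y => - f y)}.
Proof.
by move=> cf; exact: (@cvgN _ _ _ (nbhs x) _ f _ (cf : f y @[y --> x] --> f x)).
Qed.

Lemma continuous_at_norm f : {for x, continuous f} -> {for x, continuous (fun y => `|f y|)}.
Proof.
by move=> cf; exact: (@cvg_norm _ _ _ (nbhs x) _ f _ (cf : f y @[y --> x] --> f x)).
Qed.

Lemma continuous_at_cst (r : R) : {for x, continuous (fun _ : T => r)}.
Proof. exact: cst_continuous. Qed.

Lemma continuous_at_sum (I : Type) (s : seq I) (f : I -> T -> R) :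
  (forall i, {for x, continuous (f i)}) ->
  {for x, continuous (fun y => \sum_(i <- s) f i y)}.
Proof.
by move=> cf; apply: (@cvg_sumr R R T I (nbhs x) _ s xpredT f (fun i => f i x)) => i _; exact: cf.
Qed.

Lemma continuous_at_comp (h : R -> R) f : {for x, continuous f} ->
  {for f x, continuous h} -> {for x, continuous (fun y => h (f y))}.
Proof. by move=> cf ch; exact: (continuous_comp cf ch). Qed.

Lemma near_gt_at f (a : R) : {for x, continuous f} -> a < f x ->
  \forall y \near x, a < f y.
Proof. by move=> cf h; exact: (cf [set y | a < y] (open_nbhs_nbhs (conj (@open_gt R a) h))). Qed.

Lemma near_lt_at f (a : R) : {for x, continuous f} -> f x < a ->
  \forall y \near x, f y < a.
Proof. by move=> cf h; exact: (cf [set y | y < a] (open_nbhs_nbhs (conj (@open_lt R a) h))). Qed.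

End continuity_at_a_point.

Section open_congruence.
Context {R : realType} {V W : normedModType R} (U : set V) (f g : V -> W).
Hypotheses (oU : open U) (fg : forall y, U y -> f y = g y).

Lemma eq_near_open x : U x -> \forall y \near x, f y = g y.
Proof.
move=> Ux; have : \forall y \near x, U y by exact: open_nbhs_nbhs.
by apply: filterS.
Qed.

Lemma eq_open_continuous x : U x -> {for x, continuous f} -> {for x, continuous g}.
Proof. by move=> /eq_near_open h; exact: near_eq_continuous. Qed.

Lemma eq_open_derivable x v : U x -> derivable f x v -> derivable g x v.
Proof. by move=> /eq_near_open h; exact: near_eq_derivable. Qed.

Lemma eq_open_derive x v : U x -> 'D_v f x = 'D_v g x.
Proof. by move=> /eq_near_open h; exact: near_eq_derive. Qed.

End open_congruence.

Section rV_calculus.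
Context {R : realType} {d : nat}.
Local Notation E := 'rV[R]_d.

Lemma coord_le_norm (v : E) i : `|v 0 i| <= `|v|.
Proof.
by rewrite [leRHS]/Num.Def.normr/= mx_normrE; exact: (le_bigmax _ (fun ij => `|v ij.1 ij.2|) (0, i)).
Qed.

Lemma norm_rV_le (v : E) r : 0 <= r -> (forall i, `|v 0 i| <= r) -> `|v| <= r.
Proof.
move=> r0 h; rewrite [leLHS]/Num.Def.normr/= mx_normrE.
by apply: bigmax_le => // -[i j] _; rewrite (ord1 i).
Qed.

Lemma norm_basis_vec (i : 'I_d) : `|@basis_vec R d i| <= 1.
Proof.
by apply: norm_rV_le => // j; rewrite mxE eqxx /=; case: eqP; rewrite /= ?normr1 ?normr0.
Qed.

Definition linear_form (a : 'I_d -> R) (v : E) : R := \sum_i v 0 i * a i.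

Lemma linear_form_is_linear a : linear (linear_form a).
Proof.
move=> k u v; rewrite /linear_form scaler_sumr -big_split; apply: eq_bigr => i _ /=.
by rewrite !mxE mulrDl [_ *: _]mulrA.
Qed.

HB.instance Definition _ a := GRing.isLinear.Build R E R _ (linear_form a)
  (linear_form_is_linear a).

Lemma continuous_linear_form a : continuous (linear_form a).
Proof.
move=> x; apply: continuous_at_sum => i.
by apply: continuous_atM; [exact: coord_continuous|exact: continuous_at_cst].
Qed.

(* Telescoping along the coordinates turns continuity of the partial
   derivatives into a first order expansion. *)
Lemma partials_first_order (f : E -> R) (x : E) (r e : R) :
  (forall y, ball x r y -> forall i, derivable f y (basis_vec i)) ->
  (forall y, ball x r y -> forall i, `|partial i f y - partial i f x| <= e) ->
  forall h, `|h| < r ->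
    `|f (x + h) - f x - linear_form (fun i => partial i f x) h| <= e * `|h| *+ d.
Proof.
move=> df cf h hr.
(* [T k] keeps the first [k] coordinates of [h], and [S k] is the matching part of the linear
   form. *)
pose T k : E := \row_i (if (i < k)%N then h 0 i else 0).
pose S k : R := \sum_(i < d | (i < k)%N) h 0 i * partial i f x.
have main k : (k <= d)%N -> `|f (x + T k) - f x - S k| <= e * `|h| *+ k.
  elim: k => [_|k IH kd].
    have -> : T 0%N = 0 by apply/rowP => i; rewrite !mxE.
    by rewrite /S big_pred0 => [|i]; rewrite ?addr0 ?subrr ?subr0 ?normr0.
  pose j := Ordinal kd.
  have TE : T k.+1 = h 0 j *: basis_vec j + T k.
    apply/rowP => i; rewrite !mxE eqxx /= ltnS leq_eqVlt -val_eqE /=.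
    by case: eqVneq => [ik|_] /=; rewrite ?mulr0 ?add0r// ik ltnn mulr1 addr0; congr (h 0 _); exact: val_inj.
  have SE : S k.+1 = h 0 j * partial j f x + S k.
    rewrite /S (bigD1 j)//=; congr (_ + _); apply: eq_bigl => i.
    by rewrite ltnS -val_eqE /= ltn_neqAle andbC.
  (* In the sup norm the points of the telescoping path are no further from [x] than [|h|]. *)
  have near (s : R) : `|s| <= `|h 0 j| -> ball x r (s *: basis_vec j + (x + T k)).
    move=> sh; rewrite mx_norm_ball /ball_ /= opprD addrCA opprD addNKr -opprD normrN.
    apply: le_lt_trans hr; apply: norm_rV_le => // i.
    rewrite !mxE eqxx /= -val_eqE /=; case: eqVneq => [ik|_] /=.
      by rewrite ik ltnn mulr1 addr0 (le_trans sh)// coord_le_norm.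
    by rewrite mulr0 add0r; case: ifP; rewrite ?normr0// coord_le_norm.
  have [s sh gE] := @MVT0 R (fun s => f (s *: basis_vec j + (x + T k)))
    (fun s => partial j f (s *: basis_vec j + (x + T k))) (h 0 j)
    (fun s sh => is_derive_line (df _ (near s sh) j)).
  rewrite scale0r add0r in gE.
  have -> : x + T k.+1 = h 0 j *: basis_vec j + (x + T k) by rewrite TE addrCA.
  rewrite SE mulrS.
  have -> : f (h 0 j *: basis_vec j + (x + T k)) - f x - (h 0 j * partial j f x + S k) =
    (partial j f (s *: basis_vec j + (x + T k)) - partial j f x) * h 0 j + (f (x + T k) - f x - S k).
    by rewrite mulrBl -gE; ring.
  rewrite (le_trans (ler_normD _ _))// lerD ?IH ?(ltnW kd)// normrM ler_pM//.
    by apply: cf; exact: near.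
  exact: coord_le_norm.
have := main d (leqnn d); rewrite (_ : T d = h).
  by rewrite /S (eq_bigl xpredT)// => i; rewrite ltn_ord.
by apply/rowP => i; rewrite mxE ltn_ord.
Qed.

Lemma C1_is_diff (f : E -> R) (x : E) :
  (\forall y \near x, forall i, derivable f y (basis_vec i)) ->
  (forall i, {for x, continuous (partial i f)}) ->
  differentiable f x /\ 'd f x = linear_form (fun i => partial i f x) :> (E -> R).
Proof.
move=> df cf.
have key : f \o shift x = cst (f x) + (linear_form (fun i => partial i f x) : E -> R)
    +o_ (0 : E) id.
  apply/eqaddoP => _/posnumP[e].
  (* The expansion accumulates [d] errors; [d.+1] keeps the quotient meaningful when [d = 0]. *)
  have e0 : 0 < e%:num / d.+1%:R by rewrite divr_gt0.
  have /nbhs_ballP[r /= r0 hr] : \forall y \near x, (forall i, derivable f y (basis_vec i)) /\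
      forall i, `|partial i f y - partial i f x| <= e%:num / d.+1%:R.
    have cf' : \forall y \near x, forall i, `|partial i f y - partial i f x| <= e%:num / d.+1%:R.
      have ff := @filter_forall E 'I_d (fun i y => `|partial i f y - partial i f x| <= e%:num / d.+1%:R) (nbhs x); apply: ff.
      move=> i; have /cvgrPdist_le/(_ _ e0) := cf i.
      by apply: filterS => y; rewrite distrC.
    by near do split => //.
  near=> h => /=.
  have hr' : `|h| < r.
    by near: h; apply/nbhs_ballP; exists r => // y; rewrite mx_norm_ball /ball_ /= sub0r normrN.
  have := @partials_first_order f x r (e%:num / d.+1%:R)
    (fun y hy => (hr y hy).1) (fun y hy => (hr y hy).2) h hr'.
  rewrite !fctE [h + x]addrC opprD addrA => /le_trans; apply.
  rewrite -mulr_natr mulrAC ler_wpM2r//.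
  by rewrite mulrAC ler_pdivrMr// ler_wpM2l// ler_nat.
have dfE := diff_unique (@continuous_linear_form _) key.
split => //; apply/diff_locallyP; rewrite dfE; split => //.
exact: continuous_linear_form.
Unshelve. all: by end_near. Qed.

Lemma C1_derivable (f : E -> R) (x v : E) :
  (\forall y \near x, forall i, derivable f y (basis_vec i)) ->
  (forall i, {for x, continuous (partial i f)}) ->
  derivable f x v /\ 'D_v f x = \sum_i v 0 i * partial i f x.
Proof.
move=> df cf; have [h1 h2] := C1_is_diff df cf.
by split; [exact: diff_derivable|rewrite deriveE// h2].
Qed.

Lemma C1_chain (f : E -> R) (g : R -> E) (s : R) :
  (\forall y \near g s, forall i, derivable f y (basis_vec i)) ->
  (forall i, {for g s, continuous (partial i f)}) ->
  derivable g s 1 ->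
  is_derive s 1 (f \o g) (\sum_i ('D_1 g s) 0 i * partial i f (g s)).
Proof.
move=> df cf dg; have [h1 h2] := C1_is_diff df cf.
have dg' : differentiable g s by apply/derivable1_diffP.
have h3 : differentiable (f \o g) s by exact: differentiable_comp.
apply: DeriveDef; first exact: diff_derivable.
by rewrite [LHS]deriveE// diff_comp//= h2 [in RHS]deriveE.
Qed.

End rV_calculus.

(** * Integrals of bounded measurable functions *)

Section bounded_integrals.
Context {R : realType} {d : nat}.
Local Notation E := 'rV[R]_d.
Variable m : probability (borel R d) R.
Variable U : set E.
Hypothesis oU : open U.

(** Stable under sums and products and contained in the integrable functions of a probability
    measure, so integrability conditions reduce to boundedness. *)
Definition bounded_meas (f : E -> R) : Prop :=
  measurable_fun (U : set (borel R d)) f /\ exists M : R, forall x, U x -> `|f x| <= M.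

Definition mint (f : E -> R) : R := \int[m]_(x in (U : set (borel R d))) f x.

Let mU : measurable (U : set (borel R d)).
Proof. exact: open_measurable_rV. Qed.

Lemma bounded_meas_integrable f : bounded_meas f ->
  m.-integrable (U : set (borel R d)) (EFin \o f).
Proof.
move=> [mf [M fM]]; apply: measurable_bounded_integrable => //.
  by apply: le_lt_trans (probability_le1 m mU) _; rewrite ltry.
by exists M; split; rewrite ?num_real// => x Mx y Uy; exact: le_trans (fM y Uy) (ltW Mx).
Qed.

Lemma bounded_meas_continuous f (M : R) : (forall x, U x -> {for x, continuous f}) ->
  (forall x, U x -> `|f x| <= M) -> bounded_meas f.
Proof.
by move=> cf fM; split; [exact: measurable_fun_rV_continuous|exists M].
Qed.

Lemma bounded_meas_cst r : bounded_meas (cst r).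
Proof. by split; [exact: measurable_cst|exists `|r|]. Qed.

Lemma bounded_measD f g : bounded_meas f -> bounded_meas g ->
  bounded_meas (fun x => f x + g x).
Proof.
move=> [mf [M fM]] [mg [N gN]]; split; first exact: measurable_funD.
by exists (M + N) => x Ux; rewrite (le_trans (ler_normD _ _))// lerD ?fM ?gN.
Qed.

Lemma bounded_measM f g : bounded_meas f -> bounded_meas g ->
  bounded_meas (fun x => f x * g x).
Proof.
move=> [mf [M fM]] [mg [N gN]]; split; first exact: measurable_funM.
by exists (M * N) => x Ux; rewrite normrM ler_pM ?fM ?gN.
Qed.

Lemma bounded_measN f : bounded_meas f -> bounded_meas (fun x => - f x).
Proof.
move=> [mf [M fM]]; split; first exact: measurableT_comp.
by exists M => x Ux; rewrite normrN fM.
Qed.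

Lemma bounded_measB f g : bounded_meas f -> bounded_meas g ->
  bounded_meas (fun x => f x - g x).
Proof. by move=> hf hg; apply: bounded_measD => //; exact: bounded_measN. Qed.

Lemma bounded_meas_norm f : bounded_meas f -> bounded_meas (fun x => `|f x|).
Proof.
move=> [mf [M fM]]; split; first exact: measurableT_comp.
by exists M => x Ux; rewrite normr_id fM.
Qed.

Lemma bounded_measX f n : bounded_meas f -> bounded_meas (fun x => f x ^+ n).
Proof.
move=> hf; elim: n => [|n IH]; first exact: bounded_meas_cst.
by under eq_fun do rewrite exprS; exact: bounded_measM.
Qed.

Lemma bounded_meas_sum (I : Type) (r : seq I) (f : I -> E -> R) :
  (forall i, bounded_meas (f i)) -> bounded_meas (fun x => \sum_(i <- r) f i x).
Proof.
move=> hf; elim: r => [|i r IH].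
  by under eq_fun do rewrite big_nil; exact: bounded_meas_cst.
by under eq_fun do rewrite big_cons; exact: bounded_measD.
Qed.

Lemma mintD f g : bounded_meas f -> bounded_meas g ->
  mint (fun x => f x + g x) = mint f + mint g.
Proof. by move=> hf hg; apply: RintegralD => //; exact: bounded_meas_integrable. Qed.

Lemma mintB f g : bounded_meas f -> bounded_meas g ->
  mint (fun x => f x - g x) = mint f - mint g.
Proof. by move=> hf hg; apply: RintegralB => //; exact: bounded_meas_integrable. Qed.

Lemma mintZ r f : bounded_meas f -> mint (fun x => r * f x) = r * mint f.
Proof. by move=> hf; apply: RintegralZl => //; exact: bounded_meas_integrable. Qed.

Lemma mintN f : bounded_meas f -> mint (fun x => - f x) = - mint f.
Proof.
by move=> hf; rewrite -mulN1r -mintZ//; congr mint; apply/funext => x; rewrite mulN1r.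
Qed.

Lemma mint_sum (I : Type) (r : seq I) (f : I -> E -> R) :
  (forall i, bounded_meas (f i)) ->
  mint (fun x => \sum_(i <- r) f i x) = \sum_(i <- r) mint (f i).
Proof.
move=> hf; elim: r => [|i r IH].
  rewrite big_nil; under [X in mint X]eq_fun do rewrite big_nil.
  by rewrite /mint Rintegral_cst// mul0r.
rewrite big_cons -IH -mintD//; last exact: bounded_meas_sum.
by congr mint; apply/funext => x; rewrite big_cons.
Qed.

Lemma eq_mint f g : (forall x, U x -> f x = g x) -> mint f = mint g.
Proof. by move=> fg; apply: eq_Rintegral => x; rewrite inE => /fg. Qed.

Lemma le_mint f g : bounded_meas f -> bounded_meas g ->
  (forall x, U x -> f x <= g x) -> mint f <= mint g.
Proof. by move=> hf hg fg; apply: le_Rintegral => //; exact: bounded_meas_integrable. Qed.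

Lemma mint_ge0 f : (forall x, U x -> 0 <= f x) -> 0 <= mint f.
Proof. by move=> f0; apply: Rintegral_ge0. Qed.

Lemma le_norm_mint f : bounded_meas f -> `|mint f| <= mint (fun x => `|f x|).
Proof. by move=> hf; apply: le_normr_Rintegral => //; exact: bounded_meas_integrable. Qed.

Lemma mint_EFin f : bounded_meas f ->
  (mint f)%:E = (\int[m]_(x in (U : set (borel R d))) (f x)%:E)%E.
Proof.
move=> hf; rewrite /mint /Rintegral fineK//; apply: integrable_fin_num => //.
exact: bounded_meas_integrable.
Qed.

Hypothesis mU1 : m (U : set (borel R d)) = 1%E.

Lemma mint_cst r : mint (cst r) = r.
Proof. rewrite /mint Rintegral_cst// -[RHS]mulr1; congr (_ * _).
exact: (congr1 fine mU1). Qed.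

Lemma mint_le_cst f r : bounded_meas f -> (forall x, U x -> f x <= r) -> mint f <= r.
Proof. by move=> hf fr; rewrite -[leRHS]mint_cst; apply: le_mint => //; exact: bounded_meas_cst. Qed.

Lemma mint_cvg (f : nat -> E -> R) (g : E -> R) (M : R) :
  (forall n, measurable_fun (U : set (borel R d)) (f n)) ->
  (forall n x, U x -> `|f n x| <= M) ->
  (forall x, U x -> f n x @[n --> \oo] --> g x) ->
  mint (f n) @[n --> \oo] --> mint g.
Proof.
move=> mf fM fg.
have hf n : bounded_meas (f n) by split => //; exists M; exact: fM.
have mg : measurable_fun (U : set (borel R d)) g.
  by apply: (measurable_fun_cvg mf) => x Ux; exact: fg.
have hg : bounded_meas g.
  split => //; exists M => x Ux; have cM : `|f n x| @[n --> \oo] --> `|g x|.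
    by apply: cvg_norm; exact: fg.
  have icM : cvg (`|f n x| @[n --> \oo]) by apply/cvg_ex; exists (`|g x|).
  by rewrite -(cvg_lim _ cM)//; apply: limr_le => //; apply: nearW => n; exact: fM.
have [|||||_ _ h] := @dominated_convergence _ _ R m (U : set (borel R d)) mU
  (fun n => EFin \o f n) (EFin \o g) (cst M%:E).
- by move=> n; apply/measurable_EFinP; exact: mf.
- exact/measurable_EFinP.
- by apply: aeW => x Ux; apply: cvg_EFin; [exact: nearW|exact: fg].
- exact: (bounded_meas_integrable (bounded_meas_cst M)).
- by apply: aeW => x n Ux /=; rewrite lee_fin fM.
apply: fine_cvg; move: h; rewrite -mint_EFin//.
Unshelve. all: by end_near. Qed.

End bounded_integrals.

(** * Points away from the boundary, and the common interface of the two state spaces *)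

Section inner_points.
Context {R : realType} {d : nat}.
Local Notation E := 'rV[R]_d.
Implicit Types (U L : set E).

(** For [r > 0], the points at sup-distance at least [r] from the complement. Vanishing outside some
    [inner U r] replaces compact support: it also suits periodic functions on the whole space, where
    [inner U r] is everything. *)
Definition inner U (r : R) : set E := [set x | ball x r `<=` U].

Lemma inner_sub U r : 0 < r -> inner U r `<=` U.
Proof. by move=> r0 x; apply; exact: ballxx. Qed.

Lemma inner_le U r s : s <= r -> inner U r `<=` inner U s.
Proof. by move=> sr x h y /(le_ball sr)/h. Qed.

Lemma inner_closed U r : closed (inner U r).
Proof.
rewrite -[inner U r]setCK; apply: open_closedC; rewrite openE => x /= nx.
have [y [xy nUy]] : exists y, ball x r y /\ ~ U y.
  by apply: contrapT => h; apply: nx => y xy; apply: contrapT => nUy; apply: h; exists y.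
have [e e0 he] : exists2 e, 0 < e & `|x - y| + e < r.
  move: xy; rewrite mx_norm_ball /ball_ /= => xy.
  by exists ((r - `|x - y|) / 2); lra.
apply/nbhs_ballP; exists e => //= z xz h; apply: nUy; apply: h.
rewrite mx_norm_ball /ball_ /= -(subrKA x) addrC (le_lt_trans (ler_normD _ _))//.
rewrite (lt_trans _ he)// ltrD2l distrC.
by move: xz; rewrite mx_norm_ball.
Qed.

Lemma ball_shift (x l y : E) r : ball (x + l) r y <-> ball x r (y - l).
Proof.
by rewrite !mx_norm_ball /ball_ /= opprB addrA.
Qed.

Lemma inner_periodic U L r x l : (forall x l, L l -> U x -> U (x + l)) -> L l ->
  inner U r x -> inner U r (x + l).
Proof.
move=> per Ll h y /ball_shift/h Uyl; rewrite -[y](subrK l); exact: per.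
Qed.

End inner_points.

(* All that transport and relaxation use of the state space; both the domain and
   the torus provide it. *)
Record flow_facts (R : realType) (d : nat) (U L : set 'rV[R]_d)
    (m : probability (borel R d) R) : Prop := {
  ff_open : open U;
  ff_conn : connected U;
  ff_nonempty : U !=set0;
  ff_mU : m (U : set (borel R d)) = 1%E;
  ff_opp : forall l, L l -> L (- l);
  ff_shift : forall x l, L l -> U x -> U (x + l);
  ff_cover : exists C, [/\ compact C, C `<=` closure U &
    forall x, closure U x -> exists2 l, L l & C (x + l)];
  ff_tight : forall e : R, 0 < e -> exists K, [/\ compact K, K `<=` U &
    (m ((U `\` K) : set (borel R d)) <= e%:E)%E];
  ff_trans : forall (w : 'rV[R]_d -> R) (r : R) (v : 'rV[R]_d), Defs.periodic L w ->
    bounded_meas setT w -> (forall x, ~ inner U r x -> w x = 0) -> `|v| < r ->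
    mint m U (fun x => w (x + v)) = mint m U w;
  ff_vol : forall x, U x -> exists r C : R, [/\ 0 < r, 0 <= C, ball x r `<=` U &
    forall w : 'rV[R]_d -> R, Defs.periodic L w ->
      measurable_fun (U : set (borel R d)) w -> (forall x, U x -> 0 <= w x) ->
      (\int[vol R d]_(y in (ball x r : set (borel R d))) (w y)%:E <=
       C%:E * \int[m]_(y in (U : set (borel R d))) (w y)%:E)%E];
  ff_dom : exists2 C : R, 0 <= C & forall A : set (borel R d), measurable A ->
    (m A <= C%:E * vol R d A)%E }.

(** * Compactness modulo the lattice, and integrals of partial derivatives *)

Section compact_modulo.
Context {R : realType} {d : nat} {U L : set 'rV[R]_d} {m : probability (borel R d) R}.
Local Notation E := 'rV[R]_d.
Hypothesis ff : flow_facts U L m.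

(** [S] may be unbounded, as on the torus. The bound is taken on a compact set of representatives
    and spread by periodicity. *)
Lemma jointly_continuous_bounded (S : set E) (a b : R) (f : E -> R -> R) :
  closed S -> S `<=` closure U -> (forall x l, L l -> S x -> S (x + l)) ->
  jointly_continuous S `[a, b]%classic f ->
  (forall t x l, a <= t <= b -> L l -> S x -> f (x + l) t = f x t) ->
  exists M : R, forall x t, S x -> a <= t <= b -> `|f x t| <= M.
Proof.
move=> cS SU Sper cf fper; have [C [cC CU Ccov]] := ff_cover ff.
have cK : compact ((S `&` C) `*` `[a, b]%classic).
  apply: compact_setX; last exact: segment_compact.
  by rewrite setIC; exact: compact_closedI.
have cf' : {within (S `&` C) `*` `[a, b]%classic, continuous (fun z : E * R => f z.1 z.2)}.
  by apply: continuous_subspaceW cf => -[x t] [[]].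
have [M [_ hM]] := compact_bounded (continuous_compact cf' cK).
exists (M + 1) => x t Sx abt.
have [l Ll Cxl] := Ccov x (SU x Sx).
rewrite -(fper t x l abt Ll Sx); apply: hM; first by rewrite ltrDl.
exists (x + l, t) => //; split => /=; first by split => //; exact: Sper.
by rewrite in_itv.
Qed.

Lemma inner_shift r x l : L l -> inner U r x -> inner U r (x + l).
Proof. exact: (inner_periodic (ff_shift ff)). Qed.

Lemma inner_sub_closure r : 0 < r -> inner U r `<=` closure U.
Proof. by move=> r0 x /(inner_sub r0); exact: subset_closure. Qed.

Lemma inner_bounded (w : E -> R) r : 0 < r -> Defs.periodic L w ->
  (forall x, U x -> {for x, continuous w}) ->
  exists M : R, forall x, inner U r x -> `|w x| <= M.
Proof.
move=> r0 wper cw.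
(* A function independent of time, on the degenerate interval [[0, 0]]. *)
have [|||||M hM] := @jointly_continuous_bounded (inner U r) 0 0 (fun x _ => w x).
- exact: inner_closed.
- exact: inner_sub_closure.
- by move=> x l; exact: inner_shift.
- apply: continuous_in_subspaceT => -[x t] /set_mem[/= Ux _].
  apply: (@continuous_comp (E * R)%type E R fst w (x, t)); first exact: cvg_fst.
  by apply: cw; exact: inner_sub Ux.
- by move=> t x l _ Ll _; exact: wper.
by exists M => x Ux; apply: (hM x 0 Ux); rewrite lexx.
Qed.

Lemma periodic_partial (w : E -> R) i : Defs.periodic L w ->
  Defs.periodic L (partial i w).
Proof.
move=> wper x l Ll; rewrite /partial /derive.
set g := (fun h => _); set g' := (fun h => _); suff -> : g = g' by [].
by apply/funext => h; rewrite /g /g' /= addrA !(wper _ _ Ll).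
Qed.

(* By translation invariance [h |-> int w(x + h e_i) dm] is constant near [0]. *)
Lemma mint_partial0 (w : E -> R) (i : 'I_d) (r : R) : 0 < r -> Defs.periodic L w ->
  (forall x, U x -> ~ inner U r x -> w x = 0) ->
  (forall x, U x -> {for x, continuous w}) ->
  (forall x, U x -> derivable w x (basis_vec i)) ->
  (forall x, U x -> {for x, continuous (partial i w)}) ->
  mint m U (partial i w) = 0.
Proof.
move=> r0 wper w0 cw dw cdw.
have oU := ff_open ff.
have mU : measurable (U : set (borel R d)) by exact: open_measurable_rV.
(* Extension of [w] by zero, which is C^1 on the whole space and can thus be translated freely. *)
pose v x := if `[< inner U r x >] then w x else 0.
have vE x : U x -> v x = w x.
  by move=> Ux; rewrite /v; case: asboolP => // nx; rewrite w0.
(* Smoothness of [v] is checked on an open cover: [U], where [v = w], and the union of the [r]-balls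
   centred outside [U]. Those balls miss [inner U r], so [v] vanishes on them. *)
have ZE : exists Z : set E, [/\ open Z, U `|` Z = setT & forall x, Z x -> v x = 0].
  exists (\bigcup_(x in ~` U) ball x r); split.
  - by apply: bigcup_open => x _; exact: ball_open.
  - apply/seteqP; split => // x _; have [Ux|nUx] := pselect (U x); first by left.
    by right; exists x => //; exact: ballxx.
  - move=> x [y nUy yx]; rewrite /v; case: asboolP => // ix.
    by exfalso; apply: nUy; apply: ix; exact: ball_sym.
have {ZE} [Z [oZ UZ vZ]] := ZE.
have cov x : U x \/ Z x by have : (U `|` Z) x by rewrite UZ.
have v_per : Defs.periodic L v.
  move=> x l Ll; rewrite /v; case: asboolP => ix; case: asboolP => iy //.
  - by rewrite wper.
  - exfalso; apply: iy; rewrite -[x](addrK l); apply: inner_shift => //.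
    exact: (ff_opp ff).
  - by exfalso; apply: ix; exact: inner_shift.
have wv x : U x -> w x = v x by move=> /vE.
have zv x : Z x -> cst 0 x = v x by move=> /vZ.
have dv x : derivable v x (basis_vec i).
  have [Ux|Zx] := cov x.
    by apply: (eq_open_derivable oU wv Ux); exact: dw.
  by apply: (eq_open_derivable oZ zv Zx); exact: derivable_cst.
have cv x : {for x, continuous v}.
  have [Ux|Zx] := cov x.
    by apply: (eq_open_continuous oU wv Ux); exact: cw.
  by apply: (eq_open_continuous oZ zv Zx); exact: cst_continuous.
have pvU x : U x -> partial i w x = partial i v x.
  by move=> Ux; exact: (eq_open_derive oU wv).
have pvZ x : Z x -> cst 0 x = partial i v x.
  by move=> Zx; rewrite /partial -(eq_open_derive oZ zv)// derive_cst.
have cpv x : {for x, continuous (partial i v)}.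
  have [Ux|Zx] := cov x.
    by apply: (eq_open_continuous oU pvU Ux); exact: cdw.
  by apply: (eq_open_continuous oZ pvZ Zx); exact: cst_continuous.
have n0 x : ~ inner U r x -> v x = 0 by move=> nx; rewrite /v; case: asboolP.
have [M0 hM0] := inner_bounded r0 wper cw.
have vM x : `|v x| <= `|M0|.
  rewrite /v; case: asboolP => ix; last by rewrite normr0.
  by rewrite (le_trans (hM0 x ix))// ler_norm.
have pv_per : Defs.periodic L (partial i v).
  exact: periodic_partial.
have [M1 hM1] := inner_bounded r0 pv_per (fun x _ => cpv x).
have pvM x : `|partial i v x| <= `|M1|.
  have [ix|nix] := pselect (inner U r x).
    by rewrite (le_trans (hM1 x ix))// ler_norm.
  have oI : open (~` inner U r) by apply: closed_openC; exact: inner_closed.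
  have e0 y : (~` inner U r) y -> cst 0 y = v y by move=> /n0.
  by rewrite /partial -(eq_open_derive oI e0)// derive_cst normr0.
have vB : bounded_meas setT v.
  by apply: (@bounded_meas_continuous _ _ _ openT _ `|M0|).
pose F (h : R) := mint m U (fun x => v (h *: basis_vec i + x)).
have FE h : `|h| < r -> F h = mint m U v.
  move=> hr; rewrite /F -(ff_trans ff (v := h *: basis_vec i) v_per vB n0).
    by congr (mint _ _ _); apply/funext => x; rewrite addrC.
  rewrite normrZ (le_lt_trans _ hr)// ler_piMr//; exact: norm_basis_vec.
have F0 : derive1 F 0 = 0.
  have FB h : ball (0 : R) r h -> F h = cst (mint m U v) h.
    by rewrite /ball /= sub0r normrN => /FE.
  rewrite derive1E (eq_open_derive (ball_open (0 : R) r) FB (1 : R) (ballxx _ r0)).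
  exact: derive_cst.
have dF : derive1 F 0 = mint m U (partial i v).
  rewrite (@differentiation_under_integral R _ (borel R d) m
    (fun h x => v (h *: basis_vec i + x)) U mU 0 (- r) r _ _ _ (cst `|M1|)).
  - apply: eq_mint => x Ux; rewrite partial1of2E.
    have := is_derive_line (dv (0 *: basis_vec i + x)).
    by move=> h; rewrite derive_val scale0r add0r.
  - by rewrite /= in_itv /= oppr_lt0 r0.
  - move=> h _; apply: bounded_meas_integrable => //.
    apply: (@bounded_meas_continuous _ _ _ oU _ `|M0|) => // x Ux.
    apply: continuous_comp; last exact: cv.
    exact: continuous_translate.
  - move=> h x _ Ux; have hd := is_derive_line (dv (h *: basis_vec i + x)).
    exact: ex_derive.
  - by move=> x /=.
  - exact: bounded_meas_integrable (bounded_meas_cst _ _).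
  - move=> h x _ Ux /=; rewrite partial1of2E.
    have hd := is_derive_line (dv (h *: basis_vec i + x)).
    by rewrite derive_val; exact: pvM.
by rewrite -F0 dF; apply: eq_mint => x /pvU.
Qed.

End compact_modulo.

(* Stated over an arbitrary normed module: unification is much faster there
   than over row vectors. *)
Section C1_along.
Context {R : realType} {V : normedModType R} {I : Type} (e : I -> V).
Implicit Types (U : set V) (f g : V -> R).

Definition C1_along U f : Prop := forall x, U x ->
  {for x, continuous f} /\
  forall i, derivable f x (e i) /\ {for x, continuous (fun y => 'D_(e i) f y)}.

Lemma C1_along_sub U U' f : U' `<=` U -> C1_along U f -> C1_along U' f.
Proof. by move=> UU' cf x /UU' /cf. Qed.

Lemma C1_along_congr U f g : open U -> (forall x, U x -> f x = g x) ->
  C1_along U f -> C1_along U g.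
Proof.
move=> oU fg cf x Ux; have [c h] := cf x Ux; split=> [|i].
  exact: (eq_open_continuous oU fg Ux c).
have [di ci] := h i; split; first exact: (eq_open_derivable oU fg Ux di).
apply: (eq_open_continuous oU _ Ux ci) => y Uy.
exact: (eq_open_derive oU fg).
Qed.

Lemma C1_along_cst U r : C1_along U (cst r).
Proof.
move=> x _; split=> [|i]; first exact: cst_continuous.
split; first exact: derivable_cst.
rewrite (_ : (fun _ => _) = cst 0); first exact: cst_continuous.
by apply/funext => y; rewrite derive_cst.
Qed.

Lemma derivableM_fun v f g x : derivable f x v -> derivable g x v ->
  derivable (fun x => f x * g x) x v.
Proof. move=> df dg; have h := @derivableM R V f g x v df dg; exact: h. Qed.

Lemma derivableD_fun v f g x : derivable f x v -> derivable g x v ->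
  derivable (fun x => f x + g x) x v.
Proof. move=> df dg; have h := @derivableD R V R f g x v df dg; exact: h. Qed.

Lemma deriveD_fun v f g x : derivable f x v -> derivable g x v ->
  'D_v (fun x => f x + g x) x = 'D_v f x + 'D_v g x.
Proof. by move=> df dg; rewrite -deriveD. Qed.

Lemma deriveM_fun v f g x : derivable f x v -> derivable g x v ->
  'D_v (fun x => f x * g x) x = 'D_v f x * g x + f x * 'D_v g x.
Proof.
move=> df dg; have := @deriveM R V f g x v df dg; rewrite /GRing.scale /= => h.
by rewrite addrC [_ * g x]mulrC -h.
Qed.

Lemma derive_cstM v (a : R) f x : derivable f x v ->
  'D_v (fun x => a * f x) x = a * 'D_v f x.
Proof. by move=> df; rewrite (deriveM_fun (derivable_cst a x v) df) derive_cst mul0r add0r. Qed.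

Lemma C1_alongD U f g : open U -> C1_along U f -> C1_along U g ->
  C1_along U (fun x => f x + g x).
Proof.
move=> oU cf cg x Ux; have [fx hf] := cf x Ux; have [gx hg] := cg x Ux.
split=> [|i]; first exact: continuous_atD.
have [df cdf] := hf i; have [dg cdg] := hg i; split; first exact: derivableD.
apply: (eq_open_continuous oU _ Ux (continuous_atD cdf cdg)) => y Uy /=.
exact: esym (deriveD_fun ((cf y Uy).2 i).1 ((cg y Uy).2 i).1).
Qed.

Lemma C1_alongM U f g : open U -> C1_along U f -> C1_along U g ->
  C1_along U (fun x => f x * g x).
Proof.
move=> oU cf cg x Ux; have [fx hf] := cf x Ux; have [gx hg] := cg x Ux.
split=> [|i]; first exact: continuous_atM.
have [df cdf] := hf i; have [dg cdg] := hg i; split; first exact: derivableM_fun.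
apply: (eq_open_continuous oU _ Ux
  (continuous_atD (continuous_atM cdf gx) (continuous_atM fx cdg))) => y Uy /=.
exact: esym (deriveM_fun ((cf y Uy).2 i).1 ((cg y Uy).2 i).1).
Qed.

Lemma C1_along_sum (J : Type) (r : seq J) U (f : J -> V -> R) : open U ->
  (forall i, C1_along U (f i)) -> C1_along U (fun x => \sum_(i <- r) f i x).
Proof.
move=> oU cf; elim: r => [|i r IH].
  by under eq_fun do rewrite big_nil; exact: C1_along_cst.
by under eq_fun do rewrite big_cons; exact: C1_alongD.
Qed.

Lemma C1_along_prod (J : Type) (r : seq J) U (f : J -> V -> R) : open U ->
  (forall i, C1_along U (f i)) -> C1_along U (fun x => \prod_(i <- r) f i x).
Proof.
move=> oU cf; elim: r => [|i r IH].
  by under eq_fun do rewrite big_nil; exact: C1_along_cst.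
by under eq_fun do rewrite big_cons; exact: C1_alongM.
Qed.

Lemma is_derive_comp_real (h : R -> R) f x v dh :
  is_derive (f x) 1 h dh -> derivable f x v ->
  is_derive x v (fun y => h (f y)) (dh * 'D_v f x).
Proof.
move=> hh df.
have e0 : 0 *: v + x = x by rewrite scale0r add0r.
have df0 : derivable f (0 *: v + x) v by rewrite e0.
have h1 := is_derive_line df0.
have hh' : is_derive (f (0 *: v + x)) 1 h dh by rewrite e0.
have h2 : is_derive (0 : R) 1 (h \o (fun s => f (s *: v + x))) (dh * 'D_v f (0 *: v + x)).
  exact: is_derive1_comp.
rewrite e0 in h2.
apply: DeriveDef.
  by apply/derivable1P; exact: ex_derive.
rewrite -(@derive_val _ _ _ _ _ _ _ h2) /derive; set g1 := fun h => _; set g2 := fun h => _.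
suff -> : g1 = g2 by [].
by apply/funext => s; rewrite /g1 /g2 /= addr0 scale0r add0r [s *: 1]mulr1.
Qed.

Lemma C1_along_comp U (S : set R) f (h dh : R -> R) : open U ->
  (forall x, U x -> S (f x)) ->
  (forall s, S s -> is_derive s 1 h (dh s)) -> (forall s, S s -> {for s, continuous dh}) ->
  C1_along U f ->
  C1_along U (fun x => h (f x)) /\
  (forall x i, U x -> 'D_(e i) (fun x => h (f x)) x = dh (f x) * 'D_(e i) f x).
Proof.
move=> oU fS hh cdh cf.
have pE x i : U x -> is_derive x (e i) (fun x => h (f x)) (dh (f x) * 'D_(e i) f x).
  move=> Ux; apply: is_derive_comp_real; first exact/hh/fS.
  exact: ((cf x Ux).2 i).1.
split; last by move=> x i Ux; have h1 := pE x i Ux; rewrite derive_val.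
move=> x Ux; have [fx hf] := cf x Ux; split=> [|i].
  apply: continuous_at_comp fx _; apply: differentiable_continuous.
  by apply/derivable1_diffP; have h1 := hh _ (fS x Ux); exact: ex_derive.
have [df cdf] := hf i; split; first by have h1 := pE x i Ux; exact: ex_derive.
have c := continuous_atM (continuous_at_comp fx (cdh _ (fS x Ux))) cdf.
apply: (eq_open_continuous oU _ Ux c) => y Uy /=.
by have h1 := pE y i Uy; rewrite derive_val.
Qed.

End C1_along.

Section C1_on.
Context {R : realType} {d : nat}.
Local Notation E := 'rV[R]_d.
Implicit Types (U : set E) (f g : E -> R).

Definition C1_on U f : Prop := C1_along (@basis_vec R d) U f.

Lemma C1_on_coord U (i : 'I_d) : C1_on U (fun x => x 0 i).
Proof.
have D (x : E) j : is_derive x (basis_vec j) (fun x : E => x 0 i) (i == j)%:R.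
  have hid : derivable (id : E -> E) x (basis_vec j) by exact: derivable_id.
  apply: DeriveDef; first exact: ((derivable_mxP _ _ _).1 hid 0 i).
  have := derive_mx hid; rewrite derive_id => /matrixP/(_ 0 i).
  by rewrite !mxE eqxx /= => <-.
move=> x _; split=> [|j]; first exact: coord_continuous.
split; first by have h := D x j; exact: ex_derive.
rewrite (_ : (fun y : E => 'D_(basis_vec j) (fun x : E => x 0 i) y) =
  (fun=> (i == j)%:R : R)); first exact: cst_continuous.
by apply/funext => y; have h := D y j; rewrite derive_val.
Qed.

Lemma Ck1_C1_on U f : Ck 1 U f -> C1_on U f.
Proof.
move=> [cf h] x Ux; split=> [|i]; first exact: cf.
by have [df [cdf _]] := h i; split; [exact: df|exact: cdf].
Qed.

Lemma C1_on_near U f x : open U -> U x -> C1_on U f ->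
  \forall y \near x, forall i, derivable f y (basis_vec i).
Proof.
move=> oU Ux cf; have : \forall y \near x, U y by exact: open_nbhs_nbhs.
by apply: filterS => y Uy i; exact: ((cf y Uy).2 i).1.
Qed.

Lemma C1_on_derive U f x v : open U -> U x -> C1_on U f ->
  derivable f x v /\ 'D_v f x = \sum_i v 0 i * partial i f x.
Proof.
move=> oU Ux cf; apply: C1_derivable; first exact: C1_on_near cf.
by move=> i; exact: ((cf x Ux).2 i).2.
Qed.

End C1_on.

Arguments C1_along_sub {R V I e U U' f}.
Arguments C1_along_congr {R V I e U f g}.
Arguments C1_along_cst {R V I} e U r.
Arguments C1_alongD {R V I e U f g}.
Arguments C1_alongM {R V I e U f g}.
Arguments C1_along_sum {R V I e J} r {U f}.
Arguments C1_along_prod {R V I e J} r {U f}.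
Arguments C1_on_coord {R d} U i.
Arguments Ck1_C1_on {R d U f}.
Arguments C1_on_near {R d U f x}.
Arguments C1_on_derive {R d U f x} v.

(** * C^1 steps and bumps *)

Section smooth_step.
Context {R : realType}.

(** The squared positive part is C^1 and vanishes exactly on [s <= 0]. It builds [step], and its
    primitive is the convex function of [initial_barrier]. *)
Definition sqpos (s : R) : R := Num.max s 0 ^+ 2.
Definition dsqpos (s : R) : R := 2 * Num.max s 0.

Lemma is_derive_sqpos (s : R) : is_derive s 1 sqpos (dsqpos s).
Proof.
have sq (x : R) : is_derive x 1 (fun x => x ^+ 2) (2 * x).
  apply: DeriveDef; first exact: exprn_derivable.
  by rewrite -derive1E exp_derive1.
have [s0|s0|s0] := ltgtP s 0.
- have o : open [set x : R | x < 0] by exact: open_lt.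
  have e : forall x, x < 0 -> cst 0 x = sqpos x.
    by move=> x x0; rewrite /sqpos max_r ?expr0n//= ltW.
  apply: DeriveDef; first by apply: (eq_open_derivable o e s0); exact: derivable_cst.
  by rewrite -(eq_open_derive o e)// derive_cst /dsqpos max_r ?mulr0// ltW.
- have o : open [set x : R | 0 < x] by exact: open_gt.
  have e : forall x, 0 < x -> x ^+ 2 = sqpos x.
    by move=> x x0; rewrite /sqpos max_l// ltW.
  apply: DeriveDef; first by apply: (eq_open_derivable o e s0); exact: ex_derive.
  by rewrite -(eq_open_derive o e)// derive_val /dsqpos max_l// ltW.
(* At the kink the difference quotient is bounded by [|h|]. *)
- have lim0 : h^-1 *: ((sqpos \o shift 0) (h *: 1) - sqpos 0) @[h --> (0:R)^'] --> (0 : R).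
    apply/cvgrPdist_le => /= e e0; near=> h.
    have hn0 : h != 0 by near: h; exact: nbhs_dnbhs_neq.
    rewrite sub0r normrN addr0 [h *: 1]mulr1 /sqpos maxxx expr0n /= subr0.
    rewrite /GRing.scale /= normrM normfV ler_pdivrMl ?normr_gt0// normrX.
    have mh : `|Num.max h 0| <= `|h|.
      by rewrite ger0_norm ?le_max ?lexx ?orbT// ge_max normr_ge0 ler_norm.
    have he : `|h| <= e by near: h; exact: dnbhs0_le.
    by rewrite expr2 ler_pM// (le_trans mh).
  rewrite s0; apply: DeriveDef; first by apply/cvg_ex; exists 0.
  by rewrite /dsqpos maxxx mulr0; apply/cvg_lim.
Unshelve. all: by end_near. Qed.

Lemma continuous_dsqpos : continuous dsqpos.
Proof.
move=> s.
have c : {for s, continuous (fun x : R => Num.max x 0)}.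
  have := @continuous_max R R id (cst 0) s cvg_id (cvg_cst 0); exact.
exact: (@continuous_atM R R s (fun=> 2) (fun x => Num.max x 0) (@continuous_at_cst _ _ s 2) c).
Qed.

(** A C^1 transition from 0 on [s <= 1] to 1 on [2 <= s]. The two terms of the denominator never
    vanish together. *)
Definition step (s : R) : R := sqpos (s - 1) / (sqpos (s - 1) + sqpos (2 - s)).
(** The quotient rule after cancellation of the common product, a form in which the sign is
    visible. *)
Definition dstep (s : R) : R :=
  (dsqpos (s - 1) * sqpos (2 - s) + sqpos (s - 1) * dsqpos (2 - s)) /
  (sqpos (s - 1) + sqpos (2 - s)) ^+ 2.

Lemma sqpos_ge0 (s : R) : 0 <= sqpos s. Proof. exact: sqr_ge0. Qed.
Lemma dsqpos_ge0 (s : R) : 0 <= dsqpos s.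
Proof. by rewrite mulr_ge0// le_max lexx orbT. Qed.
Lemma sqpos_gt0 (s : R) : 0 < s -> 0 < sqpos s.
Proof. by move=> s0; rewrite /sqpos exprn_gt0// lt_max s0. Qed.
Lemma sqpos_le0 (s : R) : s <= 0 -> sqpos s = 0.
Proof. by move=> s0; rewrite /sqpos max_r// expr0n. Qed.
Lemma dsqpos_le0 (s : R) : s <= 0 -> dsqpos s = 0.
Proof. by move=> s0; rewrite /dsqpos max_r// mulr0. Qed.

Lemma step_denom_gt0 (s : R) : 0 < sqpos (s - 1) + sqpos (2 - s).
Proof.
have [s1|s1] := ltP 1 s.
  by rewrite ltr_wpDr ?sqpos_ge0// sqpos_gt0// subr_gt0.
by rewrite ltr_wpDl ?sqpos_ge0// sqpos_gt0//; lra.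
Qed.

Lemma step_ge0 (s : R) : 0 <= step s.
Proof. by rewrite divr_ge0 ?sqpos_ge0// ltW// step_denom_gt0. Qed.

Lemma step_le1 (s : R) : step s <= 1.
Proof. by rewrite ler_pdivrMr ?step_denom_gt0// mul1r lerDl sqpos_ge0. Qed.

Lemma step_eq0 (s : R) : s <= 1 -> step s = 0.
Proof. by move=> s1; rewrite /step sqpos_le0 ?mul0r// subr_le0. Qed.

Lemma step_eq1 (s : R) : 2 <= s -> step s = 1.
Proof.
move=> s2; rewrite /step (@sqpos_le0 (2 - s)) ?subr_le0// addr0 divff//.
by rewrite gt_eqF// sqpos_gt0//; lra.
Qed.

Lemma dstep_ge0 (s : R) : 0 <= dstep s.
Proof. by rewrite divr_ge0 ?sqr_ge0// addr_ge0// mulr_ge0// ?sqpos_ge0 ?dsqpos_ge0. Qed.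

Lemma dstep_eq0 (s : R) : 2 <= s -> dstep s = 0.
Proof.
move=> s2; rewrite /dstep (@sqpos_le0 (2 - s)) ?subr_le0//.
by rewrite (@dsqpos_le0 (2 - s)) ?subr_le0// !mulr0 addr0 mul0r.
Qed.

Lemma is_derive_step (s : R) : is_derive s 1 step (dstep s).
Proof.
have ha : is_derive s 1 (fun s => sqpos (s - 1)) (dsqpos (s - 1)).
  have h1 := is_derive_sqpos (s - 1).
  have h2 : is_derive s 1 (fun s : R => s - 1) 1 by apply: is_derive_eq; rewrite subr0.
  have := @is_derive1_comp _ sqpos (fun s => s - 1) s _ _ h1 h2.
  by rewrite mulr1.
have hb : is_derive s 1 (fun s => sqpos (2 - s)) (- dsqpos (2 - s)).
  have h1 := is_derive_sqpos (2 - s).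
  have h2 : is_derive s 1 (fun s : R => 2 - s) (-1).
    have h3 : is_derive s 1 ((cst 2 : R -> R) - (id : R -> R)) (0 - 1) by exact: is_deriveB.
    by rewrite sub0r in h3.
  have := @is_derive1_comp _ sqpos (fun s => 2 - s) s _ _ h1 h2.
  by rewrite mulrN1.
have n0 : (fun s => sqpos (s - 1) + sqpos (2 - s)) s != 0 by rewrite gt_eqF// step_denom_gt0.
have hc : is_derive s 1 (fun s => sqpos (s - 1) + sqpos (2 - s)) (dsqpos (s - 1) - dsqpos (2 - s)).
  exact: is_deriveD.
have hi := @realfun.is_deriveV R (fun s => sqpos (s - 1) + sqpos (2 - s)) s _ 1 n0 hc.
have hm := @is_deriveM R R (fun s : R => sqpos (s - 1))
  (fun s : R => (sqpos (s - 1) + sqpos (2 - s))^-1) s 1 _ _ ha hi.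
apply: (is_derive_eq hm).
rewrite /dstep /GRing.scale /=.
field.
by rewrite gt_eqF// step_denom_gt0.
Qed.

Lemma continuous_dstep : continuous dstep.
Proof.
have cs : continuous sqpos.
  move=> s; apply: differentiable_continuous; apply/derivable1_diffP.
  by have h := is_derive_sqpos s; exact: ex_derive.
have ci (s : R) : {for s, continuous (fun x : R => x)} by exact: cvg_id.
have c1 (f : R -> R) (s : R) : continuous f -> {for s, continuous (fun s : R => f (s - 1))}.
  move=> cf; apply: (@continuous_at_comp _ _ s f (fun s : R => s - 1)); last exact: cf.
  by apply: continuous_atD; [exact: ci|exact: continuous_at_cst].
have c2 (f : R -> R) (s : R) : continuous f -> {for s, continuous (fun s : R => f (2 - s))}.
  move=> cf; apply: (@continuous_at_comp _ _ s f (fun s : R => 2 - s)); last exact: cf.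
  by apply: continuous_atD; [exact: continuous_at_cst|exact: continuous_atN].
have cd := continuous_dsqpos.
move=> s.
have n0 : (sqpos (s - 1) + sqpos (2 - s)) ^+ 2 != 0.
  by rewrite gt_eqF// exprn_gt0// step_denom_gt0.
have hn := continuous_atD (continuous_atM (c1 _ s cd) (c2 _ s cs))
  (continuous_atM (c1 _ s cs) (c2 _ s cd)).
have hden := continuous_atD (c1 _ s cs) (c2 _ s cs).
have hi := @continuous_at_comp _ _ s (fun x : R => x^-1) _
  (continuous_atM hden hden) (inv_continuous n0).
exact: (continuous_atM hn hi).
Qed.

End smooth_step.

Lemma compact_within_closed {T S : topologicalType} (K : set T) (f : T -> S) (C : set S) :
  compact K -> {within K, continuous f} -> closed C -> compact (K `&` f @^-1` C).
Proof.
move=> cK cf cC.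
move: cf => /continuous_closedP/(_ C cC) /closed_subspaceP[V cV VK].
by rewrite setIC -VK setIC; exact: compact_closedI.
Qed.

Lemma open_setX {T S : topologicalType} (A : set T) (B : set S) :
  open A -> open B -> open (A `*` B).
Proof.
move=> oA oB; rewrite openE => -[a b] [/= Aa Bb]; exists (A, B) => //=.
by split; apply: open_nbhs_nbhs.
Qed.

Lemma continuous_pairl {T S : topologicalType} (s : S) : continuous (fun t : T => (t, s)).
Proof.
move=> t A [[P Q] [/= nP nQ] PQA]; apply: filterS nP => t' Pt'.
by apply: PQA; split => //=; exact: nbhs_singleton nQ.
Qed.

Section rV_topology.
Context {R : realType} {d : nat}.
Local Notation E := 'rV[R]_d.

(** The interiors of the sets [inner U 1/(n+1)] increase and cover [U], so one of them contains the
    compact set. *)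
Lemma compact_inner (U K : set E) : open U -> compact K -> K `<=` U ->
  exists2 r : R, 0 < r & K `<=` inner U r.
Proof.
move=> oU cK KU; rewrite compact_cover in cK.
have [||D _ DK] := cK nat setT (fun n => interior (inner U n.+1%:R^-1)).
- by move=> n _; exact: open_interior.
- move=> x Kx; have /nbhs_ballP[e /= e0 he] := open_nbhs_nbhs (conj oU (KU x Kx)).
  have e20 : 0 < e / 2 by rewrite divr_gt0.
  have [n _ hn] := near_infty_natSinv_lt (PosNum e20).
  (* Half of the radius is spent on moving the centre, the other half on the ball around it. *)
  exists n => //=; apply/nbhs_ballP; exists (e / 2) => //= y xy z yz; apply: he.
  have -> : e = e / 2 + e / 2 by lra.
  apply: ball_triangle xy _; apply: le_ball yz; apply: ltW.
  exact: (hn n (leqnn n)).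
pose N := (\max_(i <- finmap.enum_fset D) i)%N.
exists N.+1%:R^-1; first by rewrite invr_gt0.
move=> x /DK[n /= Dn /interior_subset]; apply: inner_le.
rewrite lef_pV2 ?posrE// ler_nat ltnS; exact: (@leq_bigmax_seq _ _ xpredT (fun i => i) n Dn).
Qed.

Lemma jointly_continuous_sub {W : normedModType R} (A B : set E) (I J : set R) (f : E -> R -> W) :
  A `<=` B -> I `<=` J -> jointly_continuous B J f -> jointly_continuous A I f.
Proof.
move=> AB IJ; rewrite /jointly_continuous => h; apply: continuous_subspaceW h.
by move=> z [/= /AB Bz /IJ Jz].
Qed.

Lemma jointly_continuous_at {W : normedModType R} (V : set E) (f : E -> R -> W) x t : open V ->
  jointly_continuous V [set t | 0 < t] f -> V x -> 0 < t ->
  {for (x, t), continuous (fun z : E * R => f z.1 z.2)}.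
Proof.
move=> oV cf Vx t0.
have o : open (V `*` [set t : R | 0 < t]) by exact: (open_setX oV (@open_gt R 0)).
move: cf; rewrite /jointly_continuous continuous_open_subspace//; apply.
by apply/mem_set.
Qed.

Lemma jointly_continuous_space {W : normedModType R} (V : set E) (f : E -> R -> W) x t : open V ->
  jointly_continuous V [set t | 0 < t] f -> V x -> 0 < t ->
  {for x, continuous (f ^~ t)}.
Proof.
move=> oV cf Vx t0.
have h := jointly_continuous_at oV cf Vx t0.
apply: (@continuous_comp E (E * R)%type W (fun y => (y, t)) (fun z => f z.1 z.2)) => //.
exact: continuous_pairl.
Qed.

Lemma C1_on_union (A B : set E) f : C1_on A f -> C1_on B f -> C1_on (A `|` B) f.
Proof. by move=> hA hB x [/hA|/hB]. Qed.

Lemma C1_on_step (U : set E) (f : E -> R) : open U -> C1_on U f ->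
  C1_on U (fun x => step (f x)) /\
  (forall x i, U x -> partial i (fun x => step (f x)) x = dstep (f x) * partial i f x).
Proof.
move=> oU Cf.
apply: (@C1_along_comp R E 'I_d (@basis_vec R d) U setT f step dstep) => // s _.
  exact: is_derive_step.
exact: continuous_dstep.
Qed.

Lemma C1_onN (U : set E) (f : E -> R) : open U -> C1_on U f -> C1_on U (fun x => - f x).
Proof.
move=> oU Cf; rewrite (_ : (fun x => - f x) = (fun x => (-1) * f x)); last first.
  by apply/funext => x; rewrite mulN1r.
by apply: C1_alongM => //; exact: C1_along_cst.
Qed.

(** A product over the coordinates, adapted to the cubes that are the balls of the sup norm. With
    [a = (x_i - p_i) / r], the factor [step (a + 3) * step (3 - a)] is 1 for [|a| <= 1] and 0 for
    [|a| >= 2]. *)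
Lemma bump_exists (p : E) (r : R) : 0 < r -> exists b : E -> R,
  [/\ C1_on setT b, forall x, 0 <= b x <= 1, forall x, `|p - x| < r -> b x = 1 &
    forall x, 2 * r <= `|p - x| -> b x = 0].
Proof.
move=> r0.
pose a i (x : E) : R := r^-1 * (x 0 i - p 0 i).
pose c i (x : E) : R := step (a i x + 3) * step (3 - a i x).
exists (fun x => \prod_(i < d) c i x).
have step_norm i (x : E) : `|p - x| < r -> c i x = 1.
  move=> px; have ai : `|a i x| < 1.
    rewrite /a normrM ger0_norm ?invr_ge0 ?ltW// mulrC ltr_pdivrMr// mul1r.
    by apply: le_lt_trans px; have := coord_le_norm (p - x) i; rewrite !mxE distrC.
  by rewrite /c !step_eq1 ?mulr1//; move: ai; rewrite ltr_norml => /andP[? ?]; lra.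
split.
- apply: C1_along_prod; first exact: openT.
  move=> i.
  have Ca : C1_on setT (a i).
    apply: C1_alongM; [exact: openT|exact: C1_along_cst|].
    apply: C1_alongD; [exact: openT|exact: C1_on_coord|exact: C1_along_cst].
  apply: C1_alongM; first exact: openT.
    apply: (C1_on_step _ _).1; first exact: openT.
    by apply: C1_alongD; [exact: openT|exact: Ca|exact: C1_along_cst].
  apply: (C1_on_step _ _).1; first exact: openT.
  by apply: C1_alongD; [exact: openT|exact: C1_along_cst|apply: C1_onN; [exact: openT|exact: Ca]].
- move=> x; have c01 i : 0 <= c i x <= 1.
    by rewrite mulr_ge0 ?step_ge0//= mulr_ile1 ?step_ge0 ?step_le1.
  apply/andP; split; first by apply: prodr_ge0 => i _; case/andP: (c01 i).
  by apply: prodr_ile1 => i _; exact: c01.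
- by move=> x px; rewrite big1// => i _; exact: step_norm.
- move=> x px.
  have [i hi] : exists i, 2 * r <= `|x 0 i - p 0 i|.
    apply: contrapT => /forallNP h.
    have : `|p - x| < 2 * r.
      have : ball p (2 * r) x.
        apply/ball_rVP; first by rewrite mulr_gt0.
        by move=> i; rewrite distrC ltNge; apply/negP; exact: h.
      by rewrite mx_norm_ball.
    by rewrite ltNge px.
  have ai : 2 <= `|a i x|.
    by rewrite /a normrM ger0_norm ?invr_ge0 ?(ltW r0)// mulrC ler_pdivlMr.
  rewrite (bigD1 i)//= (_ : c i x = 0) ?mul0r//.
  rewrite /c; have [a0|a0] := leP 0 (a i x).
    by rewrite (@step_eq0 _ (3 - _)) ?mulr0//; move: ai; rewrite ger0_norm//; lra.
  by rewrite (@step_eq0 _ (a i x + 3)) ?mul0r//; move: ai; rewrite ltr0_norm//; lra.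
Qed.

End rV_topology.

Arguments C1_on_union {R d A B f}.
Arguments C1_on_step {R d U f}.
Arguments C1_onN {R d U f}.
Arguments jointly_continuous_sub {R d W A B I J f}.
Arguments jointly_continuous_at {R d W V f x t}.
Arguments jointly_continuous_space {R d W V f x t}.

(** * Cutoffs near a C^1 boundary *)

(** The last clause is the form in which the Neumann condition is used, with [G] the gradient of the
    density: the flux through the layer where [chi n] varies tends to 0 in L^1, uniformly on compact
    intervals of positive times. *)
Definition cutoffs {R : realType} {d : nat} (U L : set 'rV[R]_d)
    (m : probability (borel R d) R) (G : 'I_d -> 'rV[R]_d -> R -> R)
    (chi : nat -> 'rV[R]_d -> R) : Prop :=
  [/\ forall n, Defs.periodic L (chi n) /\ C1_on U (chi n),
      forall n x, U x -> 0 <= chi n x <= 1,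
      forall x, U x -> chi n x @[n --> \oo] --> (1 : R),
      forall n, exists2 r : R, 0 < r & forall x, U x -> ~ inner U r x -> chi n x = 0 &
      forall a b e : R, 0 < a -> 0 < e -> exists N, forall n t, (N <= n)%N ->
        a <= t <= b ->
        mint m U (fun x => `|\sum_i partial i (chi n) x * G i x t|) <= e].

Section boundary_cutoffs.
Context {R : realType} {d : nat}.
Local Notation E := 'rV[R]_d.
Variables (U : set E) (m : probability (borel R d) R).
Hypothesis ff : flow_facts U [set 0] m.
Hypothesis U_C1 : C1_boundary U.
Variables (V : set E) (G : 'I_d -> E -> R -> R).
Hypotheses (oV : open V) (UV : closure U `<=` V).
Hypothesis cG : forall i, jointly_continuous V [set t | 0 < t] (G i).
Hypothesis G_tangent : forall p phi t, bdry U p -> local_defining U p phi -> 0 < t ->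
  \sum_i partial i phi p * G i p t = 0.

Let oU : open U. Proof. exact: ff_open ff. Qed.
Let mU1 := ff_mU ff.

Let UinV : U `<=` V. Proof. by move=> x Ux; apply: UV; exact: subset_closure. Qed.

Lemma compact_closure_domain : compact (closure U).
Proof.
have [C [cC CU h]] := ff_cover ff.
suff -> : closure U = C by [].
by apply/seteqP; split => // x /h[l -> ]; rewrite addr0.
Qed.

Lemma flux_bounded (a b : R) : 0 < a -> exists2 B : R, 0 <= B &
  forall i x t, closure U x -> a <= t <= b -> `|G i x t| <= B.
Proof.
move=> a0.
have h i : exists M : R, forall x t, closure U x -> a <= t <= b -> `|G i x t| <= M.
  apply: (jointly_continuous_bounded ff (S := closure U)) => //.
  - exact: closed_closure.
  - by move=> x l ->; rewrite addr0.
  - have sI : `[a, b]%classic `<=` [set t : R | 0 < t].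
      by move=> t /=; rewrite in_itv /= => /andP[at_ _]; exact: lt_le_trans at_.
    exact: (jointly_continuous_sub UV sI (@cG i)).
  - by move=> t x l _ ->; rewrite addr0.
exists (\sum_i `|projT1 (cid (h i))|); first by apply: sumr_ge0.
move=> i x t Ux abt; have := projT2 (cid (h i)) x t Ux abt.
move=> /le_trans; apply; rewrite (bigD1 i)//= (le_trans (ler_norm _))//.
by rewrite lerDl sumr_ge0.
Qed.

Definition dotG (z : E -> R) (t : R) (x : E) : R := \sum_i partial i z x * G i x t.

Lemma bounded_meas_partial (z : E -> R) i : C1_on U z ->
  (exists M : R, forall i x, U x -> `|partial i z x| <= M) -> bounded_meas U (partial i z).
Proof.
move=> Cz [M hM]; apply: (bounded_meas_continuous oU (M := M)) => x Ux.
  exact: ((Cz x Ux).2 i).2.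
exact: hM.
Qed.

Lemma bounded_meas_flux i t : 0 < t -> bounded_meas U (G i ^~ t).
Proof.
move=> t0; have [B B0 hB] := flux_bounded t t0.
apply: (bounded_meas_continuous oU (M := B)) => x Ux.
  exact: (jointly_continuous_space oV (@cG i) (UinV Ux) t0).
by apply: hB; rewrite ?lexx//; exact: subset_closure.
Qed.

Lemma bounded_meas_dotG (z : E -> R) t : 0 < t -> C1_on U z ->
  (exists M : R, forall i x, U x -> `|partial i z x| <= M) -> bounded_meas U (dotG z t).
Proof.
move=> t0 Cz hz; apply: bounded_meas_sum => // i; apply: bounded_measM => //.
  exact: bounded_meas_partial.
exact: bounded_meas_flux.
Qed.

(** The cutoff attached to one boundary point vanishes only near that point, so vanishing along the
    whole boundary is not asked for. Bounded gradients are, which keeps all fluxes integrable. *)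
Definition precutoffs (z : nat -> E -> R) : Prop :=
  [/\ forall n, C1_on U (z n),
      forall n x, U x -> 0 <= z n x <= 1,
      forall x, U x -> z n x @[n --> \oo] --> (1 : R),
      forall n, exists M : R, forall i x, U x -> `|partial i (z n) x| <= M &
      forall a b e : R, 0 < a -> 0 < e -> exists N, forall n t, (N <= n)%N ->
        a <= t <= b -> mint m U (fun x => `|dotG (z n) t x|) <= e].

Lemma precutoffs1 : precutoffs (fun _ => cst 1).
Proof.
have p0 i : partial i (cst (1 : R) : E -> R) = cst 0.
  by apply/funext => x; rewrite /partial derive_cst.
split.
- by move=> n; exact: C1_along_cst.
- by move=> n x _; rewrite /= ler01 lexx.
- by move=> x _; exact: cvg_cst.
- by move=> n; exists 0 => i x _; rewrite p0 normr0.
- move=> a b e a0 e0; exists 0%N => n t _ _.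
  rewrite (_ : (fun x => _) = cst 0) ?mint_cst ?ltW//.
  by apply/funext => x; rewrite /dotG big1 ?normr0// => i _; rewrite p0 mul0r.
Qed.

(** Both factors lie in [[0, 1]], so by the Leibniz rule the flux of the product is at most the sum
    of the two fluxes. *)
Lemma precutoffsM y z : precutoffs y -> precutoffs z -> precutoffs (fun n x => y n x * z n x).
Proof.
move=> [Cy y01 y1 yB yG] [Cz z01 z1 zB zG].
have C n : C1_on U (fun x => y n x * z n x) by exact: (C1_alongM oU (Cy n) (Cz n)).
have pE n i x : U x -> partial i (fun x => y n x * z n x) x =
    partial i (y n) x * z n x + y n x * partial i (z n) x.
  by move=> Ux; exact: (deriveM_fun ((Cy n x Ux).2 i).1 ((Cz n x Ux).2 i).1).
have B n : exists M : R, forall i x, U x -> `|partial i (fun x => y n x * z n x) x| <= M.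
  have [M hM] := yB n; have [N hN] := zB n; exists (M + N) => i x Ux.
  have /andP[yn0 yn1] := y01 n x Ux; have /andP[zn0 zn1] := z01 n x Ux.
  rewrite pE// (le_trans (ler_normD _ _))// lerD// normrM.
    by rewrite -[M]mulr1 ler_pM ?hM// ger0_norm.
  by rewrite -[N]mul1r ler_pM ?hN// ger0_norm.
split; [exact: C| | |exact: B|].
- move=> n x Ux; have /andP[yn0 yn1] := y01 n x Ux; have /andP[zn0 zn1] := z01 n x Ux.
  by rewrite mulr_ge0//= mulr_ile1.
- by move=> x Ux; rewrite -[1]mulr1; apply: cvgM; [exact: y1|exact: z1].
move=> a b e a0 e0; have e20 : 0 < e / 2 by rewrite divr_gt0.
have [N1 h1] := yG a b _ a0 e20; have [N2 h2] := zG a b _ a0 e20.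
exists (maxn N1 N2) => n t; rewrite geq_max => /andP[n1 n2] abt.
have t0 : 0 < t by case/andP: abt => /(lt_le_trans a0).
have by_ := bounded_meas_norm (bounded_meas_dotG t0 (Cy n) (yB n)).
have bz_ := bounded_meas_norm (bounded_meas_dotG t0 (Cz n) (zB n)).
have -> : e = e / 2 + e / 2 by lra.
apply: (le_trans _ (lerD (h1 n t n1 abt) (h2 n t n2 abt))).
rewrite -mintD//; apply: le_mint => //.
- exact: bounded_meas_norm (bounded_meas_dotG t0 (C n) (B n)).
- exact: bounded_measD.
move=> x Ux.
have /andP[yn0 yn1] := y01 n x Ux; have /andP[zn0 zn1] := z01 n x Ux.
have -> : dotG (fun x => y n x * z n x) t x = dotG (y n) t x * z n x + y n x * dotG (z n) t x.
  rewrite /dotG mulr_suml mulr_sumr -big_split; apply: eq_bigr => i _ /=.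
  rewrite pE//; ring.
rewrite (le_trans (ler_normD _ _))// lerD// normrM.
  by rewrite ler_piMr// ger0_norm.
by rewrite ler_piMl// ger0_norm.
Qed.

Lemma compact_cball (p : E) (r : R) : compact [set x | `|p - x| <= r].
Proof.
apply: bounded_closed_compact.
  exists (`|p| + r); split; first exact: num_real.
  move=> M hM x /= px; rewrite (le_trans _ (ltW hM))//.
  by rewrite -[x](subKr p) (le_trans (ler_normB _ _))// lerD2l.
have c : continuous (fun x : E => `|p - x|).
  move=> x; apply: (@continuous_comp E E R (fun x => p - x) (fun y => `|y|)).
    have -> : (fun x0 : E => p - x0) = (fun x0 => p + x0) \o (fun x0 => - x0) by [].
    by apply: continuous_comp; [exact: opp_continuous|exact: continuous_translate].
  exact: norm_continuous.
by have := (continuous_closedP _).1 c [set y | y <= r] (@closed_le R r).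
Qed.

Lemma open_far (p : E) (r : R) : open [set x | r < `|p - x|].
Proof.
have -> : [set x | r < `|p - x|] = ~` [set x | `|p - x| <= r].
  by apply/seteqP; split => x /=; rewrite ltNge => /negP.
apply: closed_openC; apply: compact_closed; last exact: compact_cball.
exact: norm_hausdorff.
Qed.

Lemma ballE (p : E) (r : R) : ball p r = [set x | `|p - x| < r].
Proof. by rewrite mx_norm_ball. Qed.

(** * The cutoff in a chart around one boundary point *)

Section chart.
Variables (W : set E) (p : E) (phi : E -> R) (r : R) (i0 : 'I_d) (s k : R).
Hypotheses (oW : open W) (C_phi : C1_on W phi) (r0 : 0 < r) (k0 : 0 < k) (s1 : `|s| <= 1).
Hypothesis UW : U `&` W = [set x | W x /\ phi x < 0].
Hypothesis BW : ball p (8 * r) `<=` W.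
Hypothesis phi_slope : forall x, ball p (8 * r) x -> k <= s * partial i0 phi x.
Hypothesis phi_tangent : forall q t, bdry U q -> W q -> 0 < t -> dotG phi t q = 0.

(** Equal to 0 where [phi >= -1/(n+1)] and to 1 where [phi <= -2/(n+1)]: the transition layer
    approaches the boundary as [n] grows. *)
Let theta (n : nat) (x : E) : R := step (- n.+1%:R * phi x).
(** Passes from [theta n], where the bump [c] is 1, to the constant 1, where [c] vanishes; it is
    therefore C^1 everywhere although [phi] is controlled only in the chart. *)
Let zeta (c : E -> R) (n : nat) (x : E) : R := 1 - c x * (1 - theta n x).

Let U_phi x : U x -> W x -> phi x < 0.
Proof. by move=> Ux Wx; have : (U `&` W) x by []; rewrite UW => -[]. Qed.

Let phi_U x : W x -> phi x < 0 -> U x.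
Proof. by move=> Wx px; have : [set x | W x /\ phi x < 0] x by []; rewrite -UW => -[]. Qed.

Let C_theta n : C1_on W (theta n) /\ forall x i, W x ->
  partial i (theta n) x = - (n.+1%:R * dstep (- n.+1%:R * phi x)) * partial i phi x.
Proof.
have Cl : C1_on W (fun x => - n.+1%:R * phi x).
  exact: (C1_alongM oW (C1_along_cst _ _ _) (@C_phi)).
have [h1 h2] := C1_on_step oW Cl; split => // x i Wx; rewrite /theta h2//.
rewrite /partial (derive_cstM _ ((@C_phi x Wx).2 i).1).
by rewrite mulrA [_ * - _]mulrN mulrC [dstep _ * _]mulrC mulrC.
Qed.

Section bump.
Variables (c : E -> R) (rho : R).
Hypotheses (Cc : C1_on setT c) (c01 : forall x, 0 <= c x <= 1).
Hypotheses (rho8 : rho < 8 * r) (c0 : forall x, rho <= `|p - x| -> c x = 0).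

(** Two open sets covering the space: on one the chart is available, on the other [zeta c n] is
    constant. *)
Let far_or_near x : ball p (8 * r) x \/ rho < `|p - x|.
Proof.
have [h|h] := ltP rho `|p - x|; [by right|left].
by rewrite ballE /=; exact: le_lt_trans h _.
Qed.

Lemma zeta_far n x : rho < `|p - x| -> zeta c n x = 1.
Proof. by move=> h; rewrite /zeta c0 ?ltW// mul0r subr0. Qed.

Lemma C1_on_zeta_near n : C1_on (ball p (8 * r)) (zeta c n).
Proof.
have oB : open (ball p (8 * r)) by exact: ball_open.
apply: (C1_alongD oB (C1_along_cst _ _ _)).
apply: (C1_onN oB); apply: (C1_alongM oB).
  by apply: C1_along_sub (@Cc).
apply: (C1_alongD oB (C1_along_cst _ _ _)); apply: (C1_onN oB).
exact: C1_along_sub (C_theta n).1.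
Qed.

Lemma C1_on_zeta n : C1_on setT (zeta c n).
Proof.
have h : C1_on (ball p (8 * r) `|` [set x | rho < `|p - x|]) (zeta c n).
  apply: C1_on_union; first exact: C1_on_zeta_near.
  have e x : rho < `|p - x| -> cst 1 x = zeta c n x by move=> h; rewrite zeta_far.
  exact: (C1_along_congr (@open_far p rho) e (C1_along_cst _ _ 1)).
have e : setT `<=` ball p (8 * r) `|` [set x | rho < `|p - x|].
  by move=> x _; exact: far_or_near.
exact: (C1_along_sub e h).
Qed.

Lemma zeta01 n x : 0 <= zeta c n x <= 1.
Proof.
rewrite /zeta; have /andP[h0 h1] := c01 x.
have t0 : 0 <= theta n x by exact: step_ge0.
have t1 : theta n x <= 1 by exact: step_le1.
have : 0 <= c x * (1 - theta n x) <= 1.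
  by rewrite mulr_ge0 ?subr_ge0//= mulr_ile1 ?subr_ge0// lerBlDr lerDl.
by move=> /andP[? ?]; apply/andP; split; lra.
Qed.

Lemma zeta_cvg x : U x -> zeta c n x @[n --> \oo] --> (1 : R).
Proof.
move=> Ux; have [Bx|fx] := far_or_near x; last first.
  by under eq_cvg do rewrite (zeta_far _ fx); exact: cvg_cst.
have px := U_phi Ux (BW Bx).
apply: cvg_near_cst; near=> n.
rewrite /zeta /theta step_eq1 ?subrr ?mulr0 ?subr0//.
rewrite mulNr -mulrN -ler_pdivrMr ?oppr_gt0//.
apply: (@le_trans _ _ n%:R); last by rewrite ler_nat.
by near: n; exact: nbhs_infty_ger.
Unshelve. all: by end_near. Qed.

Lemma partial_zeta_far n i x : rho < `|p - x| -> partial i (zeta c n) x = 0.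
Proof.
move=> h; have e y : [set x | rho < `|p - x|] y -> cst 1 y = zeta c n y.
  by move=> /= hy; rewrite zeta_far.
by rewrite /partial -(eq_open_derive (@open_far _ _) e)// derive_cst.
Qed.

Lemma partial_zeta_near n i x : ball p (8 * r) x ->
  partial i (zeta c n) x = - partial i c x * (1 - theta n x)
   - c x * (n.+1%:R * dstep (- n.+1%:R * phi x)) * partial i phi x.
Proof.
move=> Bx; have Wx := BW Bx.
have dt := (((C_theta n).1 x Wx).2 i).1.
have dc := ((@Cc x I).2 i).1 : derivable c x (basis_vec i).
have h1 : is_derive x (basis_vec i) (theta n) (partial i (theta n) x) by exact: derivableP.
have h2 : is_derive x (basis_vec i) c (partial i c x) by exact: derivableP.
have h3 : is_derive x (basis_vec i) (cst 1 - theta n) (0 - partial i (theta n) x).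
  exact: is_deriveB.
have h4 := is_deriveM h2 h3.
have h5 : is_derive x (basis_vec i) (cst 1 - c * (cst 1 - theta n))
  (0 - (c x *: (0 - partial i (theta n) x) + (cst 1 - theta n) x *: partial i c x)).
  exact: is_deriveB.
have -> : partial i (zeta c n) x = 'D_(basis_vec i) (cst 1 - c * (cst 1 - theta n)) x by [].
rewrite derive_val (C_theta n).2//.
rewrite /GRing.scale /= !fctE; ring.
Qed.

Lemma partial_zeta_bounded n : exists M : R, forall i x, `|partial i (zeta c n) x| <= M.
Proof.
have h i : exists M : R, forall x, `|partial i (zeta c n) x| <= M.
  have cK := @compact_cball p rho.
  have cf : {within [set x | `|p - x| <= rho], continuous (partial i (zeta c n))}.
    by apply: continuous_subspaceT => x; exact: ((C1_on_zeta n I).2 i).2.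
  have [M [_ hM]] := compact_bounded (continuous_compact cf cK).
  exists (`|M| + 1) => x; have [h|h] := ltP rho `|p - x|.
    by rewrite partial_zeta_far// normr0.
  apply: hM; first by rewrite (le_lt_trans (ler_norm _))// ltrDl.
  by exists x.
exists (\sum_i `|projT1 (cid (h i))|) => i x.
have := projT2 (cid (h i)) x => /le_trans; apply.
by rewrite (bigD1 i)//= (le_trans (ler_norm _))// lerDl sumr_ge0.
Qed.

End bump.

Arguments C1_on_zeta {c rho}.

Lemma dstep_bounded : exists2 D : R, 0 < D & forall u : R, dstep u <= D.
Proof.
have cf : {within `[1, 2], continuous (@dstep R)}.
  by apply: continuous_subspaceT => u; exact: continuous_dstep.
have [M [_ hM]] := compact_bounded (continuous_compact cf (@segment_compact R 1 2)).
exists (`|M| + 1) => [|u]; first by rewrite ltr_wpDl.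
have [u1|u1] := leP u 1.
  have -> : dstep u = 0.
    by rewrite /dstep (@sqpos_le0 _ (u - 1)) ?(@dsqpos_le0 _ (u - 1)) ?subr_le0// !mul0r addr0 mul0r.
  by rewrite addr_ge0.
have [u2|u2] := leP 2 u; first by rewrite dstep_eq0// addr_ge0.
rewrite (le_trans (ler_norm _))//; apply: hM.
  by rewrite (le_lt_trans (ler_norm _))// ltrDl.
by exists u => //=; rewrite in_itv /= (ltW u1) (ltW u2).
Qed.

(** On the compact set of pairs in the closure where the flux is at least [e], [phi] cannot vanish,
    since a zero of [phi] there would be a boundary point, where the flux is 0. The maximum of [phi]
    on this set is thus negative, and it is [-dl]. *)
Lemma layer_flux (a b e : R) : 0 < a -> 0 < e -> exists2 dl : R, 0 < dl &
  forall x t, U x -> `|p - x| <= 2 * r -> a <= t <= b -> - dl < phi x ->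
    `|dotG phi t x| < e.
Proof.
move=> a0 e0.
have BW2 : [set x | `|p - x| <= 2 * r] `<=` W.
  by move=> x /= h; apply: BW; rewrite ballE /= (le_lt_trans h)// ltr_pM2r// ltr_nat.
pose K := ([set x | `|p - x| <= 2 * r] `&` closure U) `*` `[a, b]%classic.
have cK : compact K.
  apply: compact_setX; last exact: segment_compact.
  by apply: compact_closedI; [exact: compact_cball|exact: closed_closure].
have cphi (z : E * R) : W z.1 -> {for z, continuous (fun z : E * R => phi z.1)}.
  move=> Wz; apply: (@continuous_comp (E * R)%type E R fst phi z); first exact: cvg_fst.
  exact: (@C_phi _ Wz).1.
have cdot : {within K, continuous (fun z : E * R => `|dotG phi z.2 z.1|)}.
  apply: continuous_in_subspaceT => -[x t] /set_mem[/= [h1 h2]]; rewrite in_itv /= => /andP[at_ tb].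
  apply: (@continuous_at_norm R (E * R)%type (x, t) (fun z => dotG phi z.2 z.1)).
  apply: continuous_at_sum => i; apply: continuous_atM.
    apply: (@continuous_comp (E * R)%type E R fst (partial i phi) (x, t)); first exact: cvg_fst.
    exact: ((@C_phi x (BW2 _ h1)).2 i).2.
  exact: (jointly_continuous_at oV (@cG i) (UV h2) (lt_le_trans a0 at_)).
pose K' := K `&` (fun z : E * R => `|dotG phi z.2 z.1|) @^-1` [set y | e <= y].
have cK' : compact K' by apply: compact_within_closed => //; exact: closed_ge.
have [K0|/set0P/negP] := pselect (K' !=set0); last first.
  rewrite negbK => /eqP K'0; exists 1 => // x t Ux px abt _.
  rewrite ltNge; apply/negP => h; have : K' (x, t).
    by split => //; split => //=; split => //; exact: subset_closure.
  by rewrite K'0.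
have cp : {within K', continuous (fun z : E * R => phi z.1)}.
  apply: continuous_in_subspaceT => z /set_mem[[[/= h1 _] _] _].
  by apply: cphi; exact: BW2.
have [z0 z0K z0max] := @compact_EVT_max _ R (fun z : E * R => phi z.1) K' K0 cK' cp.
(* [phi <= 0] on the closure of [U] inside the chart, and equality would place the point on the
   boundary. *)
have z0neg : phi z0.1 < 0.
  move: z0K => /set_mem [[[h1 h2] h3] h4].
  have W0 : W z0.1 by exact: BW2.
  have z00 : phi z0.1 <= 0.
    rewrite leNgt; apply/negP => pos.
    have : \forall y \near z0.1, 0 < phi y /\ W y.
      have c1 := (@C_phi _ W0).1.
      have n1 : \forall y \near z0.1, 0 < phi y by exact: near_gt_at c1 pos.
      have n2 : \forall y \near z0.1, W y by exact: open_nbhs_nbhs.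
      by near do split.
    by move=> /h2[y [Uy [py Wy]]]; have := U_phi Uy Wy; rewrite ltNge (ltW py).
  rewrite lt_neqAle z00 andbT; apply/negP => /eqP z00'.
  have bz : bdry U z0.1.
    split => //; move=> /interior_subset Uz; have := U_phi Uz W0.
    by rewrite z00' ltxx.
  move: h3; rewrite /= in_itv /= => /andP[at_ _].
  have := phi_tangent bz W0 (lt_le_trans a0 at_) => h.
  by move: h4; rewrite /= h normr0 leNgt e0.
exists (- phi z0.1); first by rewrite oppr_gt0.
move=> x t Ux px abt; rewrite opprK => hphi.
rewrite ltNge; apply/negP => h.
have xtK : K' (x, t) by split => //; split => //=; split => //; exact: subset_closure.
have := z0max (x, t) (mem_set xtK); rewrite /= leNgt hphi.
by [].
Unshelve. all: by end_near. Qed.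

(** Where [theta n] does not vanish, [phi < -1/(n+1)]; within the closed ball this sublevel region
    is part of a compact subset of [U]. *)
Lemma theta_inner (n : nat) : exists2 r' : R, 0 < r' &
  forall x, U x -> `|p - x| < 2 * r -> theta n x != 0 -> inner U r' x.
Proof.
pose K := [set x | `|p - x| <= 2 * r] `&` phi @^-1` [set y | y <= - n.+1%:R^-1].
have BW2 x : `|p - x| <= 2 * r -> W x.
  by move=> h; apply: BW; rewrite ballE /= (le_lt_trans h)// ltr_pM2r// ltr_nat.
have cK : compact K.
  apply: compact_within_closed; last exact: closed_le.
    exact: compact_cball.
  by apply: continuous_in_subspaceT => x /set_mem /= h; exact: (@C_phi _ (BW2 _ h)).1.
have KU : K `<=` U.
  move=> x [/= h1 h2]; apply: phi_U; first exact: BW2.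
  by rewrite (le_lt_trans h2)// oppr_lt0 invr_gt0.
have [r' r'0 hr'] := compact_inner oU cK KU; exists r' => // x Ux px tx.
apply: hr'; split => /=; first exact: ltW.
rewrite leNgt; apply: contra tx => hp; apply/eqP/step_eq0.
rewrite mulNr -mulrN -ler_pdivlMl// mulr1 lerNl; exact: ltW.
Qed.

(** The gradient of [zeta b n] has two parts. The one with [grad b] is bounded and carries the
    factor [1 - theta n], which tends to 0 in [U]. The one with [grad phi] carries the large weight
    [f n], whose integral stays bounded and which meets a flux made small by [layer_flux]. The
    second bump [c], equal to 1 on the support of [b], replaces [1 - theta n] by the globally
    regular [1 - zeta c n]. The radii [2r < 3r < 6r < 8r] nest these supports inside the chart. *)
Lemma precutoffs_chart : exists z : nat -> E -> R, precutoffs z /\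
  forall n x, U x -> `|p - x| < r -> - n.+1%:R^-1 < phi x -> z n x = 0.
Proof.
have r30 : 0 < 3 * r by rewrite mulr_gt0.
have [b [Cb b01 b1 b0]] := bump_exists p r0.
have [c [Cc c01 c1 c0]] := bump_exists p r30.
have c0' x : 6 * r <= `|p - x| -> c x = 0.
  by move=> h; apply: c0; rewrite mulrA -natrM.
have b8 : 2 * r < 8 * r by rewrite ltr_pM2r// ltr_nat.
have c8 : 6 * r < 8 * r by rewrite ltr_pM2r// ltr_nat.
have Cz n : C1_on U (zeta b n) by apply: C1_along_sub (C1_on_zeta Cb b8 b0 n).
have Bz n : exists M : R, forall i x, U x -> `|partial i (zeta b n) x| <= M.
  have [M hM] := partial_zeta_bounded Cb b8 b0 n.
  by exists M => i x _; exact: hM.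
exists (zeta b); split; last first.
  move=> n x Ux px hx; rewrite /zeta b1// /theta step_eq0 ?subr0 ?mulr1 ?subrr//.
  by rewrite mulNr -mulrN -ler_pdivlMl// mulr1 lerNl; exact: ltW.
split; [exact: Cz| | |exact: Bz|].
- by move=> n x _; exact: zeta01.
- by move=> x Ux; exact: (zeta_cvg b8 b0).
move=> a a' e a0 e0.
have far_or_near x : ball p (8 * r) x \/ 2 * r < `|p - x|.
  have [h|h] := ltP (2 * r) `|p - x|; [by right|left].
  by rewrite ballE /=; exact: le_lt_trans h _.
(* The weight of [grad phi] in the gradient of [zeta b n]. Its pointwise bound grows with [n]; only
   its integral is bounded uniformly. *)
pose f n x := b x * (n.+1%:R * dstep (- n.+1%:R * phi x)).
have f0 n x : 0 <= f n x.
  have /andP[? _] := b01 x; apply: mulr_ge0 => //; apply: mulr_ge0 => //.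
  exact: dstep_ge0.
have fB n : bounded_meas U (f n).
  have [D D0 hD] := dstep_bounded.
  apply: (bounded_meas_continuous oU (M := n.+1%:R * D)) => x Ux.
    have [Bx|fx] := far_or_near x.
      have Wx := BW Bx.
      apply: continuous_atM; first exact: (Cb x I).1.
      apply: continuous_atM; first exact: continuous_at_cst.
      apply: (@continuous_at_comp _ _ x (@dstep R)); last exact: continuous_dstep.
      by apply: continuous_atM; [exact: continuous_at_cst|exact: (@C_phi _ Wx).1].
    have e1 y : [set y | 2 * r < `|p - y|] y -> cst 0 y = f n y.
      by move=> /= h; rewrite /f b0 ?mul0r// ltW.
    by apply: (eq_open_continuous (@open_far _ _) e1 fx); exact: cst_continuous.
  rewrite ger0_norm// -[leRHS]mul1r ler_pM//.
  - by case/andP: (b01 x).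
  - by apply: mulr_ge0 => //; exact: dstep_ge0.
  - by case/andP: (b01 x).
  - by rewrite ler_pM2l.
have [Mb hMb] : exists M : R, forall i x, U x -> `|partial i b x| <= M.
  have h i : exists M : R, forall x, closure U x -> `|partial i b x| <= M.
    have cf : {within closure U, continuous (partial i b)}.
      by apply: continuous_subspaceT => x; exact: ((Cb x I).2 i).2.
    have [M [_ hM]] := compact_bounded (continuous_compact cf compact_closure_domain).
    exists (`|M| + 1) => x Ux; apply: hM; last by exists x.
    by rewrite (le_lt_trans (ler_norm _))// ltrDl.
  exists (\sum_i `|projT1 (cid (h i))|) => i x Ux.
  have := projT2 (cid (h i)) x (subset_closure Ux) => /le_trans; apply.
  by rewrite (bigD1 i)//= (le_trans (ler_norm _))// lerDl sumr_ge0.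
have Mb0 : 0 <= Mb.
  by have [x0 Ux0] := ff_nonempty ff; rewrite (le_trans _ (hMb i0 x0 Ux0)).
have bz n i : bounded_meas U (partial i (zeta b n)) by apply: bounded_meas_partial; [exact: Cz|exact: Bz].
have bb i : bounded_meas U (partial i b).
  apply: bounded_meas_partial; first exact: C1_along_sub Cb.
  by exists Mb.
(* integrating [d_i0 (b theta)] to zero *)
have fint n : mint m U (f n) <= Mb / k.
  pose w x := b x + zeta b n x - 1.
  have wE x : w x = b x * theta n x by rewrite /w /zeta; ring.
  have Cw : C1_on setT w.
    apply: (C1_alongD openT (C1_alongD openT Cb (C1_on_zeta Cb b8 b0 n))).
    exact: C1_along_cst.
  have pw x : partial i0 w x = partial i0 b x + partial i0 (zeta b n) x.
    have hb := ((Cb x I).2 i0).1.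
    have hz := ((C1_on_zeta Cb b8 b0 n x I).2 i0).1.
    have h := deriveD_fun (derivableD_fun hb hz) (@derivable_cst R E R (- 1) x (basis_vec i0)).
    by rewrite derive_cst addr0 (deriveD_fun hb hz) in h.
  have [r' r'0 hr'] := theta_inner n.
  have w0 : mint m U (partial i0 w) = 0.
    apply: (mint_partial0 ff r'0).
    - by move=> x l ->; rewrite addr0.
    - move=> x Ux nin; rewrite wE; have [h|h] := ltP `|p - x| (2 * r); last by rewrite b0 ?mul0r.
      apply/eqP; apply: contraT => bt; exfalso; apply: nin; apply: hr' => //.
      by apply: contra bt => /eqP ->; rewrite mulr0.
    - by move=> x _; exact: (Cw x I).1.
    - by move=> x _; exact: ((Cw x I).2 i0).1.
    - by move=> x _; exact: ((Cw x I).2 i0).2.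
  have bw : bounded_meas U (partial i0 w).
    rewrite (_ : partial i0 w = fun x => partial i0 b x + partial i0 (zeta b n) x).
      by apply: bounded_measD.
    exact/funext.
  rewrite ler_pdivlMr// mulrC -mintZ//.
  (* The derivative of [w] has zero integral, so it may be subtracted; the resulting integrand
     dominates [k * f n] pointwise because [phi] has slope at least [k]. *)
  have -> : Mb = mint m U (fun x => Mb - s * partial i0 w x).
    rewrite mintB//; [|exact: bounded_meas_cst|by apply: bounded_measM => //; exact: bounded_meas_cst].
    by rewrite mintZ// w0 mulr0 subr0 mint_cst.
  apply: le_mint => //.
  - by apply: bounded_measM => //; exact: bounded_meas_cst.
  - apply: bounded_measB => //; first exact: bounded_meas_cst.
    by apply: bounded_measM => //; exact: bounded_meas_cst.
  move=> x Ux; rewrite pw.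
  have [Bx|fx] := far_or_near x; last first.
    rewrite (partial_zeta_far b0)// /f b0 ?(ltW fx)// mul0r mulr0 addr0.
    rewrite subr_ge0 (le_trans (ler_norm _))// normrM -[leRHS]mul1r.
    by rewrite ler_pM ?hMb.
  rewrite (partial_zeta_near Cb)//.
  have -> : s * (partial i0 b x + (- partial i0 b x * (1 - theta n x) -
      b x * (n.+1%:R * dstep (- n.+1%:R * phi x)) * partial i0 phi x)) =
      s * partial i0 b x * theta n x - f n x * (s * partial i0 phi x).
    by rewrite /f; ring.
  rewrite opprB addrCA ler_wpDr//; last first.
    by rewrite mulrC ler_wpM2l// phi_slope.
  have t0 : 0 <= theta n x by exact: step_ge0.
  have t1 : theta n x <= 1 by exact: step_le1.
  have sb : `|s * partial i0 b x| <= Mb.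
    by rewrite normrM -[leRHS]mul1r ler_pM// hMb.
  rewrite subr_ge0 (le_trans (ler_norm _))// normrM.
  rewrite (@le_trans _ _ (Mb * 1)) ?mulr1//.
  by rewrite -[leRHS]mulr1 ler_pM// ger0_norm.
have [B B0 hB] := flux_bounded a' a0.
pose D := Mb * B *+ d.
have D0 : 0 <= D by rewrite mulrn_wge0// mulr_ge0.
have dD x t : U x -> a <= t <= a' -> `|dotG b t x| <= D.
  move=> Ux at_; rewrite /dotG (le_trans (ler_norm_sum _ _ _))//.
  rewrite (@le_trans _ _ (\sum_(i < d) Mb * B))//.
    by apply: ler_sum => i _; rewrite normrM ler_pM ?hMb ?hB//; exact: subset_closure.
  by rewrite sumr_const card_ord.
(* Chosen so that [eta] times the integral of [f n] is at most [e / 2]; the added 1 keeps the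
   denominator positive. *)
pose eta := e / 2 / (Mb / k + 1).
have Mk0 : 0 < Mb / k + 1 by rewrite ltr_wpDl// divr_ge0// ltW.
have eta0 : 0 < eta by rewrite !divr_gt0.
have [dl dl0 hdl] := layer_flux a' a0 eta0.
have zc1 : mint m U (fun x => 1 - zeta c n x) @[n --> \oo] --> (0 : R).
  rewrite -(mint_cst oU mU1 0).
  apply: (@mint_cvg _ _ _ _ oU _ _ 1).
  - move=> n; apply: (measurable_fun_rV_continuous oU) => x Ux.
    apply: continuous_atD; first exact: continuous_at_cst.
    by apply: continuous_atN; exact: (C1_on_zeta Cc c8 c0' n x I).1.
  - move=> n x Ux; have /andP[h0 h1] := zeta01 c01 n x.
    by rewrite ger0_norm ?subr_ge0// lerBlDr lerDl.
  - move=> x Ux; rewrite /cst -[X in _ --> X](subrr (1 : R)).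
    by apply: cvgB; [exact: cvg_cst|exact: (zeta_cvg c8 c0')].
have eD : 0 < e / 2 / (D + 1) by rewrite !divr_gt0// ltr_wpDl.
have /cvgrPdist_le/(_ _ eD)[N1 _ hN1] := zc1.
(* [f n] vanishes unless [phi > -2/(n+1)], so [2/(n+1) < dl] puts its support in the range of
   [layer_flux]. *)
have [N2 _ hN2] := near_infty_natSinv_lt (PosNum (divr_gt0 dl0 (ltr0Sn R 1))).
exists (maxn N1 N2) => n t; rewrite geq_max => /andP[n1 n2] at_.
have t0 : 0 < t by case/andP: at_ => /(lt_le_trans a0).
have bzc : bounded_meas U (fun x => 1 - zeta c n x).
  apply: (bounded_meas_continuous oU (M := 1)) => x Ux.
    apply: continuous_atD; first exact: continuous_at_cst.
    by apply: continuous_atN; exact: (C1_on_zeta Cc c8 c0' n x I).1.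
  have /andP[h0 h1] := zeta01 c01 n x.
  by rewrite ger0_norm ?subr_ge0// lerBlDr lerDl.
(* The first summand dominates the part with [grad b], the second the part with [grad phi]. *)
apply: (@le_trans _ _ (mint m U (fun x => D * (1 - zeta c n x) + eta * f n x))).
  apply: le_mint => //.
  - exact: bounded_meas_norm (bounded_meas_dotG t0 (Cz n) (Bz n)).
  - by apply: bounded_measD => //; apply: bounded_measM => //; exact: bounded_meas_cst.
  move=> x Ux; have /andP[zc0 zc1'] := zeta01 c01 n x.
  have [Bx|fx] := far_or_near x; last first.
    rewrite /dotG big1 ?normr0 => [|i _]; last by rewrite (partial_zeta_far b0)// mul0r.
    by rewrite addr_ge0// mulr_ge0 ?subr_ge0 ?(ltW eta0).
  have -> : dotG (zeta b n) t x = - (dotG b t x * (1 - theta n x)) - f n x * dotG phi t x.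
    rewrite /dotG mulr_suml mulr_sumr -!sumrN -big_split; apply: eq_bigr => i _ /=.
    by rewrite (partial_zeta_near Cb)// /f; ring.
  have t0' : 0 <= theta n x by exact: step_ge0.
  have t1' : theta n x <= 1 by exact: step_le1.
  rewrite (le_trans (ler_normB _ _))// lerD//.
    rewrite normrN normrM; have [px|px] := ltP `|p - x| (3 * r).
      by rewrite /zeta c1// mul1r subKr ler_pM// ?dD// ger0_norm// subr_ge0.
    have -> : dotG b t x = 0.
      rewrite /dotG big1// => i _.
      have e1 y : [set y | 2 * r < `|p - y|] y -> cst 0 y = b y.
        by move=> /= h; rewrite b0// ltW.
      have px2 : 2 * r < `|p - x| by rewrite (lt_le_trans _ px)// ltr_pM2r// ltr_nat.
      by rewrite /partial -(eq_open_derive (@open_far _ _) e1 _ px2) derive_cst mul0r.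
    by rewrite normr0 mul0r mulr_ge0// subr_ge0.
  rewrite normrM ger0_norm// mulrC.
  have [->|fn0] := eqVneq (f n x) 0; first by rewrite !mulr0.
  rewrite ler_wpM2r//.
  have px : `|p - x| <= 2 * r.
    rewrite leNgt; apply: contra fn0 => h; rewrite /f b0 ?mul0r//; exact: ltW.
  apply: ltW; apply: hdl => //.
  have s2 : - n.+1%:R * phi x < 2.
    by rewrite ltNge; apply: contra fn0 => h; rewrite /f dstep_eq0// !mulr0.
  have hn : n.+1%:R^-1 < dl / 2 :> R by exact: hN2.
  rewrite ltrNl; move: s2; rewrite mulNr -mulrN mulrC -ltr_pdivlMr// => /lt_trans; apply.
  by move: hn; rewrite ltr_pdivlMr// mulrC.
rewrite mintD//; [|by apply: bounded_measM => //; exact: bounded_meas_cst..].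
rewrite !mintZ//; have -> : e = e / 2 + e / 2 by lra.
apply: lerD.
  have := hN1 n n1; rewrite sub0r normrN => /(le_trans (ler_norm _)) h.
  rewrite (@le_trans _ _ ((D + 1) * mint m U (fun x => 1 - zeta c n x)))//.
    rewrite ler_wpM2r ?lerDl//; apply: mint_ge0 => x Ux.
    by have /andP[_ ?] := zeta01 c01 n x; rewrite subr_ge0.
  by rewrite mulrC -ler_pdivlMr// ltr_wpDl.
rewrite (@le_trans _ _ (eta * (Mb / k + 1)))//.
  by rewrite ler_pM2l// (le_trans (fint n))// lerDl.
by rewrite /eta divfK// gt_eqF.
Qed.

End chart.

(** Some partial derivative of [phi] is nonzero at [p]; by continuity it keeps its sign [s] nearby
    and at least half its size [k], which is the slope needed in the chart. The open sets [O n]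
    contain the boundary near [p], so finitely many such families surround the whole boundary. *)
Lemma boundary_precutoffs (p : E) : bdry U p ->
  exists (r : R) (z : nat -> E -> R) (O : nat -> set E), [/\ 0 < r, precutoffs z,
    forall n, open (O n), forall n x, U x -> O n x -> z n x = 0 &
    forall n q, bdry U q -> ball p r q -> O n q].
Proof.
move=> bp; have [phi lphi] := U_C1 bp.
have [W [oW Wp CW gW UW]] := lphi.
have C_phi : C1_on W phi by exact: Ck1_C1_on.
have [i0 hi0] : exists i0, partial i0 phi p != 0.
  apply: contrapT => /forallNP h; have /eqP := gW p Wp; apply.
  by apply/rowP => i; rewrite !mxE; have /negP := h i; rewrite negbK => /eqP.
pose s := Num.sg (partial i0 phi p); pose k := `|partial i0 phi p| / 2.
have k0 : 0 < k by rewrite divr_gt0// normr_gt0.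
have sk : s * partial i0 phi p = `|partial i0 phi p| by rewrite /s normrEsg.
have cs : {for p, continuous (fun x => s * partial i0 phi x)}.
  by apply: continuous_atM; [exact: continuous_at_cst|exact: ((C_phi p Wp).2 i0).2].
have ns : \forall x \near p, k < s * partial i0 phi x.
  by apply: (near_gt_at cs); rewrite sk /k; move: k0; rewrite /k; lra.
have nW : \forall x \near p, W x by exact: open_nbhs_nbhs.
have [e /= e0 he] := (nbhs_ballP _ _).1 (filterI ns nW).
(* The chart construction works in a ball of radius [8 * r]. *)
pose r := e / 8; have r0 : 0 < r by rewrite divr_gt0.
have r8 : 8 * r = e by rewrite /r; field.
have BW : ball p (8 * r) `<=` W by move=> x; rewrite r8 => /he[].
have sl x : ball p (8 * r) x -> k <= s * partial i0 phi x.
  by rewrite r8 => /he[/ltW].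
have s1 : `|s| <= 1 by rewrite /s normr_sg; case: (_ != _).
have ht q t : bdry U q -> W q -> 0 < t -> dotG phi t q = 0.
  by move=> bq Wq t0; apply: G_tangent => //; exists W.
have [z [hz z0]] := precutoffs_chart oW C_phi r0 k0 s1 UW BW sl ht.
exists r, z, (fun n => ball p r `&` (W `&` [set x | - n.+1%:R^-1 < phi x])).
split=> //.
- move=> n; apply: openI; first exact: ball_open.
  rewrite openE => x [Wx px]; apply: filterI; first exact: open_nbhs_nbhs.
  exact: (near_gt_at (C_phi x Wx).1 px).
- by move=> n x Ux [bx [_ px]]; apply: z0 => //; move: bx; rewrite ballE.
- move=> n q bq bpq; have Wq : W q by apply: BW; apply: le_ball bpq; rewrite ler_peMl ?(ltW r0)// ler1n.
  split=> //; split=> //=; apply: (@lt_le_trans _ _ 0); first by rewrite oppr_lt0 invr_gt0.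
  rewrite leNgt; apply/negP => pq; case: bq => _; apply.
  have Uq : U q by have : [set x | W x /\ phi x < 0] q by []; rewrite -UW => -[].
  by rewrite (interior_id U).1.
Qed.

Lemma precutoffs_prod (I : Type) (s : seq I) (z : I -> nat -> E -> R) :
  (forall i, precutoffs (z i)) -> precutoffs (fun n x => \prod_(i <- s) z i n x).
Proof.
move=> hz; elim: s => [|i s IH].
  rewrite (_ : (fun n x => _) = fun _ => cst 1); first exact: precutoffs1.
  by apply/funext => n; apply/funext => x; rewrite big_nil.
rewrite (_ : (fun n x => _) = fun n x => z i n x * \prod_(j <- s) z j n x).
  exact: (precutoffsM (hz i) IH).
by apply/funext => n; apply/funext => x; rewrite big_cons.
Qed.

(** Finitely many chart balls cover the compact boundary, and the product of their cutoffs vanishes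
    on [U] inside an open neighbourhood [O] of it. The closure of [U] minus [O] is a compact subset
    of [U], hence lies in some [inner U r]. *)
Lemma domain_cutoffs : exists chi, cutoffs U [set 0] m G chi.
Proof.
have h p : exists u : R * ((nat -> E -> R) * (nat -> set E)),
    [/\ 0 < u.1, precutoffs u.2.1, forall n, open (u.2.2 n),
     forall n x, U x -> u.2.2 n x -> u.2.1 n x = 0 &
     bdry U p -> forall n q, bdry U q -> ball p u.1 q -> u.2.2 n q].
  have [/boundary_precutoffs[r [z [Q [h1 h2 h3 h4 h5]]]]|nb] := pselect (bdry U p).
    by exists (r, (z, Q)).
  (* Trivial data off the boundary make the choice total. *)
  exists (1, (fun _ => cst 1, fun _ => set0)); split => //=; first exact: precutoffs1.
  by move=> _; exact: open0.
have [u hu] := choice h.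
have cB : compact (bdry U).
  rewrite /bdry setDE; apply: compact_closedI; first exact: compact_closure_domain.
  by apply: open_closedC; exact: open_interior.
rewrite compact_cover in cB.
have [||D DB Dcov] := cB E (bdry U) (fun p => ball p (u p).1).
- by move=> p _; exact: ball_open.
- by move=> p bp; exists p => //; apply: ballxx; case: (hu p).
pose s := finmap.enum_fset D.
have hz p : precutoffs (u p).2.1 by case: (hu p).
have [Cz z01 z1 zB zG] := precutoffs_prod s hz.
exists (fun n x => \prod_(p <- s) (u p).2.1 n x); split => //.
  by move=> n; split=> //; move=> x l ->; rewrite addr0.
move=> n; pose O := \bigcup_(p in [set q | q \in s]) (u p).2.2 n.
have oO : open O by apply: bigcup_open => p _; case: (hu p).
have cK : compact (closure U `&` ~` O).
  by apply: compact_closedI; [exact: compact_closure_domain|exact: open_closedC].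
have KU : closure U `&` ~` O `<=` U.
  move=> x [cx nO]; apply: contrapT => nU; apply: nO.
  have bx : bdry U x by split=> //; move=> /interior_subset.
  have [p /= pD pb] := Dcov x bx.
  have bp : bdry U p by have := DB p pD; rewrite inE.
  by exists p => //; case: (hu p) => _ _ _ _ /(_ bp n x bx pb).
have [r r0 hr] := compact_inner oU cK KU.
exists r => // x Ux nin.
have [p /= pD px] : O x.
  by apply: contrapT => nO; apply: nin; apply: hr; split=> //; exact: subset_closure.
case: (hu p) => _ _ _ /(_ n x Ux px) z0 _.
by rewrite (big_rem p)//= z0 mul0r.
Qed.

End boundary_cutoffs.

(** * Regularity of the heat flow and Green's formula *)

Lemma is_derive_mint {R : realType} {d : nat} (m : probability (borel R d) R)
    (U : set 'rV[R]_d) (f df : R -> 'rV[R]_d -> R) (t a b M : R) : open U ->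
  a < t < b ->
  (forall s x, a < s < b -> U x -> is_derive s 1 (f ^~ x) (df s x)) ->
  (forall s, a < s < b -> bounded_meas U (f s)) ->
  (forall s x, a < s < b -> U x -> `|df s x| <= M) ->
  is_derive t 1 (fun s => mint m U (f s)) (mint m U (df t)).
Proof.
move=> oU atb hd bf dfM.
have mU : measurable (U : set (borel R d)) by exact: open_measurable_rV.
have It : `]a, b[%classic t by rewrite /= in_itv.
have h1 s : `]a, b[%classic s -> m.-integrable (U : set (borel R d)) (EFin \o f s).
  by rewrite /= in_itv /= => hs; apply: (bounded_meas_integrable _ oU); exact: bf.
have h2 s x : `]a, b[%classic s -> U x -> derivable (f ^~ x) s 1.
  by rewrite /= in_itv /= => hs Ux; have h := hd s x hs Ux; exact: ex_derive.
have h3 : m.-integrable (U : set (borel R d)) (EFin \o cst `|M|).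
  apply: (bounded_meas_integrable _ oU); exact: bounded_meas_cst.
have dE s x : a < s < b -> U x -> partial1of2 f s x = df s x.
  by move=> hs Ux; rewrite partial1of2E; have h := hd s x hs Ux; rewrite derive_val.
have h4 s x : `]a, b[%classic s -> U x -> `|partial1of2 f s x| <= cst `|M| x.
  rewrite /= in_itv /= => hs Ux; rewrite dE//.
  by rewrite (le_trans (dfM s x hs Ux))// ler_norm.
have h0 (x : 'rV[R]_d) : 0 <= (cst `|M| : 'rV[R]_d -> R) x by rewrite /=.
apply: DeriveDef.
  exact: (@derivable_under_integral R _ (borel R d) m f U mU t a b It h1 h2 _ h0 h3 h4).
rewrite -derive1E (@differentiation_under_integral R _ (borel R d) m f U mU t a b It h1 h2 _ h0 h3 h4).
by apply: eq_mint => x Ux; exact: dE.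
Qed.

Lemma continuous_bounded_itv {R : realType} (k : R -> R) (M : R) : continuous k ->
  exists B : R, forall u, `|u| <= M -> `|k u| <= B.
Proof.
move=> ck; have cf : {within `[- M, M], continuous k} by exact: continuous_subspaceT.
have [B [_ hB]] := compact_bounded (continuous_compact cf (@segment_compact R (- M) M)).
exists (B + 1) => u uM; apply: hB; first by rewrite ltrDl.
by exists u => //=; rewrite in_itv /= -ler_norml.
Qed.

(** If [f x > 0], then [f] exceeds [f x / 2] on a small ball. Its integral over that ball against
    volume is positive, and [ff_vol] bounds this by a multiple of the integral against [m]. *)
Lemma mint_le0_continuous {R : realType} {d : nat} {U L : set 'rV[R]_d}
    {m : probability (borel R d) R} (ff : flow_facts U L m) (f : 'rV[R]_d -> R) x :
  (forall x, 0 <= f x) -> bounded_meas U f -> Defs.periodic L f ->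
  (forall x, U x -> {for x, continuous f}) -> mint m U f <= 0 -> U x -> f x = 0.
Proof.
move=> f0 bf fper cf f_le0 Ux; apply/eqP; rewrite eq_le f0 andbT leNgt; apply/negP => fx0.
have oU := ff_open ff.
have [r [C [r0 C0 BU hC]]] := ff_vol ff Ux.
have fx2 : f x / 2 < f x by lra.
have := near_gt_at (cf x Ux) fx2.
have nB : \forall y \near x, ball x r y by apply/nbhs_ballP; exists r.
move=> near_f; have [s /= s0 hs] := (nbhs_ballP _ _).1 (filterI nB near_f).
have mB (y : 'rV[R]_d) (e : R) : measurable (ball y e : set (borel R d)).
  by apply: open_measurable_rV; exact: ball_open.
have lb : ((f x / 2)%:E * vol R d (ball x s : set (borel R d)) <=
    \int[vol R d]_(y in (ball x r : set (borel R d))) (f y)%:E)%E.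
  rewrite -integral_cst; last exact: mB.
  apply: (@le_trans _ _ (\int[vol R d]_(y in (ball x s : set (borel R d))) (f y)%:E)%E).
    apply: ge0_le_integral => //.
    - by move=> y _; rewrite lee_fin divr_ge0.
    - by apply/measurable_EFinP; apply: measurable_funS bf.1 => //; [exact: open_measurable_rV|move=> y /hs[/BU]].
    - by move=> y /hs[_ /ltW]; rewrite lee_fin.
  apply: ge0_subset_integral => //; last by move=> y /hs[].
  - apply/measurable_EFinP; apply: measurable_funS bf.1 => //; exact: open_measurable_rV.
  - by move=> y _; rewrite lee_fin.
have pos : (0 < (f x / 2)%:E * vol R d (ball x s : set (borel R d)))%E.
  by rewrite mule_gt0 ?lte_fin ?divr_gt0//; exact: vol_ball_gt0.
have up := hC f fper bf.1 (fun x _ => f0 x).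
have := lt_le_trans pos (le_trans lb up).
by rewrite -mint_EFin// -EFinM lte_fin ltNge mulr_ge0_le0.
Qed.

(** The common setting for domain and torus. The boundary condition enters only through
    [hc_cutoffs]. *)
Record heat_ctx {R : realType} {d : nat} (U L : set 'rV[R]_d)
    (m : probability (borel R d) R) (V : set 'rV[R]_d)
    (chi : nat -> 'rV[R]_d -> R) (rho : 'rV[R]_d -> R -> R) : Prop := {
  hc_facts : flow_facts U L m;
  hc_open : open V;
  hc_closure : closure U `<=` V;
  hc_regular : C2_1 V [set t | 0 < t] rho;
  hc_continuous : jointly_continuous (closure U) [set t | 0 <= t] rho;
  hc_periodic : forall t, 0 <= t -> Defs.periodic L (rho ^~ t);
  hc_equation : forall x t, U x -> 0 < t -> derive1 (rho x) t = laplacian (rho ^~ t) x;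
  hc_cutoffs : cutoffs U L m (fun i x t => partial i (rho ^~ t) x) chi }.

Section heat.
Context {R : realType} {d : nat} {U L V : set 'rV[R]_d} {m : probability (borel R d) R}.
Context {chi : nat -> 'rV[R]_d -> R} {rho : 'rV[R]_d -> R -> R}.
Local Notation E := 'rV[R]_d.
Hypothesis H : heat_ctx U L m V chi rho.

Let ff := hc_facts H.
Let oU : open U := ff_open ff.
Let mU1 := ff_mU ff.
Let oV := hc_open H.

Let UinV : U `<=` V.
Proof. by move=> x Ux; apply: (hc_closure H); exact: subset_closure. Qed.

Let cU_shift x l : L l -> closure U x -> closure U (x + l).
Proof.
move=> Ll cx A; rewrite addrC => nA; have nB : nbhs x ((fun y => l + y) @^-1` A).
  exact: (@continuous_translate R E l x A nA).
have [y [Uy Ay]] := cx _ nB; exists (l + y); split => //.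
by rewrite addrC; exact: (ff_shift ff).
Qed.

Lemma rho_bounded (b : R) : exists M : R, forall x t, closure U x -> 0 <= t <= b ->
  `|rho x t| <= M.
Proof.
apply: (jointly_continuous_bounded ff (S := closure U)) => //.
- exact: closed_closure.
- have s : `[0, b]%classic `<=` [set t : R | 0 <= t].
    by move=> t /=; rewrite in_itv /= => /andP[].
  exact: (jointly_continuous_sub (@subset_refl _ (closure U)) s (hc_continuous H)).
- by move=> t x l /andP[t0 _] Ll _; exact: (hc_periodic H).
Qed.

(** For derivatives of the density: these are controlled only on time intervals away from 0, whereas
    [rho_bounded] reaches down to time 0. *)
Let bounded_pos (f : E -> R -> R) (a b : R) : 0 < a ->
  jointly_continuous V [set t | 0 < t] f ->
  (forall t x l, 0 < t -> L l -> closure U x -> f (x + l) t = f x t) ->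
  exists M : R, forall x t, closure U x -> a <= t <= b -> `|f x t| <= M.
Proof.
move=> a0 cf fper; apply: (jointly_continuous_bounded ff (S := closure U)) => //.
- exact: closed_closure.
- have s : `[a, b]%classic `<=` [set t : R | 0 < t].
    by move=> t /=; rewrite in_itv /= => /andP[at_ _]; exact: lt_le_trans at_.
  exact: (jointly_continuous_sub (hc_closure H) s cf).
- by move=> t x l /andP[t0 _] Ll Ux; apply: fper => //; exact: lt_le_trans t0.
Qed.

Lemma dt_bounded (a b : R) : 0 < a -> exists M : R,
  forall x t, closure U x -> a <= t <= b -> `|derive1 (rho x) t| <= M.
Proof.
move=> a0; have [[_ _ cdt _] _] := hc_regular H.
apply: (bounded_pos (f := fun x t => derive1 (rho x) t)) => // t x l t0 Ll Ux.
have o : open [set t : R | 0 < t] by exact: open_gt.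
have e s : [set t : R | 0 < t] s -> rho (x + l) s = rho x s.
  by move=> /= s0; rewrite (hc_periodic H (ltW s0)).
by rewrite !derive1E; exact: (eq_open_derive o e).
Qed.

Lemma partial_rho_bounded (a b : R) : 0 < a -> exists M : R,
  forall i x t, closure U x -> a <= t <= b -> `|partial i (rho ^~ t) x| <= M.
Proof.
move=> a0; have [[_ _ _ h] _] := hc_regular H.
have B i : exists M : R, forall x t, closure U x -> a <= t <= b -> `|partial i (rho ^~ t) x| <= M.
  apply: (bounded_pos (f := fun x t => partial i (rho ^~ t) x)) => //; first exact: (h i).2.
  by move=> t x l t0 Ll Ux; exact: (periodic_partial i (hc_periodic H (ltW t0)) x Ll).
exists (\sum_i `|projT1 (cid (B i))|) => i x t Ux abt.
have := projT2 (cid (B i)) x t Ux abt => /le_trans; apply.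
by rewrite (bigD1 i)//= (le_trans (ler_norm _))// lerDl sumr_ge0.
Qed.

Lemma C1_rho t : 0 < t -> C1_on V (rho ^~ t).
Proof.
move=> t0 x Vx; have [[h1 _ _ h] _] := hc_regular H; split.
  exact: (jointly_continuous_space oV h1 Vx t0).
move=> i; split; first exact: (h i).1.
exact: (jointly_continuous_space oV (h i).2 Vx t0).
Qed.

Lemma C1_partial_rho i t : 0 < t -> C1_on V (partial i (rho ^~ t)).
Proof.
move=> t0 x Vx; have [[_ _ _ h] h2] := hc_regular H; split.
  exact: (jointly_continuous_space oV (h i).2 Vx t0).
move=> j; split; first exact: (h2 i j).1.
exact: (jointly_continuous_space oV (h2 i j).2 Vx t0).
Qed.

Lemma rho_is_derive x (t : R) : U x -> 0 < t -> is_derive t 1 (rho x) (laplacian (rho ^~ t) x).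
Proof.
move=> Ux t0; have [[_ h _ _] _] := hc_regular H.
apply: DeriveDef; first by apply: h => //; exact: UinV.
by rewrite -derive1E (hc_equation H).
Qed.

Lemma continuous_rho t x : 0 < t -> U x -> {for x, continuous (rho ^~ t)}.
Proof. by move=> t0 Ux; exact: (C1_rho t0 (UinV Ux)).1. Qed.

Lemma continuous_partial_rho i t x : 0 < t -> U x -> {for x, continuous (partial i (rho ^~ t))}.
Proof. by move=> t0 Ux; exact: ((C1_rho t0 (UinV Ux)).2 i).2. Qed.

Lemma continuous_laplacian_rho t x : 0 < t -> U x -> {for x, continuous (laplacian (rho ^~ t))}.
Proof.
move=> t0 Ux; apply: (continuous_at_sum (f := fun i => partial i (partial i (rho ^~ t)))) => i.
exact: ((C1_partial_rho i t0 (UinV Ux)).2 i).2.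
Qed.

(** The link between positive times and the initial datum: continuity on the closed time half-line,
    tested along [1/(n+1)]. *)
Lemma rho_cvg0 x : U x -> rho x n.+1%:R^-1 @[n --> \oo] --> rho x 0.
Proof.
move=> Ux; have cf := hc_continuous H; have cx := subset_closure Ux.
pose A := closure U `*` [set t : R | 0 <= t].
have Ax : A (x, 0) by split => //=.
have c : (fun z : E * R => rho z.1 z.2) @ within A (nbhs (x, 0 : R)) --> rho x 0.
  by rewrite (nbhs_subspace_in Ax); exact: (cf (x, 0)).
have zn : (fun n : nat => (x, n.+1%:R^-1 : R)) @ \oo --> within A (nbhs (x, 0 : R)).
  move=> Q [[P1 P2] [/= nP1 nP2] PQ].
  have := @cvg_harmonic R; move=> /(_ _ nP2) [N _ hN].
  exists N => // n /= Nn; apply: (PQ (x, n.+1%:R^-1)).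
    by split => /=; [exact: nbhs_singleton nP1|exact: hN].
  by split => //=; rewrite invr_ge0.
exact: (cvg_comp _ _ zn c).
Qed.

Lemma bounded_meas_rho t : 0 < t -> bounded_meas U (rho ^~ t).
Proof.
move=> t0; have [M hM] := rho_bounded t.
apply: (bounded_meas_continuous oU (M := M)) => x Ux; first exact: continuous_rho.
by apply: hM; rewrite ?(ltW t0) ?lexx//; exact: subset_closure.
Qed.

Lemma bounded_meas_partial_rho i t : 0 < t -> bounded_meas U (partial i (rho ^~ t)).
Proof.
move=> t0; have [M hM] := partial_rho_bounded t t0.
apply: (bounded_meas_continuous oU (M := M)) => x Ux; first exact: continuous_partial_rho.
by apply: hM; rewrite ?lexx//; exact: subset_closure.
Qed.

Lemma bounded_meas_laplacian_rho t : 0 < t -> bounded_meas U (laplacian (rho ^~ t)).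
Proof.
move=> t0; have [M hM] := dt_bounded t t0.
apply: (bounded_meas_continuous oU (M := M)) => x Ux; first exact: continuous_laplacian_rho.
by rewrite -(hc_equation H)//; apply: hM; rewrite ?lexx//; exact: subset_closure.
Qed.

(* Functions that vanish outside some [inner U r] are bounded as soon as they
   are continuous, even if they blow up at the boundary before multiplication
   by the cutoff. *)
Lemma bounded_meas_cutoff n (f : E -> R) : Defs.periodic L f ->
  (forall x, U x -> {for x, continuous f}) -> bounded_meas U (fun x => chi n x * f x).
Proof.
move=> fper cf; have [Cchi chi01 _ chi0 _] := hc_cutoffs H.
have [r r0 hr] := chi0 n.
have [M hM] := inner_bounded ff r0 fper cf.
apply: (bounded_meas_continuous oU (M := `|M|)) => x Ux.
  by apply: continuous_atM; [exact: ((Cchi n).2 x Ux).1|exact: cf].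
have [ix|nx] := pselect (inner U r x); last by rewrite hr// mul0r normr0.
rewrite normrM -[leRHS]mul1r ler_pM//.
  by have /andP[? ?] := chi01 n x Ux; rewrite ger0_norm.
by rewrite (le_trans (hM x ix))// ler_norm.
Qed.

Lemma vanishing_partial (w : E -> R) i (r : R) x :
  (forall x, U x -> ~ inner U r x -> w x = 0) -> U x -> ~ inner U r x -> partial i w x = 0.
Proof.
move=> w0 Ux nx.
have o : open (U `&` ~` inner U r).
  by apply: openI => //; apply: closed_openC; exact: inner_closed.
have e y : (U `&` ~` inner U r) y -> cst 0 y = w y by move=> [Uy ny]; rewrite w0.
have Ix : (U `&` ~` inner U r) x by [].
by rewrite /partial -(eq_open_derive o e _ Ix) derive_cst.
Qed.

Lemma bounded_meas_vanishing_partial (w : E -> R) i (r : R) : 0 < r ->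
  (forall x, U x -> ~ inner U r x -> w x = 0) -> Defs.periodic L w -> C1_on U w ->
  bounded_meas U (partial i w).
Proof.
move=> r0 w0 wper Cw.
have cp x : U x -> {for x, continuous (partial i w)} by move=> Ux; exact: ((Cw x Ux).2 i).2.
have [M hM] := inner_bounded ff r0 (periodic_partial i wper) cp.
apply: (bounded_meas_continuous oU (M := `|M|)) => x Ux; first exact: cp.
have [ix|nx] := pselect (inner U r x); first by rewrite (le_trans (hM x ix))// ler_norm.
by rewrite (vanishing_partial i w0)// normr0.
Qed.

Definition grad_dot (f : E -> R) (t : R) (x : E) : R :=
  \sum_i partial i f x * partial i (rho ^~ t) x.

Lemma bounded_meas_grad_dot_chi n t : 0 < t -> bounded_meas U (grad_dot (chi n) t).
Proof.
move=> t0; have [Cchi _ _ chi0 _] := hc_cutoffs H.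
have [r r0 hr] := chi0 n; apply: bounded_meas_sum => // i; apply: bounded_measM => //.
  exact: (bounded_meas_vanishing_partial i r0 hr (Cchi n).1 (Cchi n).2).
exact: bounded_meas_partial_rho.
Qed.

Lemma bounded_meas_green n t (g : E -> R) : 0 < t -> C1_on U g -> Defs.periodic L g ->
  bounded_meas U (fun x => chi n x * (g x * laplacian (rho ^~ t) x + grad_dot g t x)).
Proof.
move=> t0 Cg gper; apply: bounded_meas_cutoff.
  move=> x l Ll.
  have e1 : laplacian (rho ^~ t) (x + l) = laplacian (rho ^~ t) x.
    apply: eq_bigr => i _.
    exact: (periodic_partial i (periodic_partial i (hc_periodic H (ltW t0))) x Ll).
  have e2 : grad_dot g t (x + l) = grad_dot g t x.
    apply: eq_bigr => i _; rewrite (periodic_partial i gper x Ll).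
    by rewrite (periodic_partial i (hc_periodic H (ltW t0)) x Ll).
  by rewrite e1 e2 (gper x l Ll).
move=> x Ux; apply: continuous_atD.
  by apply: continuous_atM; [exact: (Cg x Ux).1|exact: continuous_laplacian_rho].
apply: (continuous_at_sum (f := fun i y => partial i g y * partial i (rho ^~ t) y)) => i.
by apply: continuous_atM; [exact: ((Cg x Ux).2 i).2|exact: continuous_partial_rho].
Qed.

(** The divergence of [chi n * g * grad rho] integrates to zero by [mint_partial0]. The derivatives
    of [g] need not be bounded, and none appears on the right-hand side; this is what allows
    [g = F o X_t] later. *)
Lemma green_cutoff n t (g : E -> R) (M : R) : 0 < t -> C1_on U g -> Defs.periodic L g ->
  (forall x, U x -> `|g x| <= M) ->
  mint m U (fun x => chi n x * (g x * laplacian (rho ^~ t) x + grad_dot g t x)) =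
  - mint m U (fun x => g x * grad_dot (chi n) t x).
Proof.
move=> t0 Cg gper gM; have [Cchi _ _ chi0 _] := hc_cutoffs H.
have [r r0 hr] := chi0 n; have [cper Cc] := Cchi n.
pose w i x := chi n x * (g x * partial i (rho ^~ t) x).
have Cr i : C1_on U (partial i (rho ^~ t)) by apply: C1_along_sub (C1_partial_rho i t0).
have Cgr i : C1_on U (fun x => g x * partial i (rho ^~ t) x).
  exact: (C1_alongM oU Cg (Cr i)).
have Cw i : C1_on U (w i) by exact: (C1_alongM oU Cc (Cgr i)).
have wper i : Defs.periodic L (w i).
  move=> x l Ll; rewrite /w (cper x l Ll) (gper x l Ll).
  by rewrite (periodic_partial i (hc_periodic H (ltW t0)) x Ll).
have w0 i x : U x -> ~ inner U r x -> w i x = 0.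
  by move=> Ux nx; rewrite /w hr// mul0r.
have bw i : bounded_meas U (partial i (w i)).
  exact: (bounded_meas_vanishing_partial i r0 (w0 i) (wper i) (Cw i)).
have bg : bounded_meas U g.
  by apply: (bounded_meas_continuous oU (M := M)) => // x Ux; exact: (Cg x Ux).1.
have bA : bounded_meas U (fun x => g x * grad_dot (chi n) t x).
  by apply: bounded_measM => //; exact: bounded_meas_grad_dot_chi.
have bB := bounded_meas_green n t0 Cg gper.
have : mint m U (fun x => \sum_i partial i (w i) x) = 0.
  rewrite mint_sum// big1// => i _.
  apply: (mint_partial0 ff r0 (wper i) (w0 i)) => x Ux.
  - exact: (Cw i x Ux).1.
  - exact: ((Cw i x Ux).2 i).1.
  - exact: ((Cw i x Ux).2 i).2.
rewrite (@eq_mint _ _ _ _ _ (fun x => g x * grad_dot (chi n) t x +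
    chi n x * (g x * laplacian (rho ^~ t) x + grad_dot g t x))); last first.
  move=> x Ux; rewrite /grad_dot /laplacian !mulr_sumr -!big_split/= mulr_sumr -big_split/=.
  apply: eq_bigr => i _.
  have d1 := ((Cc x Ux).2 i).1; have d2 := ((Cg x Ux).2 i).1; have d3 := ((Cr i x Ux).2 i).1.
  rewrite /partial /w (deriveM_fun d1 (derivableM_fun d2 d3)) (deriveM_fun d2 d3).
  rewrite -/(partial i (chi n) x) -/(partial i g x) -/(partial i (rho ^~ t) x); ring.
rewrite mintD// => /eqP; rewrite addrC addr_eq0 => /eqP.
by [].
Qed.

(** [N] depends on [M] and on the time interval but not on [t] or [g]. This uniformity matters in
    [transport_step], where both come from a mean value time that varies with [n]. *)
Lemma cutoff_error (M a b e : R) : 0 < a -> 0 < e -> exists N, forall n t (g : E -> R),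
  (N <= n)%N -> a <= t <= b -> bounded_meas U g -> (forall x, U x -> `|g x| <= M) ->
  `|mint m U (fun x => g x * grad_dot (chi n) t x)| <= e.
Proof.
move=> a0 e0; have [_ _ _ _ small] := hc_cutoffs H.
have M0 : 0 < `|M| + 1 by rewrite ltr_wpDl.
have e1 : 0 < e / (`|M| + 1) by rewrite divr_gt0.
have [N hN] := small a b _ a0 e1; exists N => n t g Nn atb bg gM.
have t0 : 0 < t by case/andP: atb => /(lt_le_trans a0).
have bc := bounded_meas_grad_dot_chi n t0.
have bgc : bounded_meas U (fun x => g x * grad_dot (chi n) t x) by apply: bounded_measM.
rewrite (le_trans (le_norm_mint _ oU bgc))//.
rewrite (@le_trans _ _ (mint m U (fun x => (`|M| + 1) * `|grad_dot (chi n) t x|)))//.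
  apply: le_mint => //; first exact: bounded_meas_norm.
    by apply: bounded_measM => //; [exact: bounded_meas_cst|exact: bounded_meas_norm].
  move=> x Ux; rewrite normrM ler_wpM2r//.
  by rewrite (le_trans (gM x Ux))// (le_trans (ler_norm _))// lerDl.
rewrite mintZ//; last exact: bounded_meas_norm.
by rewrite mulrC -ler_pdivlMr//; exact: hN.
Qed.

(** When the gradient of [g] is bounded, the cutoff can be removed: the left side of [green_cutoff]
    converges boundedly, and its right side vanishes in the limit. *)
Lemma green t (g : E -> R) (M : R) : 0 < t -> C1_on U g -> Defs.periodic L g ->
  (forall x, U x -> `|g x| <= M) -> (forall i x, U x -> `|partial i g x| <= M) ->
  mint m U (fun x => g x * laplacian (rho ^~ t) x) = - mint m U (grad_dot g t).
Proof.
move=> t0 Cg gper gM dgM.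
have bg : bounded_meas U g.
  by apply: (bounded_meas_continuous oU (M := M)) => // x Ux; exact: (Cg x Ux).1.
have bgl : bounded_meas U (fun x => g x * laplacian (rho ^~ t) x).
  by apply: bounded_measM => //; exact: bounded_meas_laplacian_rho.
have bgd : bounded_meas U (grad_dot g t).
  apply: bounded_meas_sum => // i; apply: bounded_measM; last exact: bounded_meas_partial_rho.
  apply: (bounded_meas_continuous oU (M := M)) => x Ux; last exact: dgM.
  exact: ((Cg x Ux).2 i).2.
pose A x := g x * laplacian (rho ^~ t) x + grad_dot g t x.
have bA : bounded_meas U A by exact: bounded_measD.
suff : mint m U A = 0 by rewrite /A mintD// => /eqP; rewrite addr_eq0 => /eqP.
have [Cchi chi01 chi1 _ _] := hc_cutoffs H.
have [_ [MA hMA]] := bA.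
have c1 : mint m U (fun x => chi n x * A x) @[n --> \oo] --> mint m U A.
  apply: (mint_cvg oU (M := MA)).
  - by move=> n; have [] := bounded_meas_green n t0 Cg gper.
  - move=> n x Ux; rewrite normrM -[leRHS]mul1r ler_pM ?hMA//.
    by have /andP[? ?] := chi01 n x Ux; rewrite ger0_norm.
  - move=> x Ux; rewrite -[X in _ --> X]mul1r.
    by apply: cvgM; [exact: chi1|exact: cvg_cst].
have c0 : mint m U (fun x => chi n x * A x) @[n --> \oo] --> (0 : R).
  apply/cvgrPdist_le => e e0.
  have [N hN] := cutoff_error M t t0 e0.
  exists N => // n /= Nn; rewrite sub0r normrN (green_cutoff n t0 Cg gper gM) normrN.
  by apply: hN => //; rewrite !lexx.
by have := cvg_unique _ c1 c0; apply.
Qed.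

Definition grad_sq (t : R) (x : E) : R := \sum_i partial i (rho ^~ t) x ^+ 2.

Lemma bounded_meas_grad_sq t : 0 < t -> bounded_meas U (grad_sq t).
Proof.
move=> t0; apply: bounded_meas_sum => // i; apply: bounded_measX => //.
exact: bounded_meas_partial_rho.
Qed.

Lemma bounded_meas_comp_rho (h : R -> R) t : continuous h -> 0 < t ->
  bounded_meas U (fun x => h (rho x t)).
Proof.
move=> ch t0; have [M hM] := rho_bounded t.
have [B hB] := continuous_bounded_itv M ch.
apply: (bounded_meas_continuous oU (M := B)) => x Ux.
  by apply: (continuous_at_comp (f := rho ^~ t)); [exact: continuous_rho|exact: ch].
by apply: hB; apply: hM; rewrite ?(ltW t0) ?lexx//; exact: subset_closure.
Qed.

(** * Energy identity, maximum principle and conservation of mass *)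

Section energy.
Variables (h dh ddh : R -> R).
Hypotheses (h_dh : forall s : R, is_derive s 1 h (dh s)).
Hypotheses (dh_ddh : forall s : R, is_derive s 1 dh (ddh s)) (c_ddh : continuous ddh).

Let c_dh : continuous dh.
Proof.
move=> s; apply: differentiable_continuous; apply/derivable1_diffP.
by have hs := dh_ddh s; exact: ex_derive.
Qed.

Let c_h : continuous h.
Proof.
move=> s; apply: differentiable_continuous; apply/derivable1_diffP.
by have hs := h_dh s; exact: ex_derive.
Qed.

(** Differentiation under the integral gives the integral of [dh(rho) * laplacian rho], and Green's
    formula with test function [dh(rho)] turns it into minus the integral of
    [ddh(rho) * |grad rho|^2]. *)
Lemma energy_derive (t : R) : 0 < t ->
  is_derive t 1 (fun s => mint m U (fun x => h (rho x s)))
    (- mint m U (fun x => ddh (rho x t) * grad_sq t x)).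
Proof.
move=> t0; have [Mr hMr] := rho_bounded (2 * t).
have [B1 hB1] := continuous_bounded_itv Mr c_dh.
have [B2 hB2] := continuous_bounded_itv Mr c_ddh.
(* All bounds are taken for times in [(t / 2, 2 * t)], a neighbourhood of [t] away from 0. *)
have t20 : 0 < t / 2 by rewrite divr_gt0.
have [Md hMd] := dt_bounded (2 * t) t20.
have [Mp hMp] := partial_rho_bounded t t0.
have Cr : C1_on U (rho ^~ t) by apply: C1_along_sub (C1_rho t0).
have Mr0 x : U x -> `|rho x t| <= Mr.
  move=> Ux; apply: hMr; first exact: subset_closure.
  by rewrite (ltW t0) /= ler_peMl ?(ltW t0)// ler1n.
have [Cg dg] := @C1_along_comp R E 'I_d (@basis_vec R d) U setT (rho ^~ t) dh ddh oU
  (fun x _ => I) (fun s _ => dh_ddh s) (fun s _ => @c_ddh s) Cr.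
have gper : Defs.periodic L (fun x => dh (rho x t)).
  by move=> x l Ll; congr dh; exact: (hc_periodic H (ltW t0) x Ll).
have gM x : U x -> `|dh (rho x t)| <= Num.max B1 (B2 * Mp).
  by move=> Ux; rewrite le_max hB1//; exact: Mr0.
have dgE i x : U x -> partial i (fun x => dh (rho x t)) x = ddh (rho x t) * partial i (rho ^~ t) x.
  exact: dg.
have dgM i x : U x -> `|partial i (fun x => dh (rho x t)) x| <= Num.max B1 (B2 * Mp).
  move=> Ux; rewrite dgE// normrM le_max; apply/orP; right.
  apply: ler_pM => //; first by apply: hB2; exact: Mr0.
  by apply: hMp; rewrite ?lexx//; exact: subset_closure.
have := green t0 Cg gper gM dgM.
rewrite (@eq_mint _ _ m U (grad_dot _ t) (fun x => ddh (rho x t) * grad_sq t x)); last first.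
  move=> x Ux; rewrite /grad_dot /grad_sq mulr_sumr; apply: eq_bigr => i _.
  by rewrite dgE// expr2 mulrA.
move=> <-.
have pos s : t / 2 < s < 2 * t -> 0 < s by case/andP => /(lt_trans t20).
apply: (@is_derive_mint R d m U (fun s x => h (rho x s))
   (fun s x => dh (rho x s) * laplacian (rho ^~ s) x) t (t / 2) (2 * t) (B1 * Md)).
- exact: oU.
- by apply/andP; split; lra.
- move=> s x hs Ux; have s0 := pos s hs; have hd := rho_is_derive Ux s0.
  have dE : 'D_1 (rho x) s = laplacian (rho ^~ s) x by rewrite derive_val.
  by rewrite -dE; apply: is_derive_comp_real => //; exact: ex_derive.
- by move=> s hs; apply: bounded_meas_comp_rho => //; exact: pos.
- move=> s x hs Ux; have s0 := pos s hs; have cx := subset_closure Ux.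
  rewrite normrM ler_pM//.
    apply: hB1; apply: hMr => //; case/andP: hs => _ /ltW ->.
    by rewrite (ltW s0).
  by rewrite -(hc_equation H Ux s0); apply: hMd => //; case/andP: hs => /ltW -> /ltW ->.
Qed.

Hypothesis ddh_ge0 : forall s, 0 <= ddh s.

Lemma energy_nonincreasing (s t : R) : 0 < s -> s <= t ->
  mint m U (fun x => h (rho x t)) <= mint m U (fun x => h (rho x s)).
Proof.
move=> s0 st; pose F s := mint m U (fun x => h (rho x s)).
have dF (u : R) : 0 < u -> is_derive u 1 F (- mint m U (fun x => ddh (rho x u) * grad_sq u x)).
  exact: energy_derive.
have [||c _ E] := @MVT_segment R F (fun u => - mint m U (fun x => ddh (rho x u) * grad_sq u x)) s t st.
- by move=> u; rewrite in_itv /= => /andP[su _]; apply: dF; exact: lt_trans su.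
- apply: continuous_in_subspaceT => u /set_mem/=; rewrite in_itv /= => /andP[su _].
  apply: differentiable_continuous; apply/derivable1_diffP.
  by have h1 := dF u (lt_le_trans s0 su); exact: ex_derive.
rewrite -subr_le0 -/(F t) -/(F s) E mulNr oppr_le0 mulr_ge0 ?subr_ge0//.
apply: mint_ge0 => x Ux; rewrite mulr_ge0// sumr_ge0// => i _; exact: sqr_ge0.
Qed.

Lemma energy_cvg0 : mint m U (fun x => h (rho x n.+1%:R^-1)) @[n --> \oo] -->
  mint m U (fun x => h (rho x 0)).
Proof.
have [M hM] := rho_bounded 1; have [B hB] := continuous_bounded_itv M c_h.
have n0 n : (0 : R) < n.+1%:R^-1 by rewrite invr_gt0.
have n1 n : n.+1%:R^-1 <= (1 : R) by rewrite invf_le1// ler1n.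
apply: (mint_cvg oU (M := B)).
- by move=> n; have [] := bounded_meas_comp_rho c_h (n0 n).
- by move=> n x Ux; apply: hB; apply: hM; [exact: subset_closure|rewrite (ltW (n0 n)) n1].
- by move=> x Ux; exact: (cvg_comp _ _ (rho_cvg0 Ux) (@c_h (rho x 0))).
Qed.

Lemma energy_le_initial t : 0 < t ->
  mint m U (fun x => h (rho x t)) <= mint m U (fun x => h (rho x 0)).
Proof.
move=> t0; have c := energy_cvg0; rewrite -(cvg_lim _ c)//.
apply: limr_ge; first by apply/cvg_ex; eexists; exact: c.
have [N _ hN] := near_infty_natSinv_lt (PosNum t0).
exists N => // n /= /hN /ltW; apply: energy_nonincreasing; by rewrite invr_gt0.
Qed.

End energy.

Let is_derive_affine (k a s : R) : is_derive s 1 (fun s : R => a + k * s) k.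
Proof.
have h := is_deriveD (is_derive_cst a s 1) (is_deriveZ k (is_derive_id s 1)).
by apply: is_derive_eq h _; rewrite add0r [k *: 1]mulr1.
Qed.

(** Maximum principle, with [k = 1] or [k = -1] for the two sides. A third of the cubed positive
    part of [a + k * s] is convex, so its integral along the flow does not exceed the initial value
    0, and a continuous nonnegative function with integral at most 0 vanishes. The cube, unlike the
    square, has a continuous second derivative. *)
Lemma initial_barrier (a k : R) : (forall x, U x -> a + k * rho x 0 <= 0) ->
  forall x t, U x -> 0 < t -> a + k * rho x t <= 0.
Proof.
move=> init x t Ux t0.
pose u (s : R) := a + k * s.
pose h (s : R) := 3^-1 * (sqpos (u s) * u s).
have u_k (s : R) : is_derive s 1 u k by exact: is_derive_affine.
have dsq (s : R) : is_derive s 1 (fun s => sqpos (u s)) (dsqpos (u s) * k).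
  have uk := u_k s; have <- : 'D_1 u s = k by rewrite derive_val.
  by apply: is_derive_comp_real; [exact: is_derive_sqpos|exact: ex_derive].
have h1 (s : R) : is_derive s 1 h (k * sqpos (u s)).
  have hh := is_deriveZ 3^-1 (is_deriveM (dsq s) (u_k s)).
  apply: is_derive_eq hh _; rewrite /GRing.scale /=.
  rewrite /dsqpos /sqpos; have [u0|u0] := leP (u s) 0.
    by rewrite !expr2 !(mul0r, mulr0, addr0).
  by field.
have h2 (s : R) : is_derive s 1 (fun s => k * sqpos (u s)) (k ^+ 2 * dsqpos (u s)).
  by apply: is_derive_eq (is_deriveZ k (dsq s)) _; rewrite /GRing.scale /=; ring.
have h3 : continuous (fun s : R => k ^+ 2 * dsqpos (u s)).
  move=> s; have cu : {for s, continuous u}.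
    by apply: differentiable_continuous; apply/derivable1_diffP; have uk := u_k s; exact: ex_derive.
  exact: (@continuous_atM R R s _ _ (@continuous_at_cst R R s (k ^+ 2)) (@continuous_at_comp R R s _ u cu (@continuous_dsqpos R (u s)))).
have h4 (s : R) : 0 <= k ^+ 2 * dsqpos (u s) by rewrite mulr_ge0 ?sqr_ge0// dsqpos_ge0.
have hE (s : R) : u s <= 0 -> h s = 0 by move=> us; rewrite /h sqpos_le0// mul0r mulr0.
have hpos (s : R) : 0 < u s -> 0 < h s.
  by move=> us; rewrite mulr_gt0 ?invr_gt0// mulr_gt0// sqpos_gt0.
have h0 (s : R) : 0 <= h s by have [/hE ->//|/hpos/ltW] := leP (u s) 0.
have := energy_le_initial h1 h2 h3 h4 t0.
rewrite (@eq_mint _ _ m U (fun x => h (rho x 0)) (cst 0)) ?mint_cst//; last first.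
  by move=> y Uy; rewrite hE//; exact: init.
move=> le0; rewrite leNgt; apply/negP => /hpos pos.
have ch : continuous h.
  by move=> s; apply: differentiable_continuous; apply/derivable1_diffP; have uk := h1 s; exact: ex_derive.
have := mint_le0_continuous ff (f := fun x => h (rho x t)) _ (bounded_meas_comp_rho ch t0) _ _ le0 Ux.
move=> E; move: pos; rewrite E ?ltxx//.
- by move=> y l Ll; congr h; exact: (hc_periodic H (ltW t0) y Ll).
- by move=> y Uy; apply: (continuous_at_comp (f := rho ^~ t)); [exact: continuous_rho|exact: ch].
Qed.

Lemma bounded_meas_rho0 : bounded_meas U (rho ^~ 0).
Proof.
have [M hM] := rho_bounded 0; split.
  have mf n : measurable_fun (U : set (borel R d)) (fun x => rho x n.+1%:R^-1).
    by have [] : bounded_meas U (rho ^~ n.+1%:R^-1) by apply: bounded_meas_rho; rewrite invr_gt0.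
  apply: (measurable_fun_cvg mf).
  by move=> x Ux; exact: rho_cvg0.
by exists M => x Ux; apply: hM; [exact: subset_closure|rewrite !lexx].
Qed.

(** The identity and its negative both have zero second derivative, so the integrals of [rho] and of
    [-rho] are both nonincreasing. *)
Lemma mass_conserved t : 0 < t -> mint m U (rho ^~ t) = mint m U (rho ^~ 0).
Proof.
move=> t0.
have c0 : continuous (cst 0 : R -> R) by exact: cst_continuous.
have dk (k s : R) : is_derive s 1 (cst k : R -> R) 0 by exact: is_derive_cst.
have le0 := energy_le_initial (fun s => is_derive_affine 1 0 s) (dk 1) c0 (fun s => lexx 0) t0.
have le1 := energy_le_initial (fun s => is_derive_affine (-1) 0 s) (dk (-1)) c0 (fun s => lexx 0) t0.
have E1 s : mint m U (fun x => 0 + 1 * rho x s) = mint m U (rho ^~ s).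
  by apply: eq_mint => x _; rewrite add0r mul1r.
have b0 := bounded_meas_rho0.
have E2 s : bounded_meas U (rho ^~ s) -> mint m U (fun x => 0 + -1 * rho x s) = - mint m U (rho ^~ s).
  by move=> bs; rewrite -mintN//; apply: eq_mint => x _; rewrite add0r mulN1r.
move: le0 le1; rewrite !E1 !E2//; last exact: bounded_meas_rho.
by rewrite lerN2 => h1 h2; apply/eqP; rewrite eq_le h1.
Qed.

Definition energy2 (t : R) : R := mint m U (fun x => (rho x t - 1) ^+ 2).

Let d1 (s : R) : is_derive s 1 (fun s : R => (s - 1) ^+ 2) (2 * (s - 1)).
Proof.
have h := is_deriveX 2 (is_derive_affine 1 (-1) s).
have E : (fun s : R => -1 + 1 * s) ^+ 2 = (fun s : R => (s - 1) ^+ 2).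
  by apply/funext => x; rewrite fctE mul1r addrC.
rewrite E in h; apply: is_derive_eq h _; rewrite /GRing.scale /= expr1; ring.
Qed.

Let d2 (s : R) : is_derive s 1 (fun s : R => 2 * (s - 1)) 2.
Proof.
have h := is_derive_affine 2 (-2) s.
have E : (fun s : R => -2 + 2 * s) = (fun s : R => 2 * (s - 1)).
  by apply/funext => x; ring.
by rewrite E in h.
Qed.

Let c2 : continuous (fun _ : R => 2 : R). Proof. exact: cst_continuous. Qed.

Lemma energy2_nonincreasing s t : 0 < s -> s <= t -> energy2 t <= energy2 s.
Proof. exact: (energy_nonincreasing d1 d2 c2 (fun _ => ler0n R 2)). Qed.

(** Otherwise the energy would lose more than [e] per unit of time after [T], and over a length [K]
    with [e * K = energy2 T + e] it would become negative. *)
Lemma grad_sq_small (T e : R) : 0 < T -> 0 < e -> exists2 t : R, T <= t &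
  mint m U (grad_sq t) <= e.
Proof.
move=> T0 e0; apply: contrapT => /forall2NP big.
have dE (t : R) : 0 < t -> is_derive t 1 energy2 (- (2 * mint m U (grad_sq t))).
  move=> t0; have := energy_derive d1 d2 c2 t0.
  by rewrite mintZ//; exact: bounded_meas_grad_sq.
have E0 t : 0 <= energy2 t by apply: mint_ge0 => x _; exact: sqr_ge0.
pose K := energy2 T / e + 1.
have K0 : 0 < K by rewrite ltr_wpDl// divr_ge0// ltW.
have TK : T <= T + K by rewrite lerDl ltW.
have [||c /= cI Ec] := @MVT_segment R energy2 (fun u => - (2 * mint m U (grad_sq u))) T (T + K) TK.
- by move=> u; rewrite in_itv /= => /andP[su _]; apply: dE; exact: lt_trans su.
- apply: continuous_in_subspaceT => u /set_mem/=; rewrite in_itv /= => /andP[su _].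
  apply: differentiable_continuous; apply/derivable1_diffP.
  by have h1 := dE u (lt_le_trans T0 su); exact: ex_derive.
move: cI; rewrite in_itv /= => /andP[Tc _].
have [//|/negP] := big c; rewrite -ltNge => gc.
move: Ec; rewrite addrAC subrr add0r => Ec.
have : energy2 (T + K) < 0.
  have -> : energy2 (T + K) = energy2 T - 2 * mint m U (grad_sq c) * K by lra.
  rewrite subr_lt0; apply: (@lt_trans _ _ (e * K)).
    by rewrite /K mulrDr mulr1 mulrCA divff ?gt_eqF// mulr1 ltrDl.
  by rewrite ltr_pM2r//; lra.
by rewrite ltNge E0.
Qed.

Lemma partial_small (T e : R) : 0 < T -> 0 < e -> exists2 t : R, T <= t &
  forall i, mint m U (fun x => `|partial i (rho ^~ t) x|) <= e.
Proof.
(* The bound [e ^+ 2] on the squared norm makes both terms of the later AM-GM split equal to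
   [e / 2]. *)
move=> T0 e0; have e2 : 0 < e ^+ 2 by rewrite exprn_gt0.
have [t Tt ht] := grad_sq_small T0 e2; exists t => // i.
have t0 : 0 < t by exact: lt_le_trans Tt.
have bi := bounded_meas_partial_rho i t0.
rewrite (@le_trans _ _ (mint m U (fun x => e / 2 + (2 * e)^-1 * grad_sq t x)))//.
  apply: le_mint => //; first exact: bounded_meas_norm.
    apply: bounded_measD => //; first exact: bounded_meas_cst.
    by apply: bounded_measM => //; [exact: bounded_meas_cst|exact: bounded_meas_grad_sq].
  move=> x Ux; pose a := partial i (rho ^~ t) x.
  have ag : a ^+ 2 <= grad_sq t x.
    by rewrite /grad_sq (bigD1 i)//= lerDl sumr_ge0// => j _; exact: sqr_ge0.
  (* AM-GM *)
  rewrite (@le_trans _ _ (e / 2 + (2 * e)^-1 * a ^+ 2))//; last first.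
    by rewrite lerD2l ler_wpM2l// invr_ge0 mulr_ge0// ltW.
  rewrite -/a -(real_normK (num_real a)) -subr_ge0.
  have -> : e / 2 + (2 * e)^-1 * `|a| ^+ 2 - `|a| = (2 * e)^-1 * (`|a| - e) ^+ 2.
    by field; rewrite gt_eqF.
  by rewrite mulr_ge0 ?sqr_ge0// invr_ge0 mulr_ge0// ltW.
have bg := bounded_meas_grad_sq t0.
rewrite mintD//; [|exact: bounded_meas_cst|by apply: bounded_measM => //; exact: bounded_meas_cst].
rewrite (mint_cst oU mU1) mintZ//.
rewrite (@le_trans _ _ (e / 2 + (2 * e)^-1 * e ^+ 2))//.
  by rewrite lerD2l ler_wpM2l// invr_ge0 mulr_ge0// ltW.
by rewrite le_eqVlt; apply/orP; left; apply/eqP; field; rewrite gt_eqF.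
Qed.

End heat.

(** * From small gradients to nearly constant on small balls *)

Section translation.
Context {R : realType} {d : nat} {U L : set 'rV[R]_d} {m : probability (borel R d) R}.
Local Notation E := 'rV[R]_d.
Hypothesis ff : flow_facts U L m.
Let oU : open U := ff_open ff.

(** The sign with value 1 at 0, built from an indicator so that it is measurable; multiplying by it
    linearises the absolute value. *)
Definition sign (u : R) : R := 2 * \1_(`[0, +oo[%classic : set R) u - 1.

Lemma measurable_sign : measurable_fun setT sign.
Proof.
by apply: measurable_funB => //; apply: measurable_funM.
Qed.

Lemma sign_ge0 (u : R) : 0 <= u -> sign u = 1.
Proof. by move=> u0; rewrite /sign indicE mem_set ?mulr1/= ?in_itv/= ?u0//; ring. Qed.

Lemma sign_lt0 (u : R) : u < 0 -> sign u = -1.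
Proof.
move=> u0; rewrite /sign indicE memNset ?mulr0 ?add0r//=.
by rewrite in_itv /= andbT leNgt u0.
Qed.

Lemma sign_mul (u : R) : sign u * u = `|u|.
Proof.
have [u0|u0] := leP 0 u; first by rewrite sign_ge0// mul1r ger0_norm.
by rewrite sign_lt0// mulN1r ltr0_norm.
Qed.

Lemma norm_sign_le1 (u : R) : `|sign u| <= 1.
Proof.
have [u0|u0] := leP 0 u; first by rewrite sign_ge0// normr1.
by rewrite sign_lt0// normrN1.
Qed.

Let measurable_inner (r : R) : measurable (inner U r : set (borel R d)).
Proof. by apply: closed_measurable_rV; exact: inner_closed. Qed.

Lemma inner_translate (r s : R) (w y : E) : inner U s y -> `|w| + r <= s -> 0 < r ->
  inner U r (w + y).
Proof.
move=> iy wr r0 z; rewrite mx_norm_ball /ball_ /= => wz; apply: iy.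
rewrite mx_norm_ball /ball_ /=; apply: lt_le_trans wr.
rewrite (_ : y - z = - w + (w + y - z)); last by rewrite !addrA addNr add0r.
by rewrite (le_lt_trans (ler_normD _ _))// normrN ltrD2l.
Qed.

Lemma measurable_fun_translate (g : E -> R) (s : R) (w : E) :
  (forall x, U x -> {for x, continuous g}) -> `|w| < s ->
  measurable_fun (inner U s : set (borel R d)) (fun y => g (w + y)).
Proof.
move=> cg ws.
have s0 : 0 < s by apply: le_lt_trans ws.
pose O : set E := (fun y => w + y) @^-1` U.
have oO : open O.
  have c := @continuous_translate R E w.
  by move: c => /continuousP; apply.
apply: (@measurable_funS _ _ (borel R d) R O).
- exact: open_measurable_rV.
- move=> y iy; apply: (@inner_sub _ _ U (s - `|w|)); first by rewrite subr_gt0.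
  by apply: (inner_translate iy); rewrite ?subr_gt0// addrC subrK.
- apply: (measurable_fun_rV_continuous oO) => x Ox.
  apply: (@continuous_comp E E R (fun y => w + y) g x); first exact: continuous_translate.
  exact: cg.
Qed.

Lemma bounded_meas_patch (A : set E) (f : E -> R) (M : R) :
  measurable (A : set (borel R d)) -> measurable_fun (A : set (borel R d)) f ->
  (forall x, A x -> `|f x| <= M) -> bounded_meas setT (f \_ A).
Proof.
move=> mA mf fM; split; first by apply/(measurable_restrictT _ _).1.
exists `|M| => x _; rewrite patchE; case: ifPn => [/set_mem Ax|_].
  by rewrite (le_trans (fM x Ax))// ler_norm.
by rewrite normr0.
Qed.

Lemma bounded_measT_sub (f : E -> R) : bounded_meas setT f -> bounded_meas U f.
Proof.
move=> [mf [M hM]]; split; last by exists M => x _; exact: hM.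
exact: (measurable_funS measurableT (@subsetT _ _) mf).
Qed.

(* The derivative in [s] of the integral of [sign (f (v + y) - f y)] times
   [f (s v + y) - f y] is controlled by translation invariance. *)
Lemma translation_estimate (f : E -> R) (r : R) (v : E) :
  C1_on U f -> Defs.periodic L f -> 2 * `|v| < r ->
  (forall i, bounded_meas U (partial i f)) ->
  mint m U ((fun y => `|f (v + y) - f y|) \_ (inner U (2 * r))) <=
  `|v| * \sum_i mint m U (fun x => `|partial i f x|).
Proof.
move=> Cf fper vr bp.
have r0 : 0 < r by apply: le_lt_trans vr; rewrite mulr_ge0.
have r20 : 0 < 2 * r by rewrite mulr_gt0.
pose A := inner U (2 * r).
have mA : measurable (A : set (borel R d)) by exact: measurable_inner.
(* The parameter ranges over [(-2, 2)], so that the derivative exists at both endpoints of [[0, 1]];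
   hence the factor 2 in [2 * |v| < r]. *)
have sv (s : R) : `|s| < 2 -> `|s *: v| < r.
  by move=> s2; rewrite normrZ; apply: le_lt_trans vr; rewrite ler_wpM2r// ltW.
have svA (s : R) y : `|s| < 2 -> A y -> inner U r (s *: v + y).
  move=> s2 Ay; apply: (inner_translate Ay) => //; have := sv s s2; lra.
have AU y : A y -> U y by exact: inner_sub.
have cf x : U x -> {for x, continuous f} by move=> Ux; exact: (Cf x Ux).1.
have cp i x : U x -> {for x, continuous (partial i f)} by move=> Ux; exact: ((Cf x Ux).2 i).2.
have [M hM] := inner_bounded ff r0 fper cf.
have hp i : exists M : R, forall x, inner U r x -> `|partial i f x| <= M.
  exact: (inner_bounded ff r0 (periodic_partial i fper) (cp i)).
pose Mi i : R := projT1 (cid (hp i)).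
have hMi i x : inner U r x -> `|partial i f x| <= Mi i by exact: (projT2 (cid (hp i))).
have M0 : 0 <= `|M| by [].
have rr y : A y -> inner U r y by move=> Ay; have := svA 0 y; rewrite scale0r add0r; apply => //; rewrite normr0.
pose theta y := sign (f (v + y) - f y).
have vs1 : `|v| < 2 * r by have := normr_ge0 v; lra.
have mf (w : E) : `|w| < 2 * r -> measurable_fun (A : set (borel R d)) (fun y => f (w + y)).
  exact: measurable_fun_translate.
have mf0 : measurable_fun (A : set (borel R d)) f.
  have := mf 0; rewrite normr0 => /(_ r20).
  by under eq_fun do rewrite add0r.
have mth : measurable_fun (A : set (borel R d)) theta.
  apply: measurableT_comp; first exact: measurable_sign.
  by apply: measurable_funB => //; exact: mf.
(* The sign factor is frozen at its value for [s = 1], so [F] is differentiable in [s] although the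
   absolute value is not. *)
pose F (s : R) : E -> R := (fun y => theta y * (f (s *: v + y) - f y)) \_ A.
pose dF (s : R) : E -> R := (fun y => theta y * \sum_i v 0 i * partial i f (s *: v + y)) \_ A.
have s2r s : `|s| < 2 -> `|s *: v| < 2 * r by move=> /sv; lra.
have bF s : `|s| < 2 -> bounded_meas U (F s).
  move=> s2; apply: bounded_measT_sub; apply: (@bounded_meas_patch _ _ (1 * (M + M))) => //.
  - apply: measurable_funM => //; apply: measurable_funB => //.
    by apply: mf; exact: s2r.
  - move=> y Ay; rewrite normrM ler_pM// ?norm_sign_le1//.
    by rewrite (le_trans (ler_normB _ _))// lerD ?hM//; [exact: svA|exact: rr].
have dir s y : `|s| < 2 -> A y -> derivable f (s *: v + y) v /\
    'D_v f (s *: v + y) = \sum_i v 0 i * partial i f (s *: v + y).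
  move=> s2 Ay; apply: (C1_on_derive v oU _ Cf).
  by apply: (inner_sub r0); exact: svA.
have hd (s : R) y : -2 < s < 2 -> U y -> is_derive s 1 (F ^~ y) (dF s y).
  rewrite -ltr_norml => s2 Uy; rewrite /F /dF.
  rewrite (_ : (fun s : R => _) = (fun s : R => (if y \in A then theta y else 0) * (f (s *: v + y) - f y))); last first.
    by apply/funext => z; rewrite patchE; case: ifP => // _; rewrite mul0r.
  rewrite patchE; case: ifPn => [/set_mem Ay|_]; last first.
    rewrite (_ : (fun s : R => _) = cst 0); first exact: is_derive_cst.
    by apply/funext => z; rewrite mul0r.
  have [h1 h2] := dir s y s2 Ay.
  have h3 := is_derive_line h1; rewrite h2 in h3.
  have h4 := is_deriveZ (theta y) (is_deriveB h3 (is_derive_cst (f y) s 1)).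
  by apply: is_derive_eq h4 _; rewrite subr0.
pose K := \sum_i `|v 0 i| * Mi i.
have dFM (s : R) y : -2 < s < 2 -> U y -> `|dF s y| <= `|K|.
  rewrite -ltr_norml => s2 Uy; rewrite /dF patchE; case: ifPn => [/set_mem Ay|_]; last by rewrite normr0.
  rewrite normrM -[leRHS]mul1r ler_pM// ?norm_sign_le1// (le_trans _ (ler_norm _))//.
  rewrite (le_trans (ler_norm_sum _ _ _))//; apply: ler_sum => i _; rewrite normrM ler_wpM2l//.
  by apply: hMi; exact: svA.
pose G (s : R) := mint m U (F s).
have dG (s : R) : -2 < s < 2 -> is_derive s 1 G (mint m U (dF s)).
  move=> s2; apply: (@is_derive_mint R d m U F dF s (-2) 2 `|K| oU s2 hd _ dFM) => u u2.
  by apply: bF; rewrite ltr_norml.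
have [||c cI Gc] := @MVT_segment R G (fun s => mint m U (dF s)) 0 1 ler01.
- by move=> s; rewrite in_itv /= => /andP[? ?]; apply: dG; lra.
- apply: continuous_in_subspaceT => s /set_mem/=; rewrite in_itv /= => /andP[? ?].
  apply: differentiable_continuous; apply/derivable1_diffP.
  by have h1 : is_derive s 1 G (mint m U (dF s)) by apply: dG; lra.
have c01 : `|c| <= 1 by move: cI; rewrite in_itv /= => /andP[? ?]; rewrite ger0_norm.
have c2 : `|c| < 2 by lra.
have G0 : G 0 = 0.
  rewrite /G (_ : F 0 = cst 0) ?(mint_cst oU (ff_mU ff))//.
  by apply/funext => y; rewrite /F patchE; case: ifP => //; rewrite scale0r add0r subrr mulr0.
have -> : mint m U ((fun y => `|f (v + y) - f y|) \_ A) = G 1.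
  by congr mint; apply/funext => y; rewrite /F !patchE scale1r sign_mul.
move: Gc; rewrite G0 !subr0 mulr1 => ->.
(* Restricted to [inner U r], the absolute value of the partial derivative satisfies the hypotheses
   of [ff_trans], so its translate by [c *: v] has the same integral. *)
pose w i := (fun y => `|partial i f y|) \_ (inner U r).
have mi : measurable (inner U r : set (borel R d)) by exact: measurable_inner.
have bw i : bounded_meas setT (w i).
  apply: (@bounded_meas_patch _ _ (Mi i)) => //.
    apply: measurableT_comp => //; apply: measurable_funS (bp i).1; first exact: open_measurable_rV.
    exact: inner_sub.
  by move=> x ix; rewrite normr_id; exact: hMi.
have wper i : Defs.periodic L (w i).
  move=> x l Ll; rewrite /w !patchE (periodic_partial i fper x Ll).
  suff -> : (x + l \in inner U r) = (x \in inner U r) by [].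
  apply/idP/idP => /set_mem h; apply/mem_set; last exact: (inner_shift ff).
  by rewrite -[x](addrK l); apply: (inner_shift ff) => //; exact: (ff_opp ff).
have cvr : `|c *: v| < r by exact: sv.
have trans i : mint m U (fun y => w i (y + c *: v)) = mint m U (w i).
  apply: (ff_trans ff (wper i) (bw i) _ cvr) => x nx.
  by rewrite /w patchE memNset.
have bws i : bounded_meas U (fun y => w i (y + c *: v)).
  have [mw [B hB]] := bw i; split; last by exists B => x _; exact: hB.
  apply: (measurable_funS measurableT (@subsetT _ _)).
  apply: (measurableT_comp mw); exact: measurable_shift.
have bdF : bounded_meas U (dF c).
  apply: bounded_measT_sub; apply: (@bounded_meas_patch _ _ `|K|) => //.
    apply: measurable_funM => //; apply: measurable_sum => i; apply: measurable_funM => //.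
    by apply: (@measurable_fun_translate (partial i f)) => [x Ux|]; [exact: cp|exact: s2r].
  move=> y Ay; have Uy := AU y Ay; have := @dFM c y; rewrite /dF patchE mem_set//; apply => //.
  by rewrite -ltr_norml.
rewrite (le_trans (ler_norm _))// (le_trans (le_norm_mint _ oU bdF))//.
rewrite (@le_trans _ _ (mint m U (fun y => `|v| * \sum_i w i (y + c *: v))))//.
  apply: le_mint => //; first exact: bounded_meas_norm.
    apply: bounded_measM => //; first exact: bounded_meas_cst.
    exact: bounded_meas_sum.
  move=> y Uy; rewrite /dF patchE; case: ifPn => [/set_mem Ay|_]; last first.
    rewrite normr0 mulr_ge0// sumr_ge0// => i _; rewrite /w patchE; case: ifP => //.
  rewrite normrM -[leRHS]mul1r ler_pM// ?norm_sign_le1//.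
  rewrite (le_trans (ler_norm_sum _ _ _))// mulr_sumr; apply: ler_sum => i _.
  rewrite normrM ler_pM// ?coord_le_norm// /w patchE mem_set; last by rewrite addrC; exact: svA.
  by rewrite addrC.
rewrite mintZ//; last exact: bounded_meas_sum.
rewrite ler_wpM2l// mint_sum//; apply: ler_sum => i _; rewrite trans.
apply: le_mint => //; [exact: bounded_measT_sub|exact: bounded_meas_norm|].
by move=> x _; rewrite /w patchE; case: ifP => _; rewrite ?lexx// normr_ge0.
Qed.
Lemma measurable_addr :
  measurable_fun setT ((fun z => z.2 + z.1) : (borel R d * borel R d)%type -> borel R d).
Proof.
apply: measurable_fun_rV => // i.
under eq_fun do rewrite mxE.
apply: measurable_funD.
  exact: (measurableT_comp (measurable_coord i) measurable_snd).
exact: (measurableT_comp (measurable_coord i) measurable_fst).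
Qed.

(** With [B = ball x r], integrate [|f z - f y|] over [y] and [z] in [B]. With [v = z - y], Tonelli
    and [translation_estimate] bound this by [2 * r * C * V2] times the sum of the L^1 norms of the
    partial derivatives, [V2] being the volume of the ball of radius [2 * r] that contains every
    [v]. If the bound [e] failed for all [y], the double integral would be at least [e * V1]. The
    constant [K] does not depend on [f]. *)
Lemma local_constancy x : U x -> exists r K : R, [/\ 0 < r, 0 <= K, ball x r `<=` U &
  forall f e, C1_on U f -> Defs.periodic L f -> (forall i, bounded_meas U (partial i f)) ->
    K * (\sum_i mint m U (fun x => `|partial i f x|)) < e ->
    exists2 y, U y &
      (\int[vol R d]_(z in (ball x r : set (borel R d))) (`|f z - f y|)%:E <= e%:E)%E].
Proof.
move=> Ux; have [r1 [C [r10 C0 BU hC]]] := ff_vol ff Ux.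
(* For [|v| < 2 * r] the translation estimate is applied with [4 * r] and needs a margin [8 * r]
   around the points of [B]. *)
pose r := r1 / 10; have r0 : 0 < r by rewrite divr_gt0.
have r10E : r1 = 10 * r by rewrite /r; field.
pose B : set (borel R d) := ball x r.
have mb (y : E) (s : R) : measurable (ball y s : set (borel R d)).
  by apply: open_measurable_rV; exact: ball_open.
have mB : measurable B by exact: mb.
pose B2 : set (borel R d) := ball (0 : E) (2 * r).
have mB2 : measurable B2 by exact: mb.
have r20 : 0 < 2 * r by rewrite mulr_gt0.
have fV1 : vol R d B \is a fin_num.
  by rewrite ge0_fin_numE//; exact: vol_ball_lty.
have fV2 : vol R d B2 \is a fin_num.
  by rewrite ge0_fin_numE//; exact: vol_ball_lty.
pose V1 := fine (vol R d B); pose V2 := fine (vol R d B2).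
have V10 : 0 < V1 by rewrite fine_gt0// vol_ball_gt0//= vol_ball_lty.
have V20 : 0 <= V2 by rewrite fine_ge0.
pose k := 2 * r * C; have k0 : 0 <= k by rewrite !mulr_ge0// ltW.
have BB : B `<=` ball x r1 by apply: le_ball; rewrite r10E ler_peMl ?(ltW r0)// ler1n.
have BU' : B `<=` U by move=> y /BB /BU.
exists r, (k * V2 / V1); split => //; first by rewrite divr_ge0 ?mulr_ge0// ltW.
move=> f e Cf fper bp he; apply: contrapT => no.
set dl := \sum_i _ in he.
have dl0 : 0 <= dl by apply: sumr_ge0 => i _; exact: mint_ge0.
have cf y : U y -> {for y, continuous f} by move=> Uy; exact: (Cf y Uy).1.
have mU : measurable (U : set (borel R d)) by exact: open_measurable_rV.
pose psi := f \_ U.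
have mpsi : measurable_fun (setT : set (borel R d)) psi.
  by apply/(measurable_restrictT _ _).1 => //; exact: measurable_fun_rV_continuous.
have psiE y : B y -> psi y = f y by move=> By; rewrite /psi patchE mem_set//; exact: BU'.
(* The integrand in the variables [y] and [v]; the two indicators keep both [y] and [v + y] in
   [B]. *)
pose Phi (z : borel R d * borel R d) : \bar R :=
  (\1_B z.1 * \1_B (z.2 + z.1) * `|psi (z.2 + z.1) - psi z.1|)%:E.
have i1 y : B y -> \1_B y = 1 :> R by move=> By; rewrite indicE mem_set.
have i0 y : ~ B y -> \1_B y = 0 :> R by move=> By; rewrite indicE memNset.
have m1 : measurable_fun (setT : set (borel R d)) (\1_B : borel R d -> R) by exact: measurable_indic.
have mPhi : measurable_fun setT Phi.
  apply/measurable_EFinP; apply: measurable_funM.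
    apply: measurable_funM; first exact: (measurableT_comp m1 measurable_fst).
    exact: (measurableT_comp m1 measurable_addr).
  apply: measurableT_comp => //; apply: measurable_funB.
    exact: (measurableT_comp mpsi measurable_addr).
  exact: (measurableT_comp mpsi measurable_fst).
have Phi0 z : (0 <= Phi z)%E by rewrite lee_fin !mulr_ge0.
have := @fubini_tonelli _ _ _ _ R (vol R d) (vol R d) Phi mPhi Phi0.
have lower : ((e * V1)%:E <= \int[vol R d]_y \int[vol R d]_v Phi (y, v))%E.
  have -> : ((e * V1)%:E = \int[vol R d]_(y in B) (cst e%:E y))%E.
    by rewrite integral_cst// EFinM fineK.
  rewrite integral_mkcond; apply: ge0_le_integral => //.
  - by move=> y _; rewrite patchE; case: ifP => //= _; rewrite lee_fin; apply: le_trans (ltW he); rewrite mulr_ge0// divr_ge0 ?mulr_ge0// ltW.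
  - by apply/(measurable_restrictT _ _).1.
  - exact: (@measurable_fun_fubini_tonelli_F _ _ _ _ R (vol R d) Phi mPhi).
  move=> y _; rewrite patchE; case: ifPn => [/set_mem By|_]; last exact: integral_ge0.
  have Uy := BU' _ By.
  have -> : (\int[vol R d]_v Phi (y, v) =
      \int[vol R d]_(z in B) (`|f z - f y|)%:E)%E.
    pose g (z : E) : \bar R := (\1_B z * `|psi z - psi y|)%:E.
    have mg : measurable_fun (setT : set (borel R d)) g.
      apply/measurable_EFinP; apply: measurable_funM => //.
      by apply: measurableT_comp => //; exact: measurable_funB.
    have g0 z : (0 <= g z)%E by rewrite lee_fin mulr_ge0.
    rewrite [RHS]integral_mkcond -[LHS]/(\int[vol R d]_v Phi (y, v))%E.
    transitivity (\int[vol R d]_v g (v + y)%R)%E.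
      by apply: eq_integral => v _; rewrite /Phi /g /= (i1 y By) mul1r.
    rewrite (ge0_integral_vol_shift y mg g0); apply: eq_integral => z _.
    rewrite /g patchE indicE; case: ifPn => [/set_mem Bz|_]; last by rewrite mul0r.
    by rewrite mul1r !psiE.
  rewrite leNgt; apply/negP => h; apply: no; exists y => //; exact: ltW.
have upper : (\int[vol R d]_v \int[vol R d]_y Phi (y, v) <= (k * dl * V2)%:E)%E.
  have -> : ((k * dl * V2)%:E = \int[vol R d]_(v in B2) (cst (k * dl)%:E v))%E.
    by rewrite integral_cst// EFinM fineK.
  rewrite [leRHS]integral_mkcond; apply: ge0_le_integral => //.
  - by move=> v _; exact: integral_ge0.
  - exact: (@measurable_fun_fubini_tonelli_G _ _ _ _ R (vol R d) Phi mPhi).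
  - by apply/(measurable_restrictT _ _).1.
  move=> v _; rewrite patchE; case: ifPn => [/set_mem B2v|nB2]; last first.
    rewrite integral0_eq// => y _; rewrite /Phi /=.
    have [By|nBy] := pselect (B y); last by rewrite (i0 y nBy) !mul0r.
    have [Bvy|nBvy] := pselect (B (v + y)); last by rewrite (i0 _ nBvy) mulr0 mul0r.
    exfalso.
    move/negP: nB2; apply; apply/mem_set.
    move: By Bvy; rewrite /B /B2 /= !mx_norm_ball /ball_ /= sub0r normrN => h1 h2.
    rewrite (_ : v = (x - y) - (x - (v + y))); last by apply/matrixP => i j; rewrite !mxE; ring.
    rewrite (le_lt_trans (ler_normB _ _))//; lra.
  have v2 : `|v| < 2 * r.
    by move: B2v; rewrite /B2 /= mx_norm_ball /ball_ /= sub0r normrN.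
  pose w := (fun y => `|f (v + y) - f y|) \_ (inner U (2 * (4 * r))).
  have v4 : 2 * `|v| < 4 * r by lra.
  have te := translation_estimate Cf fper v4 bp.
  have mA : measurable (inner U (2 * (4 * r)) : set (borel R d)) by exact: measurable_inner.
  have v8 : `|v| < 2 * (4 * r) by lra.
  have z8 : `|0 : E| < 2 * (4 * r) by rewrite normr0; lra.
  have mw : measurable_fun (setT : set (borel R d)) w.
    apply/(measurable_restrictT _ _).1 => //; apply: measurableT_comp => //.
    apply: measurable_funB; first exact: (measurable_fun_translate cf v8).
    have := measurable_fun_translate cf z8.
    by under eq_fun do rewrite add0r.
  have w0 y : 0 <= w y by rewrite /w patchE; case: ifP.
  have wper : Defs.periodic L w.
    move=> y l Ll; rewrite /w !patchE addrA !(fper _ l Ll).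
    suff -> : (y + l \in inner U (2 * (4 * r))) = (y \in inner U (2 * (4 * r))) by [].
    apply/idP/idP => /set_mem h; apply/mem_set; last exact: (inner_shift ff).
    by rewrite -[y](addrK l); apply: (inner_shift ff) => //; exact: (ff_opp ff).
  have BA y : B y -> inner U (2 * (4 * r)) y.
    move=> By z yz; apply: BU; have -> : r1 = r + 9 * r by rewrite r10E; ring.
    apply: ball_triangle By _; apply: le_ball yz; lra.
  apply: (@le_trans _ _ (\int[vol R d]_(y in (ball x r1 : set (borel R d))) (w y)%:E)%E).
    rewrite [leRHS]integral_mkcond; apply: ge0_le_integral => //.
    - exact: (measurableT_comp mPhi (pair2_measurable v)).
    - by apply/(measurable_restrictT _ _).1 => //; apply/measurable_EFinP; exact: (measurable_funS measurableT (@subsetT _ _) mw).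
    move=> y _; rewrite /Phi patchE /=.
    have [By|nBy] := pselect (B y); last first.
      by rewrite (i0 y nBy) !mul0r; case: ifP; rewrite lee_fin.
    rewrite (mem_set (BB _ By)) lee_fin (i1 y By) mul1r.
    have [Bvy|nBvy] := pselect (B (v + y)); last first.
      by rewrite (i0 _ nBvy) mul0r.
    rewrite (i1 _ Bvy) mul1r !psiE// /w patchE mem_set//.
    exact: BA.
  have mwU : measurable_fun (U : set (borel R d)) w.
    exact: (measurable_funS measurableT (@subsetT _ _) mw).
  rewrite (le_trans (hC w wper mwU (fun y _ => w0 y)))//.
  have bw : bounded_meas U w.
    have [M hM] := inner_bounded ff r20 fper cf.
    apply: bounded_measT_sub; apply: (@bounded_meas_patch _ _ (M + M)) => //.
      exact: (measurable_restrictT _ mA).2.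
    move=> y Ay; rewrite normr_id (le_trans (ler_normB _ _))// lerD// hM//.
      by apply: (inner_translate Ay) => //; lra.
    by apply: inner_le Ay; lra.
  rewrite -mint_EFin// -EFinM lee_fin (@le_trans _ _ (C * (2 * r * dl)))//.
    rewrite ler_wpM2l//; apply: (le_trans te); rewrite ler_wpM2r//; exact: ltW.
  by rewrite /k; lra.
move=> E1; move: (le_trans lower (eq_ind _ (fun z => z <= _)%E upper _ (esym E1))).
rewrite lee_fin leNgt => /negP; apply.
by move: he; rewrite mulrAC ltr_pdivrMr// mulrAC.
Qed.

(** * From local constants to the global constant 1 *)

Section sequence.
Variables (psi : nat -> E -> R) (M : R).
Hypothesis C1_psi : forall n, C1_on U (psi n).
Hypothesis psi_per : forall n, Defs.periodic L (psi n).
Hypothesis psi_M : forall n x, U x -> `|psi n x| <= M.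
Hypothesis partial_psi : forall n i, bounded_meas U (partial i (psi n)).
Hypothesis grad_small : forall e : R, 0 < e -> exists N, forall n, (N <= n)%N ->
  \sum_i mint m U (fun x => `|partial i (psi n) x|) <= e.

(** The reference constants depend on [n] and need not converge; what matters is that one sequence
    serves several sets. *)
Definition near_const (A : set E) (a : nat -> R) : Prop :=
  forall e : R, 0 < e -> exists N, forall n, (N <= n)%N ->
   (\int[vol R d]_(z in (A : set (borel R d))) (`|psi n z - a n|)%:E <= e%:E)%E.

Let mb (y : E) (s : R) : measurable (ball y s : set (borel R d)).
Proof. by apply: open_measurable_rV; exact: ball_open. Qed.

Let mU : measurable (U : set (borel R d)). Proof. exact: open_measurable_rV. Qed.

Let mpsi n (a : R) (A : set (borel R d)) : measurable A -> A `<=` U ->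
  measurable_fun A (fun z => (`|psi n z - a|)%:E).
Proof.
move=> mA AU; apply/measurable_EFinP; apply: measurableT_comp => //.
apply: measurable_funB => //; apply: (measurable_funS mU AU).
by apply: (measurable_fun_rV_continuous oU) => x Ux; exact: (C1_psi n Ux).1.
Qed.

Lemma near_const_sub (A B : set (borel R d)) a : measurable A -> measurable B ->
  A `<=` B -> B `<=` U -> near_const B a -> near_const A a.
Proof.
move=> mA mB AB BU h e e0; have [N hN] := h e e0; exists N => n Nn.
apply: le_trans (hN n Nn); apply: ge0_subset_integral => //.
exact: mpsi.
Qed.

Lemma near_const_local x : U x -> exists r (b : nat -> R), [/\ 0 < r, ball x r `<=` U,
  forall n, `|b n| <= M & near_const (ball x r) b].
Proof.
move=> Ux; have [r [K [r0 K0 BU h]]] := local_constancy Ux.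
(* The extra [1/(n+1)] provides the strict inequality required by [local_constancy]. *)
pose e_ n := K * (\sum_i mint m U (fun x => `|partial i (psi n) x|)) + n.+1%:R^-1.
have hn n : exists y, U y /\ (\int[vol R d]_(z in (ball x r : set (borel R d)))
    (`|psi n z - psi n y|)%:E <= (e_ n)%:E)%E.
  have [|y Uy hy] := h (psi n) (e_ n) (C1_psi n) (psi_per n) (partial_psi n).
    by rewrite ltrDl invr_gt0.
  by exists y.
have [y hy] := choice hn.
exists r, (fun n => psi n (y n)); split => // [n|]; first by apply: psi_M; case: (hy n).
move=> e e0; have e1 : 0 < e / 2 / (K + 1) by rewrite !divr_gt0// ltr_wpDl.
have [N1 hN1] := grad_small e1.
have e2 : 0 < e / 2 by rewrite divr_gt0.
have [N2 _ hN2] := near_infty_natSinv_lt (PosNum e2).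
exists (maxn N1 N2) => n; rewrite geq_max => /andP[n1 n2].
apply: (le_trans (hy n).2); rewrite lee_fin /e_.
have -> : e = e / 2 + e / 2 by lra.
apply: lerD; last by apply: ltW; exact: hN2.
have := hN1 n n1 => /(ler_wpM2l K0) /le_trans; apply.
rewrite mulrC mulrAC ler_pdivrMr ?ltr_wpDl//.
by rewrite ler_wpM2l ?lerDl// ltW.
Qed.

(** The difference of the constants, multiplied by the positive volume of the ball, is at most the
    sum of the two L^1 errors. *)
Lemma near_const_unique x r a b : 0 < r -> ball x r `<=` U ->
  near_const (ball x r) a -> near_const (ball x r) b ->
  forall e : R, 0 < e -> exists N, forall n, (N <= n)%N -> `|a n - b n| <= e.
Proof.
move=> r0 BU ha hb e e0.
pose V := fine (vol R d (ball x r)).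
have fV : vol R d (ball x r : set (borel R d)) \is a fin_num.
  by rewrite ge0_fin_numE//; exact: vol_ball_lty.
have V0 : 0 < V by rewrite fine_gt0// vol_ball_gt0//= vol_ball_lty.
have e1 : 0 < e * V / 2 by rewrite divr_gt0// mulr_gt0.
have [N1 h1] := ha _ e1; have [N2 h2] := hb _ e1.
exists (maxn N1 N2) => n; rewrite geq_max => /andP[n1 n2].
rewrite -(ler_pM2r V0) -lee_fin EFinM fineK//.
have -> : (e * V = e * V / 2 + e * V / 2)%R by lra.
rewrite EFinD; apply: le_trans (leeD (h1 n n1) (h2 n n2)).
rewrite -integral_cst// -ge0_integralD//; [|exact: mpsi..].
apply: ge0_le_integral => //.
- by move=> z _; rewrite lee_fin.
- by apply: emeasurable_funD; exact: mpsi.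
move=> z _; rewrite lee_fin.
have -> : a n - b n = (psi n z - b n) - (psi n z - a n) by ring.
by rewrite addrC (le_trans (ler_normB _ _))// addrC.
Qed.

Lemma near_const_shift (A : set (borel R d)) a b : measurable A -> A `<=` U ->
  (vol R d A < +oo)%E -> near_const A a ->
  (forall e : R, 0 < e -> exists N, forall n, (N <= n)%N -> `|a n - b n| <= e) ->
  near_const A b.
Proof.
move=> mA AU Afin ha ab e e0.
have fV : vol R d A \is a fin_num by rewrite ge0_fin_numE.
pose V := fine (vol R d A); have V0 : 0 <= V by rewrite fine_ge0.
have e1 : 0 < e / 2 / (V + 1) by rewrite !divr_gt0// ltr_wpDl.
have e2 : 0 < e / 2 by rewrite divr_gt0.
have [N1 h1] := ha _ e2; have [N2 h2] := ab _ e1.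
exists (maxn N1 N2) => n; rewrite geq_max => /andP[n1 n2].
have -> : e = e / 2 + e / 2 :> R by lra.
have h3 : (\int[vol R d]_(z in A) (cst (`|a n - b n|)%:E z) <= (e / 2)%:E)%E.
  have -> : (\int[vol R d]_(z in A) (cst (`|a n - b n|)%:E z) = (`|a n - b n| * V)%:E)%E.
    by rewrite integral_cst// EFinM fineK.
  rewrite lee_fin (le_trans (ler_wpM2r V0 (h2 n n2)))// mulrAC ler_pdivrMr ?ltr_wpDl//.
  by rewrite ler_wpM2l ?lerDl// ltW.
rewrite EFinD; apply: le_trans (leeD (h1 n n1) h3).
rewrite -ge0_integralD//; [|exact: mpsi|by move=> z _; rewrite lee_fin].
apply: ge0_le_integral => //; first exact: mpsi.
- by apply: emeasurable_funD => //; exact: mpsi.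
move=> z _; rewrite lee_fin.
have -> : psi n z - b n = (psi n z - a n) + (a n - b n) by ring.
exact: ler_normD.
Qed.

(** Connectedness, applied to the set of points with a ball on which [a] works. It is open. At a
    limit point in [U], the local constants compete with [a] on a common small ball, so they agree
    asymptotically by [near_const_unique] and may be replaced by [a]. *)
Lemma near_const_everywhere : exists2 a : nat -> R, forall n, `|a n| <= M &
  forall x, U x -> exists2 r, 0 < r & ball x r `<=` U /\ near_const (ball x r) a.
Proof.
have [x0 Ux0] := ff_nonempty ff.
have [r0 [a [r00 BU0 aM ha]]] := near_const_local Ux0.
exists a => //.
pose S : set E := [set x | exists2 r, 0 < r & ball x r `<=` U /\ near_const (ball x r) a].
suff SU : U `&` S = U by move=> x Ux; have [] : (U `&` S) x by rewrite SU.
have oS : open S.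
  rewrite openE => x [r rr [BU h]]; apply/nbhs_ballP; exists (r / 2) => /= [|y xy].
    by rewrite divr_gt0.
  have sub : ball y (r / 2) `<=` ball x r.
    by move=> z yz; rewrite (_ : r = r / 2 + r / 2); [exact: ball_triangle xy yz|lra].
  exists (r / 2); first by rewrite divr_gt0.
  split; first exact: subset_trans BU.
  exact: (near_const_sub (mb y (r / 2)) (mb x r) sub BU h).
apply: (ff_conn ff).
- by exists x0; split=> //; exists r0.
- by exists S.
exists (closure S); first exact: closed_closure.
apply/seteqP; split => x [Ux]; first by move=> Sx; split => //; exact: subset_closure.
move=> cS; split=> //; have [r [b [rr BU bM hb]]] := near_const_local Ux.
exists r; [exact: rr|split; first exact: BU].
have [y [[s s0 [BUs hs]] xy]] : S `&` ball x r !=set0.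
  by apply: cS; apply/nbhs_ballP; exists r.
apply: (near_const_shift (mb x r) BU (vol_ball_lty x rr) hb).
have [q q0 [qs qx]] : exists2 q : R, 0 < q & ball y q `<=` ball y s /\ ball y q `<=` ball x r.
  have : open (ball x r) by exact: ball_open.
  rewrite openE => /(_ y xy)/nbhs_ballP[q /= q0 hq].
  exists (Num.min q s); first by rewrite lt_min q0.
  split; first by apply: le_ball; rewrite ge_min lexx orbT.
  by apply: subset_trans hq; apply: le_ball; rewrite ge_min lexx.
apply: (@near_const_unique y q _ _ q0 (subset_trans qx BU)).
- exact: (near_const_sub (mb y q) (mb x r) qx BU hb).
- exact: (near_const_sub (mb y q) (mb y s) qs BUs hs).
Qed.

Lemma near_const_setU (A B : set (borel R d)) a : measurable A -> measurable B ->
  A `<=` U -> B `<=` U -> near_const A a -> near_const B a -> near_const (A `|` B) a.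
Proof.
move=> mA mB AU BU hA hB e e0; have e2 : 0 < e / 2 by rewrite divr_gt0.
have [N1 h1] := hA _ e2; have [N2 h2] := hB _ e2.
exists (maxn N1 N2) => n; rewrite geq_max => /andP[n1 n2].
have mD : measurable (B `\` A) by exact: measurableD.
have DU : B `\` A `<=` U by move=> x [/BU].
have -> : A `|` B = A `|` (B `\` A).
  apply/seteqP; split => x [|]; [by left|by have [|] := pselect (A x); [left|right]|by left|by case; right].
have dis : [disjoint A & B `\` A] by apply/disj_setPS => x [Ax [_ /(_ Ax)]].
have ADU : A `|` (B `\` A) `<=` U by move=> x [/AU|/DU].
rewrite ge0_integral_setU//; last by apply: mpsi => //; exact: measurableU.
have -> : e = e / 2 + e / 2 :> R by lra.
rewrite EFinD; apply: leeD; first exact: h1.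
apply: le_trans (h2 n n2); by apply: ge0_subset_integral => //; exact: mpsi.
Qed.

(** A compact [K] carries all but little of the mass, and [|psi n - a n| <= M1] handles the rest. On
    [K] finitely many good balls suffice, and [ff_dom] passes from volume to [m]. *)
Lemma mint_near_const (a : nat -> R) : (forall n, `|a n| <= M) ->
  (forall x, U x -> exists2 r, 0 < r & ball x r `<=` U /\ near_const (ball x r) a) ->
  forall e : R, 0 < e -> exists N, forall n, (N <= n)%N ->
    mint m U (fun x => `|psi n x - a n|) <= e.
Proof.
move=> aM ha e e0.
have M0 : 0 <= M by apply: le_trans (aM 0%N).
pose M1 := M + M + 1; have M10 : 0 < M1 by rewrite ltr_wpDl// addr_ge0.
have e1 : 0 < e / 2 / M1 by rewrite !divr_gt0.
have [K [cK KU hK]] := ff_tight ff e1.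
have mK : measurable (K : set (borel R d)).
  by apply: closed_measurable_rV; apply: compact_closed cK; exact: norm_hausdorff.
have mUK : measurable (U `\` K : set (borel R d)) by exact: measurableD.
have [C C0 hC] := ff_dom ff.
have hr x : exists r : R, U x -> [/\ 0 < r, ball x r `<=` U & near_const (ball x r) a].
  have [/ha[r r0 [h1 h2]]|nU] := pselect (U x); first by exists r.
  by exists 0.
have [r {}hr] := choice hr.
move: (cK); rewrite compact_cover => /(_ E U (fun x => ball x (r x))) [||D DU Dcov].
- by move=> x _; exact: ball_open.
- by move=> x Kx; exists x; [exact: KU|apply: ballxx; case: (hr x (KU x Kx))].
pose s := finmap.enum_fset D.
have sU x : x \in s -> U x by move=> xs; have := DU x xs; rewrite inE.
pose W : set (borel R d) := \big[setU/set0]_(x <- s) (ball x (r x) : set (borel R d)).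
have [mW WU nW] : [/\ measurable W, W `<=` U & near_const W a].
  rewrite /W; elim: (s) sU => [|x l IH] sU'.
    rewrite big_nil; split => //; move=> q q0; exists 0%N => n _.
    by rewrite integral_set0 lee_fin ltW.
  have [|m1 u1 n1] := IH; first by move=> y yl; apply: sU'; rewrite in_cons yl orbT.
  have [r0 BU nB] := hr x (sU' x (mem_head _ _)).
  rewrite big_cons; split; first by apply: measurableU => //; exact: mb.
    by move=> y [/BU|/u1].
  by apply: near_const_setU => //; exact: mb.
have KW : K `<=` W.
  move=> x /Dcov[y /= yD yx]; rewrite /W -bigcup_seq; exists y => //=.
have e2 : 0 < e / 2 / (C + 1) by rewrite !divr_gt0// ltr_wpDl.
have [N hN] := nW _ e2; exists N => n Nn.
pose g x := `|psi n x - a n|.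
have g0 x : 0 <= g x by exact: normr_ge0.
have gM x : U x -> g x <= M1.
  move=> Ux; rewrite /g (le_trans (ler_normB _ _))// /M1.
  by rewrite (le_trans (lerD (psi_M n Ux) (aM n)))// lerDl.
have mg : measurable_fun (U : set (borel R d)) g.
  apply: measurableT_comp => //; apply: measurable_funB => //.
  by apply: (measurable_fun_rV_continuous oU) => x Ux; exact: (C1_psi n Ux).1.
have bg : bounded_meas U g.
  by split=> //; exists M1 => x Ux; rewrite /g normr_id; exact: gM.
pose h (x : E) : \bar R := (g x)%:E.
have mh : measurable_fun (U : set (borel R d)) h by exact/measurable_EFinP.
rewrite -lee_fin mint_EFin//.
rewrite -[X in (X <= _)%E]/(\int[m]_(x in (U : set (borel R d))) h x)%E.
have -> : (U : set (borel R d)) = (U `\` K) `|` K by rewrite setDKU.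
rewrite ge0_integral_setU//; last 3 first.
- by rewrite setDKU.
- by move=> x _; rewrite lee_fin g0.
- by apply/disj_setPS => x [[_ nK] /nK].
have -> : e = e / 2 + e / 2 :> R by lra.
rewrite EFinD; apply: leeD.
  apply: (@le_trans _ _ (\int[m]_(x in (U `\` K : set (borel R d))) (cst M1%:E x))%E).
    apply: ge0_le_integral => //.
    - by move=> x _; rewrite lee_fin g0.
    - by apply: (measurable_funS mU) mh => x [].
    - by move=> x [Ux _]; rewrite lee_fin; exact: gM.
  rewrite integral_cst//; apply: (le_trans (lee_wpmul2l _ hK)); first by rewrite lee_fin ltW.
  by rewrite -EFinM lee_fin mulrCA divff ?mulr1// gt_eqF.
pose h' : E -> \bar R := h \_ U.
have mh' : measurable_fun (setT : set (borel R d)) h' by apply/(measurable_restrictT _ _).1.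
have h'0 x : (0 <= h' x)%E by rewrite /h' patchE; case: ifP => //; rewrite lee_fin g0.
have h'E (P : set (borel R d)) (mu : {measure set (borel R d) -> \bar R}) : P `<=` U ->
    (\int[mu]_(x in P) h x = \int[mu]_(x in P) h' x)%E.
  by move=> PU; apply: eq_integral => x /set_mem Px; rewrite /h' patchE mem_set//; exact: PU.
rewrite h'E//.
have CN : 0 <= C by [].
pose mu := mscale (NngNum CN) (vol R d).
apply: (@le_trans _ _ (\int[mu]_(x in (K : set (borel R d))) h' x)%E).
  apply: ge0_le_measure_integral => // A mA; exact: hC.
rewrite ge0_integral_mscale//; last exact: (measurable_funS measurableT (@subsetT _ _) mh').
apply: (@le_trans _ _ (C%:E * (e / 2 / (C + 1))%:E)%E).
  apply: lee_wpmul2l; first by rewrite lee_fin.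
  apply: (@le_trans _ _ (\int[vol R d]_(x in W) h' x)%E).
    apply: ge0_subset_integral => //; exact: (measurable_funS measurableT (@subsetT _ _) mh').
  by rewrite -h'E//; exact: hN.
rewrite -EFinM lee_fin mulrCA -[leRHS]mulr1 ler_wpM2l ?(ltW (divr_gt0 e0 _))//.
by rewrite ler_pdivrMr ?ltr_wpDl// mul1r lerDl.
Qed.

Lemma psi_cvg_one : (forall n, mint m U (psi n) = 1) ->
  forall e : R, 0 < e -> exists N, forall n, (N <= n)%N ->
    mint m U (fun x => `|psi n x - 1|) <= e.
Proof.
move=> mass e e0; have [a aM ha] := near_const_everywhere.
have e2 : 0 < e / 2 by rewrite divr_gt0.
have [N hN] := mint_near_const aM ha e2; exists N => n Nn.
have bp : bounded_meas U (psi n).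
  by apply: (bounded_meas_continuous oU (M := M)) => x Ux; [exact: (C1_psi n Ux).1|exact: psi_M].
have bc c : bounded_meas U (fun x => psi n x - c).
  by apply: bounded_measB => //; exact: bounded_meas_cst.
have a1 : `|a n - 1| <= e / 2.
  have -> : a n - 1 = - mint m U (fun x => psi n x - a n).
    by rewrite mintB//; [rewrite mass (mint_cst oU (ff_mU ff)) opprB|exact: bounded_meas_cst].
  rewrite normrN.
  exact: le_trans (le_norm_mint _ oU (bc (a n))) (hN n Nn).
rewrite (@le_trans _ _ (mint m U (fun x => `|psi n x - a n| + `|a n - 1|)))//.
  apply: le_mint => //; first exact: bounded_meas_norm.
    by apply: bounded_measD => //; [exact: bounded_meas_norm|exact: bounded_meas_cst].
  by move=> x _; have -> : psi n x - 1 = (psi n x - a n) + (a n - 1) by [ring|]; exact: ler_normD.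
rewrite mintD//; [|exact: bounded_meas_norm|exact: bounded_meas_cst].
rewrite (mint_cst oU (ff_mU ff)); have -> : e = e / 2 + e / 2 by lra.
by apply: lerD => //; exact: hN.
Qed.

End sequence.

End translation.

(** * Convergence of the density to 1 in L^1 *)

Section convergence_to_equilibrium.
Context {R : realType} {d : nat} {U L V : set 'rV[R]_d} {m : probability (borel R d) R}.
Context {chi : nat -> 'rV[R]_d -> R} {rho : 'rV[R]_d -> R -> R}.
Hypothesis H : heat_ctx U L m V chi rho.

Let ff := hc_facts H.
Let oU : open U := ff_open ff.
Let mU1 := ff_mU ff.

Lemma rho_uniformly_bounded : exists2 M : R, 0 <= M & forall x t, U x -> 0 < t -> `|rho x t| <= M.
Proof.
have [M hM] := rho_bounded H 0.
have h x : U x -> `|rho x 0| <= `|M|.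
  move=> Ux; rewrite (le_trans _ (ler_norm M))// hM ?lexx//; exact: subset_closure.
exists `|M| => // x t Ux t0; rewrite ler_norml; apply/andP; split.
  rewrite -subr_ge0 -oppr_le0 (_ : - _ = - `|M| + (-1) * rho x t); last by ring.
  apply: (initial_barrier H) => // y Uy; have := h y Uy; rewrite ler_norml => /andP[? ?]; lra.
rewrite -subr_le0 (_ : _ - _ = - `|M| + 1 * rho x t); last by ring.
apply: (initial_barrier H) => // y Uy; have := h y Uy; rewrite ler_norml => /andP[? ?]; lra.
Qed.

(** Small gradients give L^1 convergence along the times [t_ n] only. The uniform bound on the
    density upgrades it to the second moment, which is monotone in time and so controls every later
    time. *)
Lemma heat_converges : mint m U (rho ^~ 0) = 1 -> forall e : R, 0 < e -> exists T : R,
  forall t, T <= t -> mint m U (fun x => `|rho x t - 1|) <= e.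
Proof.
move=> mass e e0; have [M M0 hM] := rho_uniformly_bounded.
have ht n : exists t : R, 1 <= t /\
    forall i, mint m U (fun x => `|partial i (rho ^~ t) x|) <= n.+1%:R^-1.
  have [|t h1 h2] := partial_small H ltr01 (_ : 0 < n.+1%:R^-1).
    by rewrite invr_gt0.
  by exists t.
have [t_ ht_] := choice ht.
have t0 n : 0 < t_ n by apply: lt_le_trans (ht_ n).1.
pose psi n x := rho x (t_ n).
have C1_psi n : C1_on U (psi n).
  apply: (C1_along_sub _ (C1_rho H (t0 n))) => x Ux.
  by apply: (hc_closure H); exact: subset_closure.
have psi_per n : Defs.periodic L (psi n) by exact: (hc_periodic H (ltW (t0 n))).
have psi_M n x : U x -> `|psi n x| <= M by move=> Ux; exact: hM.
have bp n i : bounded_meas U (partial i (psi n)) by exact: (bounded_meas_partial_rho H i (t0 n)).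
have small (e1 : R) : 0 < e1 -> exists N, forall n, (N <= n)%N ->
    \sum_i mint m U (fun x => `|partial i (psi n) x|) <= e1.
  move=> e10; have d0 : 0 < d%:R + 1 :> R by rewrite ltr_wpDl.
  have [N _ hN] := near_infty_natSinv_lt (PosNum (divr_gt0 e10 d0)).
  exists N => n /hN /= /ltW h.
  rewrite (@le_trans _ _ (\sum_(i < d) n.+1%:R^-1))//.
    by apply: ler_sum => i _; exact: (ht_ n).2.
  rewrite sumr_const card_ord -[leLHS]mulr_natl (le_trans (ler_wpM2l _ h))//.
  by rewrite mulrCA -[leRHS]mulr1 ler_wpM2l ?(ltW e10)// ler_pdivrMr// mul1r lerDl.
have mass_psi n : mint m U (psi n) = 1 by rewrite -mass; exact: (mass_conserved H (t0 n)).
(* [|u - 1| <= (e + (u - 1)^2 / e) / 2], and the second moment is monotone *)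
have e2 : 0 < e ^+ 2 / (M + 1) by rewrite divr_gt0// ?exprn_gt0// ltr_wpDl.
have [N hN] := psi_cvg_one ff C1_psi psi_per psi_M bp small mass_psi e2.
exists (t_ N) => t tN; have t00 : 0 < t by exact: lt_le_trans tN.
have bs s : 0 < s -> bounded_meas U (fun x => rho x s - 1).
  by move=> s0; apply: bounded_measB => //; [exact: (bounded_meas_rho H)|exact: bounded_meas_cst].
have E2 : energy2 (U := U) (m := m) (rho := rho) t <= e ^+ 2.
  apply: (le_trans (energy2_nonincreasing H (t0 N) tN)).
  rewrite /energy2 (@le_trans _ _ (mint m U (fun x => (M + 1) * `|rho x (t_ N) - 1|)))//.
    apply: le_mint => //; first by apply: bounded_measX => //; exact: bs.
      apply: bounded_measM => //; first exact: bounded_meas_cst.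
      by apply: bounded_meas_norm => //; exact: bs.
    move=> x Ux; rewrite -real_normK ?num_real// expr2 ler_wpM2r//.
    by rewrite (le_trans (ler_normB _ _))// normr1 lerD2r; exact: hM.
  rewrite mintZ//; last by apply: bounded_meas_norm => //; exact: bs.
  by rewrite mulrC -ler_pdivlMr ?ltr_wpDl//; exact: hN.
rewrite (@le_trans _ _ (mint m U (fun x => e / 2 + (2 * e)^-1 * (rho x t - 1) ^+ 2)))//.
  apply: le_mint => //.
  - by apply: bounded_meas_norm => //; exact: bs.
  - apply: bounded_measD => //; first exact: bounded_meas_cst.
    apply: bounded_measM => //; first exact: bounded_meas_cst.
    by apply: bounded_measX => //; exact: bs.
  move=> x Ux; set a := rho x t - 1; rewrite -(real_normK (num_real a)) -subr_ge0.
  have -> : e / 2 + (2 * e)^-1 * `|a| ^+ 2 - `|a| = (2 * e)^-1 * (`|a| - e) ^+ 2.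
    by field; rewrite gt_eqF.
  by rewrite mulr_ge0 ?sqr_ge0// invr_ge0 mulr_ge0// ltW.
have bq : bounded_meas U (fun x => (rho x t - 1) ^+ 2) by apply: bounded_measX => //; exact: bs.
rewrite mintD//; [|exact: bounded_meas_cst|by apply: bounded_measM => //; exact: bounded_meas_cst].
rewrite (mint_cst oU mU1) mintZ// -/(energy2 (U := U) (m := m) (rho := rho) t).
rewrite (@le_trans _ _ (e / 2 + (2 * e)^-1 * e ^+ 2))//.
  by rewrite lerD2l ler_wpM2l// invr_ge0 mulr_ge0// ltW.
by rewrite le_eqVlt; apply/orP; left; apply/eqP; field; rewrite gt_eqF.
Qed.

End convergence_to_equilibrium.

(** * Transport of observables by the redistribution maps *)

Lemma is_derive_of_line {R : realType} {V W : normedModType R} (f : V -> W) (x v : V) (a : W) :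
  is_derive (0 : R) 1 (fun h => f (h *: v + x)) a -> is_derive x v f a.
Proof.
move=> h; have e : (fun h : R => h^-1 *: (((fun h => f (h *: v + x)) \o shift 0) (h *: 1) -
    f (0 *: v + x))) = (fun h => h^-1 *: ((f \o shift x) (h *: v) - f x)).
  by apply/funext => s /=; rewrite addr0 scale0r add0r [s *: 1]mulr1.
apply: DeriveDef.
  by have := @ex_derive _ _ _ _ _ _ _ h; rewrite /derivable e.
by have := @derive_val _ _ _ _ _ _ _ h; rewrite /derive e.
Qed.

Section transport.
Context {R : realType} {d : nat} {U L V : set 'rV[R]_d} {m : probability (borel R d) R}.
Context {chi : nat -> 'rV[R]_d -> R} {rho : 'rV[R]_d -> R -> R}.
Context {X : 'rV[R]_d -> R -> 'rV[R]_d}.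
Local Notation E := 'rV[R]_d.
Hypothesis H : heat_ctx U L m V chi rho.
Hypothesis hX : redistribution U L rho X.
Hypothesis rho_pos : forall x t, U x -> 0 < t -> 0 < rho x t.

Let ff := hc_facts H.
Let oU : open U := ff_open ff.
Let mU1 := ff_mU ff.

Let UinV : U `<=` V.
Proof. by move=> x Ux; apply: (hc_closure H); exact: subset_closure. Qed.

Lemma redist_U x t : 0 <= t -> U x -> U (X x t).
Proof. by move=> t0 Ux; have [g [_ _ h _]] := redist_diffeo hX t0; case: (h x Ux). Qed.

Lemma C1_on_X k t : 0 < t -> C1_on U (fun x => X x t 0 k) /\
  forall i x, U x -> partial i (fun x => X x t 0 k) x = partial i (X ^~ t) x 0 k.
Proof.
move=> t0; have [cX _ _ h] := redist_regular hX.
have pE i x : U x -> partial i (fun x => X x t 0 k) x = partial i (X ^~ t) x 0 k.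
  by move=> Ux; rewrite /partial (derive_mx ((h i).1 x t Ux t0)) mxE.
split; last exact: pE.
move=> x Ux; split.
  apply: (@continuous_comp E E R (X ^~ t) (fun v => v 0 k)); last exact: coord_continuous.
  exact: (jointly_continuous_space oU cX Ux t0).
move=> i; split; first exact: ((derivable_mxP _ _ _).1 ((h i).1 x t Ux t0) 0 k).
have c : {for x, continuous (fun x => partial i (X ^~ t) x 0 k)}.
  apply: (@continuous_comp E E R (partial i (X ^~ t)) (fun v => v 0 k)); last exact: coord_continuous.
  exact: (jointly_continuous_space oU (h i).2 Ux t0).
have e y : U y -> partial i (X ^~ t) y 0 k = partial i (fun x => X x t 0 k) y by move=> Uy; rewrite pE.
exact: (eq_open_continuous oU e Ux c).
Qed.

Section observable.
Variables (F : E -> R) (M : R).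
Hypotheses (C1_F : C1_on U F) (F_per : Defs.periodic L F) (F_M : forall x, U x -> `|F x| <= M).

Let g (t : R) (x : E) : R := F (X x t).

Lemma F_comp_X i t x : 0 < t -> U x ->
  is_derive x (basis_vec i) (g t) (\sum_k partial k F (X x t) * partial i (X ^~ t) x 0 k).
Proof.
move=> t0 Ux; have [_ _ _ h] := redist_regular hX.
have dX := (h i).1 x t Ux t0.
have dl : is_derive (0 : R) 1 (fun s => X (s *: basis_vec i + x) t) ('D_(basis_vec i) (X ^~ t) x).
  have e0 : 0 *: basis_vec i + x = x by rewrite scale0r add0r.
  have dX0 : derivable (X ^~ t) (0 *: basis_vec i + x) (basis_vec i) by rewrite e0.
  have hl := is_derive_line dX0.
  by rewrite -[X in 'D_(basis_vec i) (_ ^~ t) X]e0; exact: hl.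
apply: is_derive_of_line.
have e0 : X (0 *: basis_vec i + x) t = X x t by rewrite scale0r add0r.
have UX : U (X x t) by apply: redist_U => //; exact: ltW.
have n1 : \forall y \near X (0 *: basis_vec i + x) t, forall j, derivable F y (basis_vec j).
  by rewrite e0; exact: (C1_on_near oU UX (@C1_F)).
have n2 j : {for X (0 *: basis_vec i + x) t, continuous (partial j F)}.
  by rewrite e0; exact: ((C1_F UX).2 j).2.
have := @C1_chain R d F (fun s => X (s *: basis_vec i + x) t) 0 n1 n2 (@ex_derive _ _ _ _ _ _ _ dl).
move=> dc; apply: is_derive_eq dc _; apply: eq_bigr => k _.
by rewrite e0 mulrC (@derive_val _ _ _ _ _ _ _ dl).
Qed.

Lemma C1_on_g t : 0 < t -> C1_on U (g t).
Proof.
move=> t0 x Ux; have UX : U (X x t) by apply: redist_U => //; exact: ltW.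
have [cX _ _ h] := redist_regular hX.
have cXt y : U y -> {for y, continuous (X ^~ t)}.
  by move=> Uy; exact: (jointly_continuous_space oU cX Uy t0).
split; first exact: (@continuous_comp E E R (X ^~ t) F x (cXt x Ux) (C1_F UX).1).
move=> i; have dg := F_comp_X i t0 Ux; split; first exact: ex_derive.
pose q y := \sum_k partial k F (X y t) * partial i (X ^~ t) y 0 k.
have cq : {for x, continuous q}.
  apply: continuous_at_sum => k; apply: continuous_atM.
    exact: (@continuous_comp E E R (X ^~ t) (partial k F) x (cXt x Ux) ((C1_F UX).2 k).2).
  apply: (@continuous_comp E E R (partial i (X ^~ t)) (fun v => v 0 k)); last exact: coord_continuous.
  exact: (jointly_continuous_space oU (h i).2 Ux t0).
have e y : U y -> q y = partial i (g t) y.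
  by move=> Uy; have dgy := F_comp_X i t0 Uy; rewrite /partial derive_val.
exact: (eq_open_continuous oU e Ux cq).
Qed.

Lemma g_periodic t : 0 <= t -> Defs.periodic L (g t).
Proof. by move=> t0 x l Ll; rewrite /g (redist_equivariant hX x Ll t0) F_per. Qed.

Let dtg (t : R) (x : E) : R := \sum_k derive1 (X x) t 0 k * partial k F (X x t).

Lemma g_is_derive_time x (t : R) : U x -> 0 < t -> is_derive t 1 (g ^~ x) (dtg t x).
Proof.
move=> Ux t0; have [_ dX _ _] := redist_regular hX.
have UX : U (X x t) by apply: redist_U => //; exact: ltW.
have n1 : \forall y \near X x t, forall j, derivable F y (basis_vec j).
  exact: (C1_on_near oU UX (@C1_F)).
have n2 j : {for X x t, continuous (partial j F)} by exact: ((C1_F UX).2 j).2.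
have dc := @C1_chain R d F (X x) t n1 n2 (dX x t Ux t0).
by apply: is_derive_eq dc _; apply: eq_bigr => k _; rewrite derive1E.
Qed.

Lemma partial_ln_rho i x t : U x -> 0 < t ->
  partial i (fun y => ln (rho y t)) x = partial i (rho ^~ t) x / rho x t.
Proof.
move=> Ux t0; have dr := (((C1_rho H t0) x (UinV Ux)).2 i).1.
have := is_derive_comp_real (is_derive1_ln (rho_pos Ux t0)) dr.
by move=> h; rewrite /partial derive_val mulrC.
Qed.

(* The transport equation turns [rho d_t g] into [grad g . grad rho]. *)
Lemma transport_equation x t : U x -> 0 < t ->
  rho x t * dtg t x = grad_dot (rho := rho) (g t) t x.
Proof.
move=> Ux t0; have rp := rho_pos Ux t0.
have UX : U (X x t) by apply: redist_U => //; exact: ltW.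
set u := velocity rho x t.
have uE i : u 0 i = - (partial i (rho ^~ t) x / rho x t).
  by rewrite /u /velocity !mxE partial_ln_rho.
have dk k := C1_on_derive u oU Ux (C1_on_X k t0).1.
have dX : derivable (X ^~ t) x u.
  by apply/derivable_mxP => i k; rewrite (ord1 i); exact: (dk k).1.
have XE k : derive1 (X x) t 0 k = - \sum_i u 0 i * partial i (X ^~ t) x 0 k.
  have /eqP := redist_transport hX Ux t0; rewrite addr_eq0 => /eqP ->.
  rewrite !mxE (derive_mx dX) mxE (dk k).2; congr (- _).
  by apply: eq_bigr => i _; rewrite (C1_on_X k t0).2.
rewrite /dtg /grad_dot; under eq_bigr do rewrite XE.
transitivity (rho x t * \sum_i \sum_k - (u 0 i * partial i (X ^~ t) x 0 k * partial k F (X x t))).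
  congr (_ * _); rewrite exchange_big; apply: eq_bigr => k _.
  by rewrite mulNr mulr_suml sumrN.
rewrite mulr_sumr; apply: eq_bigr => i _.
have dg := F_comp_X i t0 Ux; rewrite /partial derive_val -/(partial i (rho ^~ t) x).
rewrite mulr_sumr mulr_suml; apply: eq_bigr => k _.
rewrite uE -/(partial k F (X x t)) -/(partial i (X ^~ t) x); field.
by rewrite gt_eqF.
Qed.

(** The bound holds away from the boundary only, since [X] is regular in the open set [U]. By
    equivariance the time derivative of [X] is periodic although [X] is not. *)
Lemma dtg_bounded (r a b : R) : 0 < r -> 0 < a -> exists B : R,
  forall x t, inner U r x -> a <= t <= b -> `|dtg t x| <= B.
Proof.
move=> r0 a0; have [cX _ cdX _] := redist_regular hX.
have pos t : a <= t <= b -> 0 < t by case/andP => /(lt_le_trans a0).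
apply: (jointly_continuous_bounded ff (S := inner U r) (f := fun x t => dtg t x)).
- exact: inner_closed.
- exact: (inner_sub_closure r0).
- by move=> x l; exact: (inner_shift ff).
- apply: continuous_in_subspaceT => -[x t] /set_mem[/= ix]; rewrite in_itv /= => tab.
  have t0 := pos t tab; have Ux : U x by exact: inner_sub ix.
  have UX : U (X x t) by apply: redist_U => //; exact: ltW.
  have c1 := jointly_continuous_at oU cX Ux t0.
  have c2 := jointly_continuous_at oU cdX Ux t0.
  apply: (@continuous_at_sum R (E * R)%type (x, t) 'I_d _
    (fun k z => derive1 (X z.1) z.2 0 k * partial k F (X z.1 z.2))) => k.
  apply: continuous_atM.
    apply: (@continuous_comp (E * R)%type E R (fun z => derive1 (X z.1) z.2) (fun v => v 0 k)) => //.
    exact: coord_continuous.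
  exact: (@continuous_comp (E * R)%type E R (fun z => X z.1 z.2) (partial k F) (x, t) c1 ((C1_F UX).2 k).2).
move=> t x l tab Ll ix; have t0 := pos t tab; apply: eq_bigr => k _.
rewrite (redist_equivariant hX x Ll (ltW t0)) (periodic_partial k F_per _ Ll).
have o : open [set t : R | 0 < t] by exact: open_gt.
have e s : [set t : R | 0 < t] s -> X (x + l) s = X x s + l.
  by move=> /= s0; rewrite (redist_equivariant hX x Ll (ltW s0)).
have dX : derivable (X x) t 1.
  have [_ h _ _] := redist_regular hX; apply: h => //; exact: inner_sub ix.
have h := @is_deriveD _ _ _ (X x) (cst l) t 1 _ _ (DeriveDef dX erefl) (is_derive_cst l t 1).
have E1 : 'D_1 (fun s => X x s + l) t = 'D_1 (X x) t.
  by rewrite -[LHS]/('D_1 (X x + cst l) t) (@derive_val _ _ _ _ _ _ _ h) addr0.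
by rewrite !derive1E (eq_open_derive o e _ t0) E1.
Qed.

Let I_ n (t : R) := mint m U (fun x => chi n x * (g t x * rho x t)).

Let bounded_meas_I n t : 0 < t -> bounded_meas U (fun x => chi n x * (g t x * rho x t)).
Proof.
move=> t0; apply: (bounded_meas_cutoff H).
  by move=> x l Ll; rewrite (g_periodic (ltW t0) x Ll) (hc_periodic H (ltW t0) x Ll).
move=> x Ux; apply: continuous_atM; first exact: (C1_on_g t0 Ux).1.
exact: (continuous_rho H t0 Ux).
Qed.

(** By the transport equation the derivative is the integral of [chi n * (g * laplacian rho + grad g
    . grad rho)], and [green_cutoff] trades this for a boundary term free of derivatives of [g]. *)
Lemma cutoff_mass_derive n (t : R) : 0 < t ->
  is_derive t 1 (I_ n) (- mint m U (fun x => g t x * grad_dot (rho := rho) (chi n) t x)).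
Proof.
move=> t0; have g_M x : U x -> `|g t x| <= M.
  by move=> Ux; apply: F_M; apply: redist_U => //; exact: ltW.
rewrite -(green_cutoff H n t0 (@C1_on_g t t0) (g_periodic (ltW t0)) g_M).
have t20 : 0 < t / 2 by rewrite divr_gt0.
have pos s : t / 2 < s < 2 * t -> 0 < s by case/andP => /(lt_trans t20).
have [Cchi chi01 _ chi0 _] := hc_cutoffs H; have [r r0 hr] := chi0 n.
have [B hB] := dtg_bounded (2 * t) r0 t20.
have [Mr hMr] := rho_bounded H (2 * t).
have [Md hMd] := dt_bounded H (2 * t) t20.
apply: (@is_derive_mint R d m U (fun s x => chi n x * (g s x * rho x s))
  (fun s x => chi n x * (g s x * laplacian (rho ^~ s) x + grad_dot (rho := rho) (g s) s x))
  t (t / 2) (2 * t) (M * Md + Mr * `|B|)).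
- exact: oU.
- by apply/andP; split; lra.
- move=> s x hs Ux; have s0 := pos s hs.
  rewrite -(transport_equation Ux s0).
  have h1 := is_deriveM (g_is_derive_time Ux s0) (rho_is_derive H Ux s0).
  have h2 := is_deriveZ (chi n x) h1.
  by apply: is_derive_eq h2 _; rewrite /GRing.scale /=.
- by move=> s hs; apply: bounded_meas_I; exact: pos.
- move=> s x hs Ux; have s0 := pos s hs.
  have hs' : t / 2 <= s <= 2 * t by case/andP: hs => /ltW -> /ltW ->.
  have cx := subset_closure Ux.
  have M0 : 0 <= M by apply: le_trans (F_M Ux).
  have Md0 : 0 <= Md by apply: le_trans (hMd x s cx hs').
  have s2 : 0 <= s <= 2 * t by rewrite (ltW s0); case/andP: hs'.
  have Mr0 : 0 <= Mr by apply: le_trans (hMr x s cx s2).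
  have [ix|nx] := pselect (inner U r x); last first.
    by rewrite hr// mul0r normr0 addr_ge0 ?mulr_ge0.
  rewrite -(transport_equation Ux s0) normrM -[leRHS]mul1r ler_pM//.
    by have /andP[? ?] := chi01 n x Ux; rewrite ger0_norm.
  rewrite (le_trans (ler_normD _ _))// lerD// normrM ler_pM//.
  + by apply: F_M; apply: redist_U => //; exact: ltW.
  + by rewrite -(hc_equation H Ux s0); exact: hMd.
  + exact: hMr.
  + by rewrite (le_trans (hB x s ix hs'))// ler_norm.
Qed.

(** The increment of [I_ n] tends to the difference of the two sides. By the mean value theorem it
    is also [b - a] times a boundary term at a time depending on [n], which tends to 0 by the
    uniform [cutoff_error]. *)
Lemma transport_step (a b : R) : 0 < a -> a <= b ->
  mint m U (fun x => g b x * rho x b) = mint m U (fun x => g a x * rho x a).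
Proof.
move=> a0 ab; have [Cchi chi01 chi1 _ _] := hc_cutoffs H.
have b0 : 0 < b by exact: lt_le_trans ab.
have cI t : 0 < t -> I_ n t @[n --> \oo] --> mint m U (fun x => g t x * rho x t).
  move=> t0; have [Mr hMr] := rho_bounded H t.
  apply: (mint_cvg oU (M := M * Mr)).
  - by move=> n; have [] := bounded_meas_I n t0.
  - move=> n x Ux; have UX : U (X x t) by apply: redist_U => //; exact: ltW.
    have t1 : 0 <= t <= t by rewrite (ltW t0) lexx.
    rewrite normrM -[leRHS]mul1r ler_pM//.
      by have /andP[? ?] := chi01 n x Ux; rewrite ger0_norm.
    by rewrite normrM ler_pM ?F_M ?hMr//; exact: subset_closure.
  - move=> x Ux; rewrite -[X in _ --> X]mul1r.
    by apply: cvgM; [exact: chi1|exact: cvg_cst].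
have c1 := cvgB (cI b b0) (cI a a0).
have c0 : I_ n b - I_ n a @[n --> \oo] --> (0 : R).
  apply/cvgrPdist_le => e e0.
  have e1 : 0 < e / (b - a + 1) by rewrite divr_gt0// ltr_wpDl// subr_ge0.
  have [N hN] := cutoff_error H M b a0 e1.
  exists N => // n /= Nn; rewrite sub0r normrN.
  have [||c cI' ->] := @MVT_segment R (I_ n)
    (fun t => - mint m U (fun x => g t x * grad_dot (rho := rho) (chi n) t x)) a b ab.
  - by move=> t; rewrite in_itv /= => /andP[at_ _]; apply: cutoff_mass_derive; exact: lt_trans at_.
  - apply: continuous_in_subspaceT => t /set_mem/=; rewrite in_itv /= => /andP[at_ _].
    apply: differentiable_continuous; apply/derivable1_diffP.
    by have h1 := cutoff_mass_derive n (lt_le_trans a0 at_); exact: ex_derive.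
  move: cI'; rewrite in_itv /= => cab.
  have c00 : 0 < c by case/andP: cab => /(lt_le_trans a0).
  have g_M x : U x -> `|g c x| <= M.
    by move=> Ux; apply: F_M; apply: redist_U => //; exact: ltW.
  have bg : bounded_meas U (g c).
    by apply: (bounded_meas_continuous oU (M := M)) => // x Ux; exact: (C1_on_g c00 Ux).1.
  have := hN n c (g c) Nn cab bg g_M => h.
  rewrite normrM normrN (ger0_norm (_ : 0 <= b - a)) ?subr_ge0//.
  apply: (@le_trans _ _ (e / (b - a + 1) * (b - a))); first by rewrite ler_wpM2r// subr_ge0.
  by rewrite mulrAC ler_pdivrMr ?ltr_wpDl ?subr_ge0// ler_wpM2l ?lerDl// ltW.
have hR : hausdorff_space R by exact: norm_hausdorff.
have E0 := cvg_unique hR (c1 _) c0.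
by apply/eqP; rewrite -subr_eq0; apply/eqP; exact: E0.
Qed.

Lemma transport t : 0 < t ->
  mint m U (fun x => F (X x t) * rho x t) = mint m U (fun x => F x * rho x 0).
Proof.
move=> t0.
have c : mint m U (fun x => g n.+1%:R^-1 x * rho x n.+1%:R^-1) @[n --> \oo] -->
    mint m U (fun x => F x * rho x 0).
  have n0 n : (0 : R) < n.+1%:R^-1 by rewrite invr_gt0.
  have n1 n : n.+1%:R^-1 <= (1 : R) by rewrite invf_le1// ler1n.
  have [Mr hMr] := rho_bounded H 1.
  apply: (mint_cvg oU (M := M * Mr)).
  - move=> n; apply: measurable_funM; last by have [] := bounded_meas_rho H (n0 n).
    by apply: (measurable_fun_rV_continuous oU) => x Ux; exact: (C1_on_g (n0 n) Ux).1.
  - move=> n x Ux; have UX : U (X x n.+1%:R^-1) by apply: redist_U => //; exact: ltW.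
    by rewrite normrM ler_pM ?F_M ?hMr ?(ltW (n0 n)) ?n1//; exact: subset_closure.
  - move=> x Ux; apply: cvgM; last exact: (rho_cvg0 H Ux).
    have cX := redist_continuous hX.
    pose A := U `*` [set t : R | 0 <= t].
    have Ax : A (x, 0) by split => //=.
    have c1 : (fun z : E * R => X z.1 z.2) @ within A (nbhs (x, 0 : R)) --> X x 0.
      by rewrite (nbhs_subspace_in Ax); exact: (cX (x, 0)).
    have zn : (fun n : nat => (x, n.+1%:R^-1 : R)) @ \oo --> within A (nbhs (x, 0 : R)).
      move=> Q [[P1 P2] [/= nP1 nP2] PQ].
      have := @cvg_harmonic R; move=> /(_ _ nP2) [N _ hN].
      exists N => // n /= Nn; apply: (PQ (x, n.+1%:R^-1)).
        by split => /=; [exact: nbhs_singleton nP1|exact: hN].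
      by split => //=; rewrite invr_ge0.
    have c2 := cvg_comp _ _ zn c1; rewrite (redist_initial hX Ux) in c2.
    exact: (cvg_comp _ _ c2 (C1_F Ux).1).
rewrite -(cvg_lim _ c)//; apply/esym/cvg_lim => //.
(* Once [1/(n+1) <= t], the terms all equal the value at time [t]. *)
apply: cvg_near_cst; have [N _ hN] := near_infty_natSinv_lt (PosNum t0).
exists N => // n /= /hN /ltW nt; exact/esym/transport_step.
Qed.

End observable.
End transport.

(** * Expectations from laws known on invariant sets *)

(** The count of thresholds not exceeding [u] is the integer part of [u]. After scaling, it
    approximates a bounded function by a combination of indicators of its superlevel sets. *)
Lemma count_le {R : realType} (K : nat) (u : R) : 0 <= u <= K%:R ->
  \sum_(j < K) (j.+1%:R <= u)%R%:R <= u <= \sum_(j < K) (j.+1%:R <= u)%R%:R + 1.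
Proof.
elim: K => [|K IH] /andP[u0 uK]; first by rewrite !big_ord0 add0r u0 (le_trans uK).
rewrite !big_ord_recr /=; have [uK1|uK1] := leP u K%:R.
  have -> : (K.+1%:R <= u) = false.
    by apply/negbTE; rewrite -ltNge (le_lt_trans uK1)// ltr_nat.
  by rewrite addr0; apply: IH; rewrite u0.
have -> : \sum_(j < K) (j.+1%:R <= u)%R%:R = K%:R :> R.
  rewrite (eq_bigr (fun=> 1)) ?sumr_const ?card_ord// => j _.
  by rewrite (_ : (_ <= u) = true)//; apply: le_trans (ltW uK1); rewrite ler_nat.
rewrite -natr1 in uK *; have [h|h] := leP (K%:R + 1) u => /=; apply/andP; split; lra.
Qed.

Section laws.
Context {R : realType} {d : nat} {U L : set 'rV[R]_d} {m : probability (borel R d) R}.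
Local Notation E := 'rV[R]_d.
Hypothesis ff : flow_facts U L m.
Let oU : open U := ff_open ff.
Let mU : measurable (U : set (borel R d)). Proof. exact: open_measurable_rV. Qed.

Let U_shift x l : L l -> U (x + l) = U x.
Proof.
move=> Ll; apply/propext; split; last exact: (ff_shift ff).
by move=> h; rewrite -[x](addrK l); apply: (ff_shift ff) => //; exact: (ff_opp ff).
Qed.

(* Both integrals are limits of the same combinations of the measures of the
   periodic sets [f >= c]. *)
Lemma mint_law (nu : probability (borel R d) R) (sigma f : E -> R) (M : R) :
  nu U = 1%E -> bounded_meas U sigma -> (forall x, U x -> 0 <= sigma x) ->
  (forall A : set (borel R d), measurable A -> Defs.periodic L (A : E -> Prop) ->
    nu A = (\int[m]_(x in A `&` U) (sigma x)%:E)%E) ->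
  Defs.periodic L f -> (forall x, U x -> {for x, continuous f}) ->
  (forall x, U x -> `|f x| <= M) ->
  mint nu U f = mint m U (fun x => f x * sigma x).
Proof.
move=> nuU bs s0 nuE fper cf fM.
have bf : bounded_meas U f by exact: (bounded_meas_continuous oU cf fM).
have ms : mint m U sigma = 1.
  apply: EFin_inj; rewrite mint_EFin//.
  have := nuE U mU _; rewrite nuU setIid => <- // x l Ll; exact: U_shift.
pose B c : set (borel R d) := [set x | U x /\ c <= f x].
have mB c : measurable (B c).
  have -> : B c = U `&` f @^-1` `[c, +oo[%classic.
    by apply/seteqP; split => x [Ux]; rewrite /= in_itv/= andbT.
  by apply: bf.1 => //; exact: measurable_itv.
have BU c : B c `<=` U by move=> x [].
have Bper c : Defs.periodic L (B c : E -> Prop).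
  by move=> x l Ll; rewrite /B /= U_shift// fper.
have b1 c : bounded_meas U (\1_(B c) : E -> R).
  split; first exact: measurable_indic.
  by exists 1 => x _; rewrite indicE; case: (_ \in _); rewrite ?normr1 ?normr0.
have indE c : mint nu U (\1_(B c)) = mint m U (fun x => \1_(B c) x * sigma x).
  apply: EFin_inj; rewrite !mint_EFin//; last exact: bounded_measM.
  transitivity (nu (B c)); first by rewrite integral_indic// (setIidl (BU c)).
  rewrite nuE// setIC integral_mkcondr; apply: eq_integral => x _.
  rewrite patchE indicE; case: ifP => _; first by rewrite mul1r.
  by rewrite mul0r.
have M0 : 0 <= M by have [x Ux] := ff_nonempty ff; rewrite (le_trans _ (fM x Ux)).
apply/eqP; rewrite -subr_eq0 -normr_le0; apply/ler_addgt0Pr => e e0; rewrite add0r.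
have q0 : 0 <= 4 * (M + 1) / e by rewrite divr_ge0 ?(ltW e0)// mulr_ge0// addr_ge0.
have [K K0 Ke] : exists2 K : nat, (0 < K)%N & 4 * (M + 1) / e <= K%:R.
  exists (Num.bound (4 * (M + 1) / e)).+1 => //.
  by rewrite (le_trans (ltW (archi_boundP q0)))// ler_nat.
(* Mesh of [K] equal levels filling [[-(M + 1), M + 1]]; [K] makes it at most [e / 2], and using
   [M + 1] keeps it positive even when [M = 0]. *)
pose dl := 2 * (M + 1) / K%:R.
have K0' : 0 < K%:R :> R by rewrite ltr0n.
have dl0 : 0 < dl by rewrite divr_gt0// mulr_gt0// ltr_wpDl.
have dlK : dl * K%:R = 2 * (M + 1) by rewrite /dl divfK// gt_eqF.
have dle : dl <= e / 2.
  rewrite /dl ler_pdivrMr//; move: Ke; rewrite ler_pdivrMr//; lra.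
(* A step function within [dl] of [f], built from periodic sets, on which the two measures are known
   to agree. *)
pose h x : R := - (M + 1) + dl * \sum_(j < K) \1_(B (- (M + 1) + dl * j.+1%:R)) x.
have bS : bounded_meas U (fun x => \sum_(j < K) \1_(B (- (M + 1) + dl * j.+1%:R)) x).
  by apply: bounded_meas_sum => // j; exact: b1.
have bdS : bounded_meas U (fun x => dl * \sum_(j < K) \1_(B (- (M + 1) + dl * j.+1%:R)) x).
  by apply: bounded_measM => //; exact: bounded_meas_cst.
have bh : bounded_meas U h by apply: bounded_measD => //; exact: bounded_meas_cst.
have hf x : U x -> `|f x - h x| <= dl.
  move=> Ux; pose u := (f x + (M + 1)) / dl.
  have fE : f x = - (M + 1) + dl * u by rewrite /u mulrC divfK ?gt_eqF//; ring.
  have := fM x Ux; rewrite ler_norml => /andP[f1 f2].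
  have u0 : 0 <= u <= K%:R.
    rewrite divr_ge0 ?(ltW dl0)//=; last by lra.
    by rewrite ler_pdivrMr// mulrC dlK; lra.
  have := count_le u0.
  have -> : \sum_(j < K) (j.+1%:R <= u)%R%:R = \sum_(j < K) \1_(B (- (M + 1) + dl * j.+1%:R)) x :> R.
    apply: eq_bigr => j _; rewrite indicE; congr (nat_of_bool _)%:R.
    have -> : (j.+1%:R <= u) = (- (M + 1) + dl * j.+1%:R <= f x).
      by rewrite fE lerD2l ler_pM2l.
    by apply/idP/idP => [hh|/set_mem[]//]; apply/mem_set.
  rewrite /h; set S := bigop _ _ _ => /andP[h1 h2].
  rewrite (_ : f x - _ = dl * (u - S)); last by rewrite fE; ring.
  rewrite normrM gtr0_norm//.
  rewrite -[leRHS]mulr1 ler_pM2l// ger0_norm ?subr_ge0//; lra.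
have hE : mint nu U h = mint m U (fun x => h x * sigma x).
  rewrite /h mintD//; last exact: bounded_meas_cst.
  rewrite (mint_cst oU nuU) mintZ// mint_sum//.
  have -> : mint m U (fun x => (- (M + 1) + dl * \sum_(j < K) \1_(B (- (M + 1) + dl * j.+1%:R)) x) * sigma x) =
    mint m U (fun x => - (M + 1) * sigma x + dl * \sum_(j < K) (\1_(B (- (M + 1) + dl * j.+1%:R)) x * sigma x)).
    by apply: eq_mint => x _; rewrite -mulr_suml; ring.
  have bBs c : bounded_meas U (fun x => \1_(B c) x * sigma x) by exact: bounded_measM.
  have bBS : bounded_meas U (fun x => \sum_(j < K) (\1_(B (- (M + 1) + dl * j.+1%:R)) x * sigma x)).
    by apply: bounded_meas_sum.
  rewrite mintD//; [|by apply: bounded_measM => //; exact: bounded_meas_cst..].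
  rewrite !mintZ// ms mulr1 mint_sum//; congr (_ + _ * _).
  by apply: eq_bigr => j _; exact: indE.
have bfs : bounded_meas U (fun x => f x * sigma x) by exact: bounded_measM.
have bhs : bounded_meas U (fun x => h x * sigma x) by exact: bounded_measM.
have -> : mint nu U f - mint m U (fun x => f x * sigma x) =
    mint nu U (fun x => f x - h x) - mint m U (fun x => f x * sigma x - h x * sigma x).
  by rewrite !mintB// hE; ring.
have bfh : bounded_meas U (fun x => f x - h x) by exact: bounded_measB.
rewrite (le_trans (ler_normB _ _))//; have -> : e = e / 2 + e / 2 by lra.
apply: lerD.
  rewrite (le_trans (le_norm_mint _ oU bfh))// (le_trans _ dle)//.
  by apply: (mint_le_cst oU nuU) => //; exact: bounded_meas_norm.
have bfhs : bounded_meas U (fun x => f x * sigma x - h x * sigma x) by exact: bounded_measB.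
rewrite (le_trans (le_norm_mint _ oU bfhs))//.
rewrite (@le_trans _ _ (mint m U (fun x => dl * sigma x)))//; last by rewrite mintZ// ms mulr1.
apply: le_mint => //; first exact: bounded_meas_norm.
  by apply: bounded_measM => //; exact: bounded_meas_cst.
move=> x Ux; rewrite -mulrBl normrM (ger0_norm (s0 x Ux)) ler_wpM2r//; [exact: s0|exact: hf].
Qed.

Lemma expectation_law {dO} {Omega : measurableType dO} (P : probability Omega R)
    (Y : {RV P >-> borel R d}) (mu : set (borel R d) -> \bar R) (sigma f : E -> R) (M : R) :
  has_law U L Y mu -> bounded_meas U sigma -> (forall x, U x -> 0 <= sigma x) ->
  (forall A : set (borel R d), measurable A -> mu A = (\int[m]_(x in A `&` U) (sigma x)%:E)%E) ->
  Defs.periodic L f -> (forall x, U x -> {for x, continuous f}) ->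
  (forall x, U x -> `|f x| <= M) ->
  ('E_P[f \o Y] = (mint m U (fun x => f x * sigma x))%:E)%E.
Proof.
move=> [YU YL] bs s0 muE fper cf fM.
have bf : bounded_meas U f by exact: (bounded_meas_continuous oU cf fM).
pose nu : probability (borel R d) R := distribution P Y.
have nuU : nu U = 1%E.
  rewrite /nu /= /distribution /pushforward (_ : Y @^-1` U = setT) ?probability_setT//.
  by apply/seteqP; split => // w _; exact: YU.
rewrite -(@mint_law nu sigma f M)//; last by move=> A mA Aper; rewrite -muE//; exact: YL.
rewrite mint_EFin// unlock.
(* Continuity and boundedness of [f] are known on [U] only; its extension by zero is measurable
   everywhere. *)
pose f' := f \_ U.
have mf' : measurable_fun (setT : set (borel R d)) f' by apply/(measurable_restrictT _ _).1 => //; exact: bf.1.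
have -> : (\int[nu]_(x in (U : set (borel R d))) (f x)%:E = \int[nu]_x (f' x)%:E)%E.
  rewrite [LHS]integral_mkcond; apply: eq_integral => x _.
  by rewrite /f' !patchE; case: ifP.
transitivity (\int[P]_w ((EFin \o f') \o Y) w)%E.
  by apply: eq_integral => w _ /=; rewrite /f' patchE mem_set//; exact: YU.
symmetry; apply: integral_distribution; first exact/measurable_EFinP.
apply: measurable_bounded_integrable => //.
- by apply: le_lt_trans (probability_le1 P measurableT) _; rewrite ltry.
- by apply: measurableT_comp.
- exists `|M|; split; rewrite ?num_real// => x Mx y _ /=.
  rewrite /f' patchE mem_set; last exact: YU.
  by rewrite (le_trans (fM _ (YU y)))// (le_trans (ler_norm _))// ltW.
Qed.

End laws.

(** * Approximation of continuous observables by C^1 ones *)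

(** The building blocks of the approximation. On the torus a bump must be periodic, so the
    prescribed neighbourhood [O] is taken invariant under [L]. *)
Definition has_bumps {R : realType} {d : nat} (U L : set 'rV[R]_d) : Prop :=
  forall q O, U q -> open O -> O q -> (forall x l, L l -> O x -> O (x + l)) ->
  exists phi : 'rV[R]_d -> R, [/\ C1_on U phi, Defs.periodic L phi,
    forall x, U x -> 0 <= phi x <= 1, exists2 N, open N /\ N q & forall x, N x -> phi x = 1 &
    forall x, U x -> ~ O x -> phi x = 0].

Section approximation.
Context {R : realType} {d : nat} {U L : set 'rV[R]_d} {m : probability (borel R d) R}.
Local Notation E := 'rV[R]_d.
Hypothesis ff : flow_facts U L m.
Hypothesis bumps : has_bumps U L.
Variables (f : E -> R) (M : R).
Hypotheses (cf : forall x, U x -> {for x, continuous f}) (f_per : Defs.periodic L f).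
Hypothesis f_M : forall x, U x -> `|f x| <= M.
Let oU : open U := ff_open ff.

Let M0 : 0 <= M.
Proof. by have [x Ux] := ff_nonempty ff; rewrite (le_trans _ (f_M Ux)). Qed.

(* Successive interpolation: each bump pulls the value towards [f q] near [q],
   and all values used at a point are close to [f] there. *)
Let interpolate (phi : E -> E -> R) : seq E -> E -> R :=
  foldr (fun q F x => (1 - phi q x) * F x + phi q x * f q) (cst 0).

Lemma C1_approx_compact (K : set E) (e : R) : compact K -> K `<=` U -> 0 < e ->
  exists F : E -> R, [/\ C1_on U F, Defs.periodic L F, forall x, U x -> `|F x| <= M &
    forall x, K x -> `|F x - f x| <= e].
Proof.
move=> cK KU e0; pose O q : set E := U `&` [set x | `|f x - f q| < e].
have oO q : open (O q).
  rewrite openE => x [Ux fx]; apply: filterI; first exact: open_nbhs_nbhs.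
  apply: (near_lt_at (f := fun x => `|f x - f q|)) => //.
  apply: continuous_at_norm; apply: continuous_atD; first exact: cf.
  exact: continuous_at_cst.
have h q : exists u : (E -> R) * set E, U q -> [/\ C1_on U u.1, Defs.periodic L u.1,
    forall x, U x -> 0 <= u.1 x <= 1, (open u.2 /\ u.2 q) /\ (forall x, u.2 x -> u.1 x = 1) &
    forall x, U x -> ~ O q x -> u.1 x = 0].
  have [Uq|nU] := pselect (U q); last by exists (cst 0, set0).
  have [||phi [h1 h2 h3 [N h4 h5] h6]] := @bumps q (O q) Uq (oO q).
  - by split=> //=; rewrite subrr normr0.
  - move=> x l Ll [Ux fx]; split; first exact: (ff_shift ff).
    by rewrite /= f_per.
  by exists (phi, N).
have [u hu] := choice h; pose phi q := (u q).1.
move: (cK); rewrite compact_cover => /(_ E U (fun q => (u q).2)) [||D DU Dcov].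
- by move=> q /hu[_ _ _ [[]]].
- by move=> x Kx; exists x; [exact: KU|case: (hu x (KU x Kx)) => _ _ _ [[]]].
pose s := finmap.enum_fset D.
have sU q : q \in s -> U q by move=> qs; have := DU q qs; rewrite inE.
exists (interpolate phi s).
(* The invariant of the induction. Where some bump equals 1, the initial value 0 drops out and the
   result is a convex combination of values [f q] within [e] of [f x], since bumps whose [O q]
   misses [x] have no effect there. *)
have main : [/\ C1_on U (interpolate phi s), Defs.periodic L (interpolate phi s),
    forall x, U x -> `|interpolate phi s x| <= M &
    forall x, U x -> (exists2 q, q \in s & phi q x = 1) -> `|interpolate phi s x - f x| <= e].
  elim: (s) sU => [|q l IH] sU'.
    split => //; first exact: C1_along_cst.
    - by move=> x _; rewrite /= normr0.
    - by move=> x _ [].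
  have [|C1 per bd ap] := IH; first by move=> y yl; apply: sU'; rewrite in_cons yl orbT.
  have Uq := sU' q (mem_head _ _).
  have [Cq perq q01 _ q0] := hu q Uq.
  split.
  - apply: (C1_alongD oU).
      apply: (C1_alongM oU _ C1); apply: (C1_alongD oU (C1_along_cst _ _ _)).
      exact: (C1_onN oU Cq).
    exact: (C1_alongM oU Cq (C1_along_cst _ _ _)).
  - move=> x v Lv; rewrite /=.
    by rewrite /phi (perq x v Lv) (per x v Lv).
  - move=> x Ux /=; have /andP[p0 p1] := q01 x Ux.
    rewrite (le_trans (ler_normD _ _))// !normrM (ger0_norm p0) ger0_norm ?subr_ge0//.
    rewrite (@le_trans _ _ ((1 - phi q x) * M + phi q x * M))//; last first.
      by rewrite -mulrDl subrK mul1r.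
    by rewrite lerD// ler_wpM2l ?subr_ge0//; [exact: bd|exact: f_M].
  - move=> x Ux [q' q'l p1] /=; have /andP[pp0 pp1] := q01 x Ux.
    have [Ox|nOx] := pselect (O q x); last first.
      have e1 : phi q x = 0 by exact: q0.
      rewrite e1 subr0 mul1r mul0r addr0; apply: ap => //; exists q' => //.
      move: q'l; rewrite in_cons => /predU1P[E1|//]; exfalso; move: p1; rewrite E1 e1 => /eqP.
      by rewrite eq_sym oner_eq0.
    have fq : `|f q - f x| <= e by case: Ox => _ /ltW; rewrite distrC.
    have [p1'|np1] := eqVneq (phi q x) 1; first by rewrite p1' subrr mul0r add0r mul1r.
    have apx : `|interpolate phi l x - f x| <= e.
      apply: ap => //; exists q' => //; move: q'l; rewrite in_cons => /predU1P[E1|//].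
      by move: np1; rewrite -E1 p1 eqxx.
    have -> : (1 - phi q x) * interpolate phi l x + phi q x * f q - f x =
      (1 - phi q x) * (interpolate phi l x - f x) + phi q x * (f q - f x) by ring.
    rewrite (le_trans (ler_normD _ _))// !normrM (ger0_norm pp0) ger0_norm ?subr_ge0//.
    rewrite (@le_trans _ _ ((1 - phi q x) * e + phi q x * e))//; last first.
      by rewrite -mulrDl subrK mul1r.
    by rewrite lerD// ler_wpM2l// subr_ge0.
have [h1 h2 h3 h4] := main; split=> // x Kx; apply: h4; first exact: KU.
by have [q /= qD qx] := Dcov x Kx; exists q => //; case: (hu q (sU q qD)) => _ _ _ [_ /(_ x qx)].
Qed.

(** The approximations are made on the compact sets [C] intersected with [inner U 1/(n+1)], where
    [C] contains representatives of all points; a given point is moved into [C] by an element of [L]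
    and is eventually inside. *)
Lemma C1_approx : exists F : nat -> E -> R, [/\ forall n, C1_on U (F n),
  forall n, Defs.periodic L (F n), forall n x, U x -> `|F n x| <= M &
  forall x, U x -> F n x @[n --> \oo] --> f x].
Proof.
have [C [cC CU Ccov]] := ff_cover ff.
have h n : exists F : E -> R, [/\ C1_on U F, Defs.periodic L F, forall x, U x -> `|F x| <= M &
    forall x, (C `&` inner U n.+1%:R^-1) x -> `|F x - f x| <= n.+1%:R^-1].
  have n0 : (0 : R) < n.+1%:R^-1 by rewrite invr_gt0.
  apply: C1_approx_compact => //.
    by apply: compact_closedI => //; exact: inner_closed.
  by move=> x [_]; exact: inner_sub.
have [F hF] := choice h; exists F; split; try by move=> n; case: (hF n).
move=> x Ux; have [l Ll Cxl] := Ccov x (subset_closure Ux).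
have Uxl : U (x + l) by exact: (ff_shift ff).
have := oU; rewrite openE => /(_ _ Uxl)/nbhs_ballP[r /= r0 hr].
apply/cvgrPdist_le => e e0; have re : 0 < Num.min r e by rewrite lt_min r0.
have [N _ hN] := near_infty_natSinv_lt (PosNum re).
exists N => // n /= /hN /=; rewrite lt_min => /andP[nr ne].
have [_ per _ ap] := hF n.
rewrite -(f_per x Ll) -(per x l Ll) distrC (le_trans (ap _ _))//; last exact: ltW.
by split=> //; apply: subset_trans hr; apply: le_ball; exact: ltW.
Qed.

End approximation.

Section transport_continuous.
Context {R : realType} {d : nat} {U L V : set 'rV[R]_d} {m : probability (borel R d) R}.
Context {chi : nat -> 'rV[R]_d -> R} {rho : 'rV[R]_d -> R -> R}.
Context {X : 'rV[R]_d -> R -> 'rV[R]_d}.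
Local Notation E := 'rV[R]_d.
Hypothesis H : heat_ctx U L m V chi rho.
Hypothesis bumps : has_bumps U L.
Hypothesis hX : redistribution U L rho X.
Hypothesis rho_pos : forall x t, U x -> 0 < t -> 0 < rho x t.
Let ff := hc_facts H.
Let oU : open U := ff_open ff.

Lemma continuous_X t x : 0 < t -> U x -> {for x, continuous (X ^~ t)}.
Proof.
by move=> t0 Ux; have [cX _ _ _] := redist_regular hX; exact: (jointly_continuous_space oU cX Ux t0).
Qed.

Lemma transport_continuous (f : E -> R) (M t : R) : 0 < t ->
  (forall x, U x -> {for x, continuous f}) -> Defs.periodic L f ->
  (forall x, U x -> `|f x| <= M) ->
  mint m U (fun x => f (X x t) * rho x t) = mint m U (fun x => f x * rho x 0).
Proof.
move=> t0 cf fper fM; have [F [C1F perF FM Ff]] := C1_approx ff bumps cf fper fM.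
have eqF n := transport H hX rho_pos (C1F n) (perF n) (FM n) t0.
have UX x : U x -> U (X x t) by move=> Ux; apply: (redist_U hX) => //; exact: ltW.
have br := bounded_meas_rho H t0; have [mr [B hB]] := br.
have br0 := bounded_meas_rho0 H; have [mr0 [B0 hB0]] := br0.
have c1 : mint m U (fun x => F n (X x t) * rho x t) @[n --> \oo] -->
    mint m U (fun x => f (X x t) * rho x t).
  apply: (mint_cvg oU (M := M * B)).
  - move=> n; apply: measurable_funM => //; apply: (measurable_fun_rV_continuous oU) => x Ux.
    exact: (@continuous_comp E E R (X ^~ t) (F n) x (continuous_X t0 Ux) (C1F n _ (UX x Ux)).1).
  - by move=> n x Ux; rewrite normrM ler_pM ?FM ?hB//; exact: UX.
  - by move=> x Ux; apply: cvgM; [apply: Ff; exact: UX|exact: cvg_cst].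
have c0 : mint m U (fun x => F n x * rho x 0) @[n --> \oo] --> mint m U (fun x => f x * rho x 0).
  apply: (mint_cvg oU (M := M * B0)).
  - move=> n; apply: measurable_funM => //; apply: (measurable_fun_rV_continuous oU) => x Ux.
    exact: (C1F n x Ux).1.
  - by move=> n x Ux; rewrite normrM ler_pM ?FM ?hB0.
  - by move=> x Ux; apply: cvgM; [exact: Ff|exact: cvg_cst].
rewrite -(cvg_lim _ c1)// -(cvg_lim _ c0)//; congr (limn _).
by apply/funext => n; exact: eqF.
Qed.

End transport_continuous.

(** * Measures with constant density *)

Section uniform_measure.
Context {R : realType} {d : nat} {m : probability (borel R d) R}.
Local Notation E := 'rV[R]_d.
Variables (D : set E) (c : R).
Hypothesis mD : measurable (D : set (borel R d)).
Hypothesis hm : forall A : set (borel R d), measurable A ->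
  m A = (c%:E * lebesgue_vol (A `&` D))%E.

Lemma uniform_vol (A : set (borel R d)) : measurable A -> m A = (c%:E * vol R d (A `&` D))%E.
Proof. by move=> mA; rewrite hm// volE//; exact: measurableI. Qed.

Lemma uniform_gt0 : 0 < c.
Proof.
have h : (1 : \bar R)%E = (c%:E * vol R d (setT `&` D))%E.
  by rewrite -uniform_vol// probability_setT.
rewrite ltNge; apply/negP => c0; have : (c%:E * vol R d (setT `&` D) <= 0)%E.
  by rewrite mule_le0_ge0// lee_fin.
by rewrite -h lee_fin ler10.
Qed.

Lemma uniform_le_vol (A : set (borel R d)) : measurable A -> (m A <= c%:E * vol R d A)%E.
Proof.
move=> mA; rewrite uniform_vol//; apply: lee_wpmul2l; first by rewrite lee_fin ltW// uniform_gt0.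
by apply: le_measure; rewrite ?inE//; exact: measurableI.
Qed.

Lemma ge0_integral_uniform (A : set (borel R d)) (f : E -> \bar R) : measurable A ->
  measurable_fun A f -> (forall x, 0 <= f x)%E ->
  (\int[m]_(x in A) f x = c%:E * \int[vol R d]_(x in A `&` D) f x)%E.
Proof.
move=> mA mf f0.
have mAD : measurable (A `\` D) by exact: measurableD.
have mAI : measurable (A `&` D) by exact: measurableI.
have z : m (A `\` D) = 0%E.
  rewrite uniform_vol// (_ : (A `\` D) `&` D = set0) ?measure0 ?mule0//.
  by apply/seteqP; split => // x [[]].
rewrite (ge0_negligible_integral mAD mA mf _ z)//.
have -> : A `\` (A `\` D) = A `&` D by rewrite setDD.
have mf' : measurable_fun (A `&` D) f by apply: (measurable_funS mA _ mf); exact: subIsetl.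
have c0 : 0 <= c by exact: (ltW uniform_gt0).
rewrite -(ge0_integral_mscale (vol R d) mAI (NngNum c0))//.
apply: eq_measure_integral => B mB BAD; transitivity (c%:E * vol R d B)%E; last by [].
apply: (etrans (uniform_vol mB)).
by rewrite setIidl// => x /BAD[].
Qed.

End uniform_measure.

Section generic_facts.
Context {R : realType} {d : nat} {m : probability (borel R d) R}.
Local Notation E := 'rV[R]_d.
Variables (U L : set E).
Hypotheses (oU : open U) (mU1 : m (U : set (borel R d)) = 1%E).
Let mU : measurable (U : set (borel R d)). Proof. exact: open_measurable_rV. Qed.

(** [U] is exhausted by the compact sets [K n]; the indicators of the remainders tend to 0
    pointwise, hence in integral. *)
Lemma tight_open (e : R) : 0 < e -> exists K, [/\ compact K, K `<=` U &
  (m ((U `\` K) : set (borel R d)) <= e%:E)%E].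
Proof.
move=> e0; pose K n : set E := inner U n.+1%:R^-1 `&` [set x | `|0 - x| <= n%:R].
have cK n : compact (K n).
  by rewrite /K setIC; apply: compact_closedI; [exact: compact_cball|exact: inner_closed].
have KU n : K n `<=` U by move=> x [+ _]; apply: inner_sub; rewrite invr_gt0.
have mK n : measurable (K n : set (borel R d)).
  by apply: closed_measurable_rV; apply: compact_closed (cK n); exact: norm_hausdorff.
have mUK n : measurable (U `\` K n : set (borel R d)) by exact: measurableD.
have b1 n : bounded_meas U (\1_(U `\` K n : set (borel R d)) : E -> R).
  split; first exact: measurable_indic.
  by exists 1 => x _; rewrite indicE; case: (_ \in _); rewrite ?normr1 ?normr0.
have cv : mint m U (\1_(U `\` K n : set (borel R d)) : E -> R) @[n --> \oo] --> mint m U (cst 0).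
  apply: (mint_cvg oU (M := 1)).
  - by move=> n; have [] := b1 n.
  - by move=> n x _; rewrite indicE; case: (_ \in _); rewrite ?normr1 ?normr0.
  - move=> x Ux; apply: cvg_near_cst.
    have := oU; rewrite openE => /(_ x Ux)/nbhs_ballP[r /= r0 hr].
    have [N _ hN] := near_infty_natSinv_lt (PosNum r0).
    exists (maxn N (Num.bound `|x|)) => // n /=; rewrite geq_max => /andP[nN nx].
    rewrite indicE memNset// => -[_]; apply; split.
      by apply: subset_trans hr; apply: le_ball; apply: ltW; exact: hN.
    rewrite /= sub0r normrN (le_trans (ltW (archi_boundP _)))// ?ler_nat//.
rewrite (mint_cst oU mU1) in cv.
have /cvgrPdist_le/(_ _ e0)[N _ hN] := cv.
exists (K N); split => //.
have := hN N (leqnn N); rewrite sub0r normrN => /(le_trans (ler_norm _)).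
rewrite -lee_fin mint_EFin// integral_indic// setIidl//.
Qed.

(** Reduction to nonnegative functions by splitting [w] into positive and negative parts, each with
    the same periodicity and support. *)
Lemma trans_of_ge0 :
  (forall (w : E -> R) (r : R) (v : E), Defs.periodic L w -> measurable_fun (setT : set (borel R d)) w ->
    (forall x, 0 <= w x) -> (forall x, ~ inner U r x -> w x = 0) -> `|v| < r ->
    (\int[m]_(x in (U : set (borel R d))) (w (x + v))%:E =
     \int[m]_(x in (U : set (borel R d))) (w x)%:E)%E) ->
  forall (w : E -> R) (r : R) (v : E), Defs.periodic L w -> bounded_meas setT w ->
    (forall x, ~ inner U r x -> w x = 0) -> `|v| < r ->
    mint m U (fun x => w (x + v)) = mint m U w.
Proof.
move=> h w r v wper [mw [M wM]] w0 vr.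
have pos (s : R) : mint m U (fun x => Num.max (s * w (x + v)) 0) = mint m U (fun x => Num.max (s * w x) 0).
  rewrite /mint /Rintegral; congr fine.
  apply: (h (fun x => Num.max (s * w x) 0) r v) => //.
  - by move=> x l Ll; rewrite wper.
  - by apply: measurable_maxr => //; exact: measurable_funM.
  - by move=> x; rewrite le_max lexx orbT.
  - by move=> x nx; rewrite w0// mulr0 maxxx.
have mwv : measurable_fun (setT : set (borel R d)) (fun x => w (x + v)).
  exact: (measurableT_comp mw (measurable_shift v)).
have bd (g : E -> R) (s : R) : measurable_fun (setT : set (borel R d)) g ->
    (forall x, `|g x| <= M) -> bounded_meas U (fun x => Num.max (s * g x) 0).
  move=> mg gM; split.
    apply: (measurable_funS measurableT (@subsetT _ _)).
    by apply: measurable_maxr => //; exact: measurable_funM.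
  exists (`|s| * M) => x _; rewrite ger0_norm ?le_max ?lexx ?orbT//.
  rewrite ge_max mulr_ge0 ?andbT//; last exact: le_trans (gM x).
  by rewrite (le_trans (ler_norm _))// normrM ler_wpM2l.
have split_ (g : E -> R) : measurable_fun (setT : set (borel R d)) g -> (forall x, `|g x| <= M) ->
    mint m U g = mint m U (fun x => Num.max (1 * g x) 0) - mint m U (fun x => Num.max (-1 * g x) 0).
  move=> mg gM; rewrite -mintB; [|exact: oU|exact: bd|exact: bd].
  apply: eq_mint => x _; rewrite mul1r mulN1r.
  by have [g0|g0] := leP 0 (g x); have [h'|h'] := leP 0 (- g x); lra.
rewrite (split_ _ mwv (fun x => wM (x + v) I)) (split_ _ mw (fun x => wM x I)).
by rewrite !pos.
Qed.

End generic_facts.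

Lemma connected_setT {R : realType} {d : nat} : connected (setT : set 'rV[R]_d).
Proof.
have -> : setT = \bigcup_(x in (setT : set 'rV[R]_d)) ((fun s : R => s *: x) @` `[0, 1]%classic).
  apply/seteqP; split => // x _; exists x => //; exists 1 => /=; last by rewrite scale1r.
  by rewrite in_itv /= ler01 lexx.
apply: bigcup_connected.
  by exists 0 => x _; exists 0 => /=; [rewrite in_itv /= lexx ler01|rewrite scale0r].
move=> x _; apply: connected_continuous_connected; first exact: segment_connected.
apply: continuous_subspaceT => s.
have h : s' *: x @[s' --> s] --> s *: x by apply: cvgZr_tmp; exact: cvg_id.
exact: h.
Qed.

(** * The bounded domain *)

Section bounded_domain.
Context {R : realType} {d : nat} {m : probability (borel R d) R}.
Local Notation E := 'rV[R]_d.
Variables (U : set E) (c : R).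
Hypotheses (oU : open U) (U0 : U !=set0) (conU : connected U) (bU : bounded_set U).
Hypothesis hm : forall A : set (borel R d), measurable A ->
  m A = (c%:E * lebesgue_vol (A `&` U))%E.

Let mU : measurable (U : set (borel R d)). Proof. exact: open_measurable_rV. Qed.

Lemma domain_bumps : has_bumps U [set 0].
Proof.
move=> q O Uq oO Oq _; have := oO; rewrite openE => /(_ q Oq)/nbhs_ballP[r /= r0 hr].
have r20 : 0 < r / 2 by rewrite divr_gt0.
have [b [Cb b01 b1 b0]] := bump_exists q r20.
exists b; split.
- exact: (C1_along_sub (@subsetT _ U) Cb).
- by move=> x l ->; rewrite addr0.
- by move=> x _.
- have ob : open (ball q (r / 2)) by exact: ball_open.
  exists (ball q (r / 2)); first by split; [exact: ob|exact: ballxx].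
  by move=> x; rewrite ballE => /b1.
- move=> x Ux nO; apply: b0; rewrite leNgt; apply/negP => h; apply: nO; apply: hr.
  by rewrite ballE /=; move: h; rewrite mulrC divfK.
Qed.

Let ball_integral_le (w : E -> R) (x : E) (r : R) : measurable_fun (U : set (borel R d)) w ->
  (forall x, U x -> 0 <= w x) -> ball x r `<=` U ->
  (\int[vol R d]_(y in (ball x r : set (borel R d))) (w y)%:E <=
       c^-1%:E * \int[m]_(y in (U : set (borel R d))) (w y)%:E)%E.
Proof.
move=> mw w0 hr; have c0 := uniform_gt0 mU hm.
pose w' (y : E) : \bar R := ((w \_ U) y)%:E.
have w'E y : U y -> w' y = (w y)%:E by move=> Uy; rewrite /w' patchE mem_set.
have w'0 y : (0 <= w' y)%E.
  by rewrite /w' patchE lee_fin; case: ifPn => [/set_mem/w0|_].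
have mw' : measurable_fun (setT : set (borel R d)) w'.
  by apply/measurable_EFinP; apply/(measurable_restrictT _ _).1.
have mb : measurable (ball x r : set (borel R d)).
  by apply: open_measurable_rV; exact: ball_open.
have -> : (\int[m]_(y in (U : set (borel R d))) (w y)%:E =
    \int[m]_(y in (U : set (borel R d))) w' y)%E.
  by apply: eq_integral => y /set_mem Uy; rewrite w'E.
rewrite (ge0_integral_uniform mU hm)//; last exact: (measurable_funS measurableT (@subsetT _ _) mw').
rewrite setIid muleA -EFinM mulVf ?gt_eqF// mul1e.
apply: (@le_trans _ _ (\int[vol R d]_(y in (ball x r : set (borel R d))) w' y)%E).
  by rewrite le_eqVlt; apply/orP; left; apply/eqP; apply: eq_integral => y /set_mem /hr Uy; rewrite w'E.
by apply: ge0_subset_integral => //; exact: (measurable_funS measurableT (@subsetT _ _) mw').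
Qed.

Lemma domain_facts : flow_facts U [set 0] m.
Proof.
have c0 := uniform_gt0 mU hm.
have mU1 : m (U : set (borel R d)) = 1%E.
  rewrite (uniform_vol mU hm)// setIid -(probability_setT m).
  by rewrite (uniform_vol mU hm)// setTI.
have l0 : [set 0] (0 : E) by [].
split => //.
- by move=> l ->; rewrite oppr0.
- by move=> x l -> Ux; rewrite addr0.
- exists (closure U); split => //; last by move=> x Ux; exists 0; rewrite ?addr0.
  apply: bounded_closed_compact; last exact: closed_closure.
  have [M [_ hM]] := bU; exists (M + 1); split; first exact: num_real.
  move=> M' MM' x cx /=.
  have cb : closed [set y : E | `|y| <= M'].
    have cn : continuous (fun y : E => `|y|) by exact: norm_continuous.
    by have := (continuous_closedP _).1 cn [set y | y <= M'] (@closed_le R M').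
  have sub : U `<=` [set y : E | `|y| <= M'].
    by move=> y Uy; apply: (hM M' _ y Uy); apply: lt_trans MM'; rewrite ltrDl.
  by have := closure_subset sub cx; rewrite -(closure_id _).1.
- exact: tight_open.
- apply: trans_of_ge0 => // w r v _ mw win0 win vr.
  have r0 : 0 < r by apply: le_lt_trans vr.
  have mwv : measurable_fun (setT : set (borel R d)) (fun x => w (x + v)).
    exact: (measurableT_comp mw (measurable_shift v)).
  have ge (g : E -> R) : measurable_fun (setT : set (borel R d)) g -> (forall x, 0 <= g x) ->
      (\int[m]_(x in (U : set (borel R d))) (g x)%:E =
       c%:E * \int[vol R d]_(x in (U `&` U : set (borel R d))) (g x)%:E)%E.
    move=> mg g0; apply: (ge0_integral_uniform mU hm) => //.
    by apply/measurable_EFinP; exact: (measurable_funS measurableT (@subsetT _ _) mg).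
  rewrite (ge _ mw win0) (ge _ mwv (fun x => win0 (x + v))).
  congr (_ * _)%E; rewrite setIid.
  (* Both [w] and its translate by [|v| < r] vanish outside [U], so the integrals extend to the
     whole space, where volume is translation invariant. *)
  have ext (g : E -> R) : (forall x, ~ U x -> g x = 0) ->
      (\int[vol R d]_(x in (U : set (borel R d))) (g x)%:E = \int[vol R d]_x (g x)%:E)%E.
    move=> g0; rewrite integral_mkcond; apply: eq_integral => x _.
    by rewrite patchE; case: ifPn => // /negP nU; rewrite g0// => Ux; apply: nU; exact/mem_set.
  rewrite !ext.
  + rewrite (ge0_integral_vol_shift v (f := fun x => (w x)%:E))//; first exact/measurable_EFinP.
  + by move=> x nU; rewrite win// => ix; apply: nU; exact: inner_sub ix.
  + move=> x nU; rewrite win// => ix; apply: nU; apply: ix.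
    by rewrite ballE /= addrAC subrr add0r.
- move=> x Ux; have [r /= r0 hr] := (nbhs_ballP _ _).1 (open_nbhs_nbhs (conj oU Ux)).
  exists r, c^-1; split => //; first by rewrite invr_ge0 ltW.
  move=> w _ mw w0.
  exact: (ball_integral_le mw w0 hr).
- exists c; first exact: ltW.
  by move=> A mA; exact: (uniform_le_vol mU hm).
Qed.

End bounded_domain.

(** * The flat torus *)

Section torus.
Context {R : realType} {d : nat} {m : probability (borel R d) R}.
Local Notation E := 'rV[R]_d.
Variables (B : 'M[R]_d) (c : R).
Hypothesis uB : B \in unitmx.
Hypothesis hm : forall A : set (borel R d), measurable A ->
  m A = (c%:E * lebesgue_vol (A `&` cell B))%E.

(** Coordinates in the lattice basis, in which the cell is the unit cube. [lat k] is the lattice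
    vector with integer coordinates [k], and [fl x] is the index of the tile containing [x]. *)
Let S (i : 'I_d) (x : E) : R := (x *m invmx B) 0 i.
Let lat (k : 'rV[int]_d) : E := map_mx intr k *m B.
Let fl (x : E) : 'rV[int]_d := \row_i Num.floor (S i x).

Let SE i x : S i x = \sum_j x 0 j * invmx B j i.
Proof. by rewrite /S mxE. Qed.

Let SD i x y : S i (x + y) = S i x + S i y.
Proof. by rewrite /S mulmxDl mxE. Qed.

Let SN i x : S i (- x) = - S i x.
Proof. by rewrite /S mulNmx mxE. Qed.

Let S_mul i (s : E) : S i (s *m B) = s 0 i.
Proof. by rewrite /S mulmxK. Qed.

Let S_lat i k : S i (lat k) = (k 0 i)%:~R.
Proof. by rewrite S_mul mxE. Qed.

Let latN k : lat (- k) = - lat k.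
Proof. by rewrite /lat -mulNmx; congr (_ *m _); apply/rowP => i; rewrite !mxE mulrNz. Qed.

Let lat_lattice k : lattice B (lat k).
Proof. by exists k. Qed.

Let cellP x : cell B x <-> forall i, 0 <= S i x < 1.
Proof.
split=> [[s hs ->] i|h]; first by rewrite S_mul.
by exists (x *m invmx B) => //; rewrite mulmxKV.
Qed.

Let cell_shift x k : cell B (x - lat k) <-> fl x = k.
Proof.
rewrite cellP; split=> [h|<- i]; last first.
  rewrite SD SN S_lat mxE subr_ge0 ltrBlDr addrC -intrD1.
  exact: floor_itv.
apply/rowP => i; rewrite mxE; apply/eqP; rewrite floor_eq.
have := h i; rewrite SD SN S_lat subr_ge0 ltrBlDr => /andP[-> /=].
by rewrite intrD addrC.
Qed.

Let C1_S i : C1_on setT (S i).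
Proof.
have h : C1_on setT (fun x : E => \sum_j x 0 j * invmx B j i).
  apply: C1_along_sum => [|j]; first exact: openT.
  exact: (C1_alongM openT (C1_on_coord setT j) (C1_along_cst _ _ _)).
by rewrite (_ : S i = fun x : E => \sum_j x 0 j * invmx B j i)//; apply/funext => x; rewrite SE.
Qed.

Let measurable_S i : measurable_fun (setT : set (borel R d)) (S i).
Proof. by apply: (measurable_fun_rV_continuous openT) => x _; exact: (C1_S i I).1. Qed.

Let measurable_cell : measurable (cell B : set (borel R d)).
Proof.
have -> : cell B = \bigcap_(i in [set: 'I_d]) (S i @^-1` `[0, 1[%classic).
  apply/seteqP; split => x; first by move=> /cellP h i _; rewrite /= in_itv /=.
  by move=> h; apply/cellP => i; have := h i I; rewrite /= in_itv.
apply: fin_bigcap_measurable => [|i _]; first exact: finite_finset.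
by rewrite -[X in measurable X]setTI; apply: measurable_S.
Qed.

(** Tiles are numbered by natural numbers through [pickle], so that countable additivity over [nat]
    applies. *)
Let tile_eq (k : 'rV[int]_d) n : pickle k = n -> forall x, pickle (fl x) = n <-> cell B (x - lat k).
Proof.
move=> <- x; rewrite cell_shift; split => [|->//]; exact: (pcan_inj pickleK).
Qed.

Let measurable_cell_shift (v : E) : measurable ([set x | cell B (x + v)] : set (borel R d)).
Proof. by rewrite -[X in measurable X]setTI; exact: (measurable_shift v). Qed.

(* Both sides decompose along the countably many lattice translates. *)
Let torus_translation (w : E -> R) (v : E) : Defs.periodic (lattice B) w ->
  measurable_fun (setT : set (borel R d)) w -> (forall x, 0 <= w x) ->
  (\int[vol R d]_(x in (cell B : set (borel R d))) (w (x + v))%:E =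
   \int[vol R d]_(x in (cell B : set (borel R d))) (w x)%:E)%E.
Proof.
move=> wper mw w0.
have mind (u : E) : measurable_fun (setT : set (borel R d)) (fun y => \1_(cell B) (y + u) : R).
  have m1 : measurable_fun (setT : set (borel R d)) (\1_(cell B : set (borel R d)) : borel R d -> R).
    exact: measurable_indic.
  exact: (measurableT_comp m1 (measurable_shift u)).
have restr (g : E -> R) : (\int[vol R d]_(x in (cell B : set (borel R d))) (g x)%:E =
    \int[vol R d]_x (\1_(cell B) x * g x)%:E)%E.
  rewrite integral_mkcond; apply: eq_integral => x _; rewrite patchE indicE.
  by case: ifP => _; rewrite ?mul1r ?mul0r.
have i1 y : cell B y -> \1_(cell B) y = 1 :> R by move=> By; rewrite indicE mem_set.
have i0 y : ~ cell B y -> \1_(cell B) y = 0 :> R by move=> By; rewrite indicE memNset.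
rewrite !restr.
pose f (y : E) : \bar R := (\1_(cell B) (y - v) * w y)%:E.
pose g (y : E) : \bar R := (\1_(cell B) y * w y)%:E.
have f0 y : (0 <= f y)%E by rewrite lee_fin mulr_ge0.
have g0 y : (0 <= g y)%E by rewrite lee_fin mulr_ge0.
have mf : measurable_fun (setT : set (borel R d)) f.
  by apply/measurable_EFinP; apply: measurable_funM.
have mg : measurable_fun (setT : set (borel R d)) g.
  by apply/measurable_EFinP; apply: measurable_funM.
transitivity (\int[vol R d]_x f x)%E.
  rewrite -(ge0_integral_vol_shift v mf f0); apply: eq_integral => x _.
  by rewrite /f addrK.
rewrite -[RHS]/(\int[vol R d]_x g x)%E.
(* For [pickle k = n], [T n] is the cell moved by [lat k] and [T' n] the cell moved by [v - lat k].
   Substituting [y + lat k] for [y] turns [f] on [T n] into [g] on [T' n], which explains the minus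
   sign. *)
pose T n : set (borel R d) := [set y | pickle (fl y) = n].
pose T' n : set (borel R d) := [set y | pickle (- fl (y - v)) = n].
have TE k n : pickle k = n -> T n = [set x | cell B (x - lat k)].
  by move=> kn; apply/seteqP; split => x /(tile_eq kn).
have T'E k n : pickle k = n -> T' n = [set x | cell B (x + (lat k - v))].
  move=> kn; apply/seteqP; split => x /=.
    move=> E1; have /(pcan_inj pickleK) fk : pickle (- fl (x - v)) = pickle k by rewrite kn.
    rewrite (_ : x + (lat k - v) = x - v - lat (- k)); last by rewrite latN opprK addrAC addrA.
    by apply/cell_shift; rewrite -fk opprK.
  rewrite (_ : x + (lat k - v) = x - v - lat (- k)); last by rewrite latN opprK addrAC addrA.
  by move=> /cell_shift E1; rewrite /T' /= E1 opprK.
have T0 n : (forall k : 'rV[int]_d, pickle k <> n) -> T n = set0 /\ T' n = set0.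
  by move=> h; split; apply/seteqP; split => // x /= /h.
have kn n : (exists k : 'rV[int]_d, pickle k = n) \/ forall k : 'rV[int]_d, pickle k <> n.
  by have [|/forallNP] := pselect (exists k : 'rV[int]_d, pickle k = n); [left|right].
have mT n : measurable (T n) /\ measurable (T' n).
  have [[k kE]|/T0[-> ->]] := kn n; last by split; exact: measurable0.
  by rewrite (TE k)// (T'E k)//; split; exact: measurable_cell_shift.
have bT : \bigcup_n T n = setT by apply/seteqP; split => // x _; exists (pickle (fl x)).
have bT' : \bigcup_n T' n = setT.
  by apply/seteqP; split => // x _; exists (pickle (- fl (x - v))).
have tT : trivIset setT T by move=> i j _ _ [x [/= <- <-]].
have tT' : trivIset setT T' by move=> i j _ _ [x [/= <- <-]].
rewrite -[in LHS]bT -[in RHS]bT'.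
have mf1 : measurable_fun (\bigcup_n T n) f by rewrite bT.
have mg1 : measurable_fun (\bigcup_n T' n) g by rewrite bT'.
rewrite (ge0_integral_bigcup (vol R d) (fun n => (mT n).1) mf1 (fun x _ => f0 x) tT).
rewrite (ge0_integral_bigcup (vol R d) (fun n => (mT n).2) mg1 (fun x _ => g0 x) tT').
apply: eq_eseriesr => n _.
have [[k kE]|/T0[-> ->]] := kn n; last by rewrite !integral_set0.
rewrite (TE k)// (T'E k)//.
pose q (y : E) : \bar R := (\1_(cell B) (y - lat k) * (\1_(cell B) (y - v) * w y))%:E.
have q0 y : (0 <= q y)%E by rewrite lee_fin !mulr_ge0.
have mq : measurable_fun (setT : set (borel R d)) q.
  by apply/measurable_EFinP; apply: measurable_funM => //; apply: measurable_funM.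
transitivity (\int[vol R d]_y q y)%E.
  rewrite [LHS]integral_mkcond; apply: eq_integral => y _; rewrite patchE /q /f.
  case: ifPn => [/set_mem /= h|/negP h]; first by rewrite (i1 _ h) mul1r.
  by rewrite i0 ?mul0r// => h'; apply: h; exact/mem_set.
rewrite -(ge0_integral_vol_shift (lat k) mq q0) [RHS]integral_mkcond.
apply: eq_integral => y _; rewrite patchE /q /g addrK -addrA wper//.
case: ifPn => [/set_mem /= h|/negP h]; first by rewrite (i1 _ h) mul1r.
by rewrite (i0 (y + _)) ?mul0r ?mulr0// => h'; apply: h; exact/mem_set.
Qed.

Let norm_mul_le (A : 'M[R]_d) (x : E) i : `|(x *m A) 0 i| <= `|x| * \sum_j \sum_k `|A j k|.
Proof.
rewrite mxE (le_trans (ler_norm_sum _ _ _))// mulr_sumr; apply: ler_sum => j _.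
rewrite normrM ler_pM ?coord_le_norm//.
by rewrite (bigD1 i)//= lerDl sumr_ge0.
Qed.

Lemma torus_facts : flow_facts setT (lattice B) m.
Proof.
have c0 := uniform_gt0 measurable_cell hm.
have opp l : lattice B l -> lattice B (- l) by move=> [k ->]; exists (- k); rewrite -latN.
have ge (g : E -> R) : measurable_fun (setT : set (borel R d)) g -> (forall x, 0 <= g x) ->
    (\int[m]_(x in (setT : set (borel R d))) (g x)%:E =
     c%:E * \int[vol R d]_(x in (cell B : set (borel R d))) (g x)%:E)%E.
  move=> mg g0; rewrite (ge0_integral_uniform measurable_cell hm)// ?setTI//.
  exact/measurable_EFinP.
split => //.
- exact: openT.
- exact: connected_setT.
- by exists 0.
- exact: probability_setT.
(* A sup-norm bound for the points of the cell; the closed ball of this radius contains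
   representatives of all points. *)
- pose r := \sum_j \sum_k `|B j k|.
  exists [set x | `|0 - x| <= r]; split; first exact: compact_cball.
    by rewrite closureT.
  move=> x _; exists (- lat (fl x)); first exact/opp.
  have [s hs ->] : cell B (x - lat (fl x)) by apply/cell_shift.
  rewrite /= sub0r normrN; apply: norm_rV_le => [|i]; first by rewrite sumr_ge0// => j _; exact: sumr_ge0.
  rewrite (le_trans (norm_mul_le _ _ _))// -[leRHS]mul1r ler_wpM2r//.
    by rewrite sumr_ge0// => j _; exact: sumr_ge0.
  by apply: norm_rV_le => // j; have /andP[? /ltW ?] := hs j; rewrite ger0_norm.
- by move=> e; apply: tight_open; [exact: openT|exact: probability_setT].
- apply: trans_of_ge0; first exact: openT.
  move=> w r v wper mw w0 _ _.
  rewrite (ge _ mw w0) (ge _ (measurableT_comp mw (measurable_shift v)) (fun x => w0 (x + v))).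
  by rewrite torus_translation.
- move=> x _.
  pose K := \sum_j \sum_k `|invmx B j k| + 1.
  have K0 : 0 < K by rewrite ltr_wpDl// sumr_ge0// => j _; exact: sumr_ge0.
  pose r := (2 * K)^-1; have r0 : 0 < r by rewrite invr_gt0 mulr_gt0.
  (* [v] moves the centre of the cell to [x]. A displacement shorter than [r = 1/(2K)] changes each
     lattice coordinate by less than [1/2], so the ball stays inside the moved cell. *)
  pose h : E := const_mx 2^-1; pose v := x - h *m B.
  exists r, c^-1; split => //; first by rewrite invr_ge0 ltW.
  move=> w wper mw w0'; have w0 y : 0 <= w y by exact: w0'.
  rewrite (ge w mw w0) muleA -EFinM mulVf ?gt_eqF// mul1e.
  rewrite -(torus_translation v wper mw w0).
  pose f (y : E) : \bar R := (\1_(cell B) (y - v) * w y)%:E.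
  have f0 y : (0 <= f y)%E by rewrite lee_fin mulr_ge0.
  have mf : measurable_fun (setT : set (borel R d)) f.
    apply/measurable_EFinP; apply: measurable_funM => //.
    have m1 : measurable_fun (setT : set (borel R d)) (\1_(cell B : set (borel R d)) : borel R d -> R).
      exact: measurable_indic.
    exact: (measurableT_comp m1 (measurable_shift (- v))).
  have -> : (\int[vol R d]_(x in (cell B : set (borel R d))) (w (x + v))%:E = \int[vol R d]_y f y)%E.
    rewrite -(ge0_integral_vol_shift v mf f0) integral_mkcond; apply: eq_integral => y _.
    by rewrite /f addrK patchE indicE; case: ifP => _; rewrite ?mul1r ?mul0r.
  have mb : measurable (ball x r : set (borel R d)).
    by apply: open_measurable_rV; exact: ball_open.
  rewrite integral_mkcond; apply: ge0_le_integral => //.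
  + by move=> y _; rewrite patchE; case: ifP => // _; rewrite lee_fin.
  + by apply/(measurable_restrictT _ _).1 => //; apply/measurable_EFinP; exact: (measurable_funS measurableT (@subsetT _ _) mw).
  move=> y _; rewrite patchE; case: ifPn => [/set_mem xy|_]; last exact: f0.
  rewrite /f indicE mem_set ?mul1r//; apply/cellP => i.
  have -> : y - v = (y - x) + h *m B by rewrite /v opprB addrCA addrC.
  rewrite SD S_mul mxE; have hy := norm_mul_le (invmx B) (y - x) i.
  have : `|S i (y - x)| < 2^-1.
    apply: le_lt_trans hy _; apply: (@le_lt_trans _ _ (`|y - x| * K)).
      by rewrite ler_wpM2l// lerDl.
    rewrite -ltr_pdivlMr// -invfM distrC; move: xy; rewrite ballE.
    exact.
  by rewrite ltr_norml => /andP[? ?]; apply/andP; split; lra.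
- exists c; first exact: ltW.
  by move=> A mA; exact: (uniform_le_vol measurable_cell hm).
Qed.

Let cosDint (u : R) (k : int) : cos (2 * pi * (u + k%:~R)) = cos (2 * pi * u).
Proof.
have nat_case (n : nat) (t : R) : cos (2 * pi * (t + n%:R)) = cos (2 * pi * t).
  have := periodicn (@cosD2pi R) n (2 * pi * t) => <-; congr cos.
  by rewrite -(mulr_natr _ n) -(mulr_natr pi 2); ring.
case: k => n; first exact: nat_case.
rewrite NegzE mulrNz -(nat_case n.+1 (u - _)); congr cos; congr (_ * _).
by rewrite subrK.
Qed.

(* [cos] decreases on [0, pi], so a large value of [cos (2 pi u)] forces [u] to
   be close to an integer. *)
Let near_integer (u eta : R) : 0 < eta -> eta <= 4^-1 -> cos (2 * pi * eta) < cos (2 * pi * u) ->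
  exists k : int, `|u - k%:~R| < eta.
Proof.
(* [k] is a nearest integer, so [2 pi |t|] lies in [[0, pi]]. *)
move=> eta0 eta4 h; pose k := Num.floor (u + 2^-1); exists k.
set t := u - k%:~R.
have /andP[k1 k2] := floor_itv (u + 2^-1); rewrite -/k in k1 k2.
have t2 : `|t| <= 2^-1.
  by rewrite ler_norml /t; move: k2; rewrite intrD => k2; apply/andP; split; lra.
have pi0 := pi_gt0 R.
have cE : cos (2 * pi * u) = cos (2 * pi * `|t|).
  have -> : u = t + k%:~R by rewrite /t subrK.
  rewrite cosDint; case: (ger0P t) => t0; first by [].
  by rewrite mulrN cosN.
rewrite cE ltr_cos in h.
- by move: h; rewrite ltr_pM2l// mulr_gt0.
- by rewrite in_itv /= mulr_ge0 ?(ltW eta0) ?mulr_ge0 ?(ltW pi0)//=; nra.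
- by rewrite in_itv /= mulr_ge0 ?mulr_ge0 ?(ltW pi0)//=; nra.
Qed.

(** A product of steps of functions [p i] affine in the cosine of the [i]-th lattice coordinate
    relative to [q]. A nonzero factor forces [p i > 1], so that coordinate is within [eta] of an
    integer; if all are, [x] is close to a lattice translate of [q]. *)
Lemma torus_bumps : has_bumps setT (lattice B).
Proof.
move=> q O _ oO Oq Oper.
have [r0 /= r00 hr0] := (nbhs_ballP _ _).1 (open_nbhs_nbhs (conj oO Oq)).
pose K := \sum_j \sum_k `|B j k| + 1.
have K0 : 0 < K by rewrite ltr_wpDl// sumr_ge0// => j _; exact: sumr_ge0.
(* The bound [1/4] serves [near_integer]; [eta * K <= r0] sends lattice coordinates of size [eta]
   into the ball of radius [r0]. *)
pose eta := Num.min 4^-1 (r0 / K).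
have eta0 : 0 < eta by rewrite lt_min divr_gt0// invr_gt0 ltr0n.
have eta4 : eta <= 4^-1 by rewrite ge_min lexx.
have etaK : eta * K <= r0 by rewrite -ler_pdivlMr// ge_min lexx orbT.
have pi0 := pi_gt0 R.
pose b : R := cos (2 * pi * eta).
have b1 : b < 1.
  rewrite -cos0 /b ltr_cos ?in_itv /= ?lexx ?(ltW pi0) ?mulr_gt0//.
  by rewrite mulr_ge0 ?(ltW eta0) ?mulr_ge0 ?(ltW pi0)//=; nra.
(* Normalised so that [p i] equals 3 at [q], beyond the point 2 where [step] reaches 1. *)
pose a : R := 2 / (1 - b); have a0 : 0 < a by rewrite divr_gt0// subr_gt0.
pose u i (x : E) : R := S i x - S i q.
pose p i (x : E) : R := 1 + a * (cos (2 * pi * u i x) - b).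
have Cu i : C1_on setT (fun x => 2 * pi * u i x).
  apply: (C1_alongM openT (C1_along_cst _ _ _)).
  exact: (C1_alongD openT (@C1_S i) (C1_along_cst _ _ _)).
have dcos (s : R) : setT s -> is_derive s 1 cos (- sin s) by move=> _; exact: is_derive_cos.
have ccos (s : R) : setT s -> {for s, continuous (fun s : R => - sin s)}.
  by move=> _; exact: (@continuous_atN R R s sin (@continuous_sin R s)).
have Cp i : C1_on setT (p i).
  apply: (C1_alongD openT (C1_along_cst _ _ _)); apply: (C1_alongM openT (C1_along_cst _ _ _)).
  apply: (C1_alongD openT _ (C1_along_cst _ _ _)).
  exact: (@C1_along_comp R E 'I_d (@basis_vec R d) setT setT (fun x => 2 * pi * u i x) cos (fun s => - sin s) openT
    (fun x _ => I) dcos ccos (@Cu i)).1.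
exists (fun x => \prod_i step (p i x)); split.
- apply: C1_along_prod => [|i]; first exact: openT.
  exact: (C1_on_step openT (@Cp i)).1.
- move=> x l [k ->]; apply: eq_bigr => i _; congr step; congr (1 + a * (_ - b)).
  rewrite /u -/(lat k) SD S_lat (_ : S i x + (k 0 i)%:~R - S i q = S i x - S i q + (k 0 i)%:~R); last by ring.
  exact: cosDint.
- move=> x _; apply/andP; split; first by apply: prodr_ge0 => i _; exact: step_ge0.
  by apply: prodr_ile1 => i _; rewrite step_ge0 step_le1.
- exists (interior [set x | \prod_i step (p i x) = 1]); last by move=> x /interior_subset.
  split; first exact: open_interior.
  have nb : \forall x \near q, forall i, 2 < p i x.
    have ff := @filter_forall E 'I_d (fun i x => 2 < p i x) (nbhs q); apply: ff => i.
    have cpi := (Cp i q I).1; apply: (near_gt_at cpi).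
    by rewrite /p /u subrr mulr0 cos0 /a divfK ?gt_eqF ?subr_gt0//; lra.
  apply: filterS nb => x hx /=; rewrite big1// => i _; apply: step_eq1.
  exact: ltW.
- move=> x _ nO; apply/eqP; apply: contraT => /prodf_neq0 h; exfalso; apply: nO.
  have hk i : exists k : int, `|u i x - k%:~R| < eta.
    apply: near_integer => //; rewrite -/b.
    have : 1 < p i x.
      rewrite ltNge; apply/negP => p1; have := h i isT; rewrite step_eq0//.
      by rewrite eqxx.
    by rewrite /p ltrDl pmulr_rgt0// subr_gt0.
  have [k hk'] := choice hk.
  pose kr : 'rV[int]_d := \row_i k i.
  rewrite -[x](subrK (lat kr)); apply: Oper; first by exists kr.
  apply: hr0; rewrite ballE /=.
  have -> : q - (x - lat kr) = (\row_i (S i q - S i x + (k i)%:~R)) *m B.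
    rewrite -[LHS](mulmxKV uB); congr (_ *m B); apply/rowP => i.
    rewrite -[LHS]/(S i (q - (x - lat kr))) SD SN SD SN S_lat !mxE; ring.
  pose w : E := \row_i (S i q - S i x + (k i)%:~R).
  have wn : `|w| <= eta.
    apply: norm_rV_le => [|i]; first exact: ltW.
    rewrite -normrN (_ : - w 0 i = u i x - (k i)%:~R); last by rewrite mxE /u; ring.
    by apply: ltW; exact: hk'.
  apply: (@le_lt_trans _ _ (eta * (K - 1))).
    apply: norm_rV_le => [|i].
      rewrite mulr_ge0 ?(ltW eta0)// /K addrK sumr_ge0// => j _; exact: sumr_ge0.
    rewrite (le_trans (norm_mul_le _ _ _))// /K addrK ler_wpM2r//.
    by rewrite sumr_ge0// => j _; exact: sumr_ge0.
  by apply: lt_le_trans etaK; rewrite ltr_pM2l// gtrBl.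
Qed.

End torus.

(** * Convergence in distribution *)

Section conclusion.
Context {R : realType} {d : nat} {U L V : set 'rV[R]_d} {m : probability (borel R d) R}.
Context {chi : nat -> 'rV[R]_d -> R} {rho0 : 'rV[R]_d -> R} {rho : 'rV[R]_d -> R -> R}.
Context {X : 'rV[R]_d -> R -> 'rV[R]_d}.
Local Notation E := 'rV[R]_d.
Hypothesis H : heat_ctx U L m V chi rho.
Hypothesis bumps : has_bumps U L.
Hypothesis hrho0 : smooth_density U L m rho0.
Hypothesis init : forall x, U x -> rho x 0 = rho0 x.
Hypothesis hX : redistribution U L rho X.
Let ff := hc_facts H.
Let oU : open U := ff_open ff.
Let mU1 := ff_mU ff.
Let mU : measurable (U : set (borel R d)). Proof. exact: open_measurable_rV. Qed.

(** The initial lower bound persists by [initial_barrier]. Positivity is what gives the velocity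
    [- grad (ln rho)] its meaning in the transport equation. *)
Lemma rho_gt0 x t : U x -> 0 < t -> 0 < rho x t.
Proof.
move=> Ux t0; have [c c0 hc] := density_lower_bound hrho0.
have : c + (-1) * rho x t <= 0.
  by apply: (initial_barrier H) => // y Uy; rewrite init//; have := hc y Uy; lra.
lra.
Qed.

Lemma weak_convergence {dY dZ} {OmegaY : measurableType dY} (PY : probability OmegaY R)
    (Y : {RV PY >-> borel R d}) {OmegaZ : measurableType dZ} (PZ : probability OmegaZ R)
    (Z : {RV PZ >-> borel R d}) :
  has_law U L Y (fun A => (\int[m]_(x in A `&` (U : set (borel R d))) (rho0 x)%:E)%E) ->
  has_law U L Z m ->
  cvg_in_distribution U L PZ (fun t w => X (Z w) t) PY Y.
Proof.
move=> hY hZ f cf_ [M hM] fper.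
have cf x : U x -> {for x, continuous f}.
  move=> Ux; move: cf_; rewrite continuous_open_subspace// => h; apply: h; exact/mem_set.
have b0 := bounded_meas_rho0 H.
have E0 : mint m U (fun x => f x * rho x 0) = mint m U (fun x => f x * rho0 x).
  by apply: eq_mint => x Ux; rewrite init.
have brho0 : bounded_meas U rho0.
  have [_ [B hB]] := b0; apply: (bounded_meas_continuous oU (M := B)) => x Ux.
    exact: (density_smooth hrho0 0%N).1.
  by rewrite -init// hB.
have mass : mint m U (rho ^~ 0) = 1.
  rewrite (@eq_mint _ _ m U (rho ^~ 0) rho0)//.
  by apply: EFin_inj; rewrite mint_EFin//; exact: (density_mass hrho0).
have EY : ('E_PY[f \o Y] = (mint m U (fun x => f x * rho x 0))%:E)%E.
  rewrite E0; apply: (expectation_law ff hY brho0 _ _ fper cf hM) => // x Ux.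
  have [c c0 hc] := density_lower_bound hrho0.
  exact: le_trans (ltW c0) (hc x Ux).
rewrite EY.
have M0 : 0 <= M by have [x Ux] := ff_nonempty ff; rewrite (le_trans _ (hM x Ux)).
have UX x t : 0 < t -> U x -> U (X x t).
  by move=> t0 Ux; apply: (redist_U hX) => //; exact: ltW.
pose ft t : E -> R := fun x => f (X x t).
have cft t (x : E) : 0 < t -> U x -> {for x, continuous (ft t)}.
  move=> t0 Ux; have UXx := UX x t t0 Ux.
  exact: (@continuous_comp E E R (X ^~ t) f x (continuous_X H hX t0 Ux) (cf _ UXx)).
have ftM t x : 0 < t -> U x -> `|f (X x t)| <= M by move=> t0 Ux; apply: hM; exact: UX.
have bft t : 0 < t -> bounded_meas U (fun x => f (X x t)).
  by move=> t0; apply: (bounded_meas_continuous oU (M := M)) => x Ux; [exact: cft|exact: ftM].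
have EZ t : 0 < t -> ('E_PZ[f \o (fun w => X (Z w) t)] = (mint m U (fun x => f (X x t)))%:E)%E.
  move=> t0; have -> : mint m U (fun x => f (X x t)) = mint m U (fun x => f (X x t) * cst 1 x).
    by apply: eq_mint => x _; rewrite mulr1.
  apply: (expectation_law ff (f := ft t) hZ (bounded_meas_cst _ 1) _ _ _ (fun x => @cft t x t0) (fun x => @ftM t x t0)).
  - by move=> x _; exact: ler01.
  (* The law of [Z] has density 1: [m] gives no mass to the complement of [U]. *)
  - move=> A mA; have mAU : measurable (A `&` U) by exact: measurableI.
    have -> : (\int[m]_(x in A `&` (U : set (borel R d))) (cst 1 x)%:E = m (A `&` U))%E.
      by rewrite -[RHS]mul1e -integral_cst.
    have mAD : measurable (A `\` U) by exact: measurableD.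
    have z : m (A `\` U) = 0%E.
      apply: (subset_measure0 mAD (measurableC mU)) => [x []//|].
      by apply: (etrans (probability_setC m mU)); apply: (etrans (congr1 (fun u => 1 - u)%E mU1)); rewrite subee.
    by apply: (etrans (measureDI m mA mU)); apply: (etrans (congr1 (fun u => u + _)%E z)); rewrite add0e.
  - by move=> x l Ll; rewrite /ft (redist_equivariant hX x Ll (ltW t0)) fper.
apply: cvg_trans.
  apply: (@near_eq_cvg _ _ _ _ (fun t => (mint m U (fun x => f (X x t)))%:E)).
  by near=> t; rewrite EZ.
apply: cvg_EFin; first exact: nearW.
apply/cvgrPdist_le => e e0.
have e1 : 0 < e / (M + 1) by rewrite divr_gt0// ltr_wpDl.
have [T hT] := heat_converges H mass e1.
near=> t.
have t0 : 0 < t by near: t; exact: nbhs_pinfty_gt.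
have Tt : T <= t by near: t; apply: nbhs_pinfty_ge; exact: num_real.
(* Both expectations become integrals of the same function [f(X_t)], against the densities [rho_t]
   and 1. *)
rewrite -(transport_continuous H bumps hX rho_gt0 t0 cf fper hM) /=.
have br := bounded_meas_rho H t0.
have bfr : bounded_meas U (fun x => f (X x t) * rho x t) by apply: bounded_measM => //; exact: bft.
rewrite -mintB//; last exact: bft.
have b1 : bounded_meas U (fun x => rho x t - 1).
  by apply: bounded_measB => //; exact: bounded_meas_cst.
have bb : bounded_meas U (fun x => f (X x t) * rho x t - f (X x t)).
  by apply: bounded_measB => //; exact: bft.
rewrite (le_trans (le_norm_mint _ oU bb))//.
rewrite (@le_trans _ _ (mint m U (fun x => (M + 1) * `|rho x t - 1|)))//.
  apply: le_mint => //; first exact: bounded_meas_norm.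
    by apply: bounded_measM => //; [exact: bounded_meas_cst|exact: bounded_meas_norm].
  move=> x Ux; rewrite -[X in _ - X]mulr1 -mulrBr normrM ler_wpM2r//.
  by rewrite (le_trans (ftM t x t0 Ux))// lerDl.
rewrite mintZ//; last exact: bounded_meas_norm.
by rewrite mulrC -ler_pdivlMr ?ltr_wpDl//; exact: hT.
Unshelve. all: by end_near. Qed.

End conclusion.

(** The Neumann condition speaks of the unit normal given by a defining function [phi]. Removing the
    positive normalising factor leaves [grad phi . grad rho = 0], the tangency that [domain_cutoffs]
    requires for every local defining function. *)
Lemma bounded_domain_cutoffs {R : realType} {d : nat} (U : set 'rV[R]_d)
    (m : probability (borel R d) R) (rho0 : 'rV[R]_d -> R) (rho : 'rV[R]_d -> R -> R)
    (V : set 'rV[R]_d) :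
  flow_facts U [set 0] m -> C1_boundary U -> heat_flow U [set 0] rho0 rho ->
  open V -> closure U `<=` V -> C2_1 V [set t | 0 < t] rho ->
  exists chi, cutoffs U [set 0] m (fun i x t => partial i (rho ^~ t) x) chi.
Proof.
move=> ff CU hrho oV UV hC; have [[h1 h2 h3 h4] h5] := hC.
apply: (domain_cutoffs ff CU oV UV) => [i|]; first exact: (h4 i).2.
move=> p phi t bp lphi t0.
have Vp : V p by apply: UV; case: bp.
have C1r : C1_on V (rho ^~ t).
  move=> x Vx; split; first exact: (jointly_continuous_space oV h1 Vx t0).
  move=> i; split; first exact: (h4 i).1.
  exact: (jointly_continuous_space oV (h4 i).2 Vx t0).
have g0 : grad phi p != 0 by have [W [_ Wp _ gW _]] := lphi; exact: gW.
pose k := (Num.sqrt (dot (grad phi p) (grad phi p)))^-1.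
have dot0 : 0 < dot (grad phi p) (grad phi p).
  have ge0 i : 0 <= grad phi p 0 i * grad phi p 0 i by rewrite -expr2 sqr_ge0.
  rewrite lt_neqAle sumr_ge0 ?andbT//; apply: contra g0; rewrite eq_sym => /eqP s0.
  apply/eqP/rowP => i; rewrite [RHS]mxE; apply/eqP.
  have := psumr_eq0P (fun i (_ : true) => ge0 i) s0 => /(_ i isT)/eqP.
  by rewrite mulf_eq0 orbb.
have k0 : k != 0 by rewrite invr_eq0 gt_eqF// sqrtr_gt0.
have := heat_neumann hrho bp (ex_intro2 _ _ phi lphi erefl) t0.
rewrite -/k (C1_on_derive _ oV Vp C1r).2 => E0.
apply: (mulfI k0); rewrite mulr0; apply: etrans E0; rewrite mulr_sumr; apply: eq_bigr => i _.
by rewrite !mxE mulrA.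
Qed.

Lemma torus_cutoffs {R : realType} {d : nat} (L : set 'rV[R]_d)
    (m : probability (borel R d) R) (G : 'I_d -> 'rV[R]_d -> R -> R) :
  m (setT : set (borel R d)) = 1%E -> cutoffs setT L m G (fun _ => cst 1).
Proof.
move=> m1; split.
- by move=> n; split; [by []|exact: C1_along_cst].
- by move=> n x _; rewrite /= ler01 lexx.
- by move=> x _; exact: cvg_cst.
(* Vacuous: [inner setT 1] is the whole space. *)
- by move=> n; exists 1 => // x _ [].
- move=> a b e a0 e0; exists 0%N => n t _ _.
  rewrite (_ : (fun x => _) = cst 0) ?(mint_cst openT m1) ?ltW//.
  apply/funext => x; rewrite big1 ?normr0// => i _.
  by rewrite /partial derive_cst mul0r.
Qed.

Theorem theorem2p1 (R : realType) (d : nat) (d_gt0 : (0 < d)%N)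
  (U L D : set 'rV[R]_d) (hU : flow_space U L D)
  (m : probability (borel R d) R) (hm : uniform_on D m)
  (rho0 : 'rV[R]_d -> R) (hrho0 : smooth_density U L m rho0)
  (rho : 'rV[R]_d -> R -> R) (hrho : heat_flow U L rho0 rho)
  (X : 'rV[R]_d -> R -> 'rV[R]_d) (hX : redistribution U L rho X)
  (dY : measure_display) (OmegaY : measurableType dY)
  (PY : probability OmegaY R) (Y : {RV PY >-> borel R d})
  (hY : has_law U L Y
     (fun A => (\int[m]_(x in A `&` (U : set (borel R d))) (rho0 x)%:E)%E))
  (dZ : measure_display) (OmegaZ : measurableType dZ)
  (PZ : probability OmegaZ R) (Z : {RV PZ >-> borel R d})
  (hZ : has_law U L Z m) :
  cvg_in_distribution U L PZ (fun t w => X (Z w) t) PY Y.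
Proof.
have [V [oV UV hC]] := heat_regular hrho.
have [chi [ff [bumps cut]]] : exists chi, flow_facts U L m /\ has_bumps U L /\
    cutoffs U L m (fun i x t => partial i (rho ^~ t) x) chi.
  case: hU hm hrho UV => [W oW W0 cW bW CW|B uB] [c hc] hrho' UV'.
    have ff := domain_facts oW W0 cW bW hc.
    have [chi hchi] := bounded_domain_cutoffs ff CW hrho' oV UV' hC.
    by exists chi; split => //; split => //; exact: domain_bumps.
  exists (fun _ => cst 1); split; first exact: (torus_facts uB hc).
  split; first exact: torus_bumps.
  by apply: torus_cutoffs; exact: probability_setT.
have H : heat_ctx U L m V chi rho.
  split => //.
  - exact: heat_continuous hrho.
  - exact: heat_periodic hrho.
  - exact: heat_equation hrho.
exact: (weak_convergence H bumps hrho0 (heat_initial hrho) hX hY hZ).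
Qed.
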